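(* Fix $\eta>0$. There is a constant $C>0$ depending only on $\eta$ such that the following holds for every $\delta>0$ and every $\delta$-isoradial graph with rhombi angles in $[\eta,\pi-\eta]$. Take $v_0\in\Lambda=\Gamma\cup\Gamma^*$, $R>0$, and let $F:B^\delta_\diamondsuit(v_0,R)\to\mathbb C$ be an s-holomorphic function. Define $H=\mathrm{Im}\int^\delta(F(z))^2d^\delta z$ on the vertices of the rhombi with centers in $B^\delta_\diamondsuit(v_0,R)$ by $$H(u)-H(w)=2\delta\cdot\big|\mathrm{Proj}\big[F(z);[i(w-u)]^{-\frac12}\big]\big|^2$$ for every edge $[uw]$ ($u\in\Gamma$, $w\in\Gamma^*$) of a rhombus with center $z\in B^\delta_\diamondsuit(v_0,R)$, with the additive constant chosen so that $H\ge0$ everywhere on $B^\delta_\Lambda(v_0,R)$. Then $$H(v_1)\le C\cdot H(v_0)\quad\text{for any }v_1\in\Lambda\text{ in the disc }B(v_0,\tfrac12R).$$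
   Context: **Lattice.** A planar graph $\Gamma$ embedded in $\mathbb C$ is $\delta$-isoradial if each face is inscribed in a circle of radius $\delta$; the circle centers are assumed to lie inside the faces and are the vertices of the dual graph $\Gamma^*$. $\Lambda=\Gamma\cup\Gamma^*$, with edges $[uw]$ joining $u\in\Gamma$ to the center $w\in\Gamma^*$ of an incident face; the faces of $\Lambda$ are rhombi with side $\delta$, and $\diamondsuit$ is the set of rhombi centers. **Discrete disc.** $B^\delta_\diamondsuit(v_0,R)$ is the set of centers of the rhombi having at least one vertex in the open disc $B(v_0,R)=\{|v-v_0|<R\}$, and $B^\delta_\Lambda(v_0,R)$ is the set of all vertices of these rhombi. $z_0\sim z_1$ if the corresponding rhombi share an edge of $\Lambda$. **s-holomorphicity.** $\mathrm{Proj}[X;u]=\frac X2+\frac{\overline Xu^2}{2|u|^2}$ is the orthogonal projection of $X$ on $u\mathbb R$. $F$ is s-holomorphic if $\mathrm{Proj}[F(z_0);[i(w-u)]^{-1/2}]=\mathrm{Proj}[F(z_1);[i(w-u)]^{-1/2}]$ for all $z_0\sim z_1$ in its domain with common edge $[uw]$, $u\in\Gamma$, $w\in\Gamma^*$. (For such $F$ the function $H$ is well defined up to an additive constant.) *)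

(* Defs.v *)
From mathcomp Require Import all_boot all_order all_algebra.
From mathcomp Require Import all_classical all_reals all_analysis.
From mathcomp Require Import complex.

Set Implicit Arguments.
Unset Strict Implicit.
Unset Printing Implicit Defensive.

Import Order.TTheory GRing.Theory Num.Theory.
Import numFieldNormedType.Exports.

Local Open Scope ring_scope.
Local Open Scope classical_set_scope.

(* The complex plane, seen as a numClosedFieldType so that the field structure,
   sqrtC and the norm topology are all inferred from the same head. *)
Definition cplx (R : realType) : numClosedFieldType := R[i].

Definition rc {R : realType} (t : R) : cplx R := Complex t 0.

(* The generic constant 'i of ssrnum is only characterised by 'i ^+ 2 = -1;
   the sign matters for s-holomorphicity, hence the explicit 0 + 1i. *)
Definition ii {R : realType} : cplx R := Complex 0 1.

(* The modulus, as an element of R (the norm `|z| of R[i] lies in R[i]). *)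
Definition cabs {R : realType} (z : cplx R) : R := complex.Re `|z|.

(* Unoriented angle between two nonzero vectors, in [0, pi]. *)
Definition angle {R : realType} (a b : cplx R) : R :=
  acos (complex.Re (a * b^* : cplx R) / (cabs a * cabs b)).

Definition segment {R : realType} (a b : cplx R) : set (cplx R) :=
  [set x | exists t : R, [/\ 0 <= t, t <= 1 & x = a + rc t * (b - a)]].

(* Graphs drawn in the plane with straight edges. *)
Record geom_graph (R : realType) := GeomGraph {
  gvert : set (cplx R);
  gedge : cplx R -> cplx R -> Prop
}.

Record plane_graph {R : realType} (G : geom_graph R) : Prop := PlaneGraph {
  plane_vert : forall a b, gedge G a b -> gvert G a /\ gvert G b;
  plane_irrefl : forall a, ~ gedge G a a;
  plane_sym : forall a b, gedge G a b -> gedge G b a;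
  plane_vertex_edge : forall a b v, gedge G a b -> gvert G v ->
    segment a b v -> v = a \/ v = b;
  plane_noncrossing : forall a b c d x, gedge G a b -> gedge G c d ->
    segment a b x -> segment c d x ->
    [\/ gvert G x, a = c /\ b = d | a = d /\ b = c];
  plane_finite_vert : forall r : R,
    finite_set [set v | gvert G v /\ cabs v <= r];
  plane_finite_edge : forall r : R,
    finite_set [set e : cplx R * cplx R | gedge G e.1 e.2 /\
                  exists2 x, segment e.1 e.2 x & cabs x <= r]
}.

Definition drawing {R : realType} (G : geom_graph R) : set (cplx R) :=
  [set x | gvert G x \/ exists a b, gedge G a b /\ segment a b x].

Definition face {R : realType} (G : geom_graph R) (f : set (cplx R)) : Prop :=
  exists2 x, (~` drawing G) x & f = connected_component (~` drawing G) x.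

Definition face_vert {R : realType} (G : geom_graph R) (f : set (cplx R)) :
  set (cplx R) := gvert G `&` closure f.

Definition inscribed {R : realType} (delta : R) (G : geom_graph R)
    (f : set (cplx R)) (w : cplx R) : Prop :=
  (forall x, f x -> cabs (x - w) <= delta) /\
  (forall v, face_vert G f v -> cabs (v - w) = delta).

(* Every face is required to be inscribed in a circle, so there is no unbounded
   face: the graph fills the whole plane. *)
Definition isoradial {R : realType} (delta : R) (G : geom_graph R) : Prop :=
  plane_graph G /\
  forall f, face G f -> exists2 w, f w & inscribed delta G f w.

Definition face_center {R : realType} (delta : R) (G : geom_graph R)
    (f : set (cplx R)) (w : cplx R) : Prop :=
  [/\ face G f, f w & inscribed delta G f w].

Definition dual_vert {R : realType} (delta : R) (G : geom_graph R) :
  set (cplx R) := [set w | exists f, face_center delta G f w].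

Definition incident {R : realType} (delta : R) (G : geom_graph R)
    (u w : cplx R) : Prop :=
  exists2 f, face_center delta G f w & face_vert G f u.

Definition Lambda {R : realType} (delta : R) (G : geom_graph R) :
  geom_graph R :=
  GeomGraph (gvert G `|` dual_vert delta G)
            (fun a b => incident delta G a b \/ incident delta G b a).

(* u, w, u', w' are the consecutive corners of a rhombus, with u, u' in Gamma
   and w, w' in Gamma^*. *)
Definition rhombus {R : realType} (delta : R) (G : geom_graph R)
    (u w u' w' : cplx R) : Prop :=
  [/\ gvert G u /\ gvert G u', dual_vert delta G w /\ dual_vert delta G w',
      u <> u', w <> w' &
      exists2 f, face (Lambda delta G) f &
                 face_vert (Lambda delta G) f = [set u; w; u'; w']].

Definition rhombi_angles_in {R : realType} (delta : R) (G : geom_graph R)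
    (lo hi : R) : Prop :=
  forall u w u' w', rhombus delta G u w u' w' ->
    (lo <= angle (w - u) (w' - u) <= hi) /\
    (lo <= angle (u - w) (u' - w) <= hi).

(* [uw] is an edge, with u in Gamma and w in Gamma^*, of the rhombus centered
   at z.  A rhombus is identified with its center, an element of R[i]. *)
Definition rhombus_edge {R : realType} (delta : R) (G : geom_graph R)
    (z u w : cplx R) : Prop :=
  exists u' w', rhombus delta G u w u' w' /\ z = (u + u') / 2.

Definition rhombus_vert {R : realType} (delta : R) (G : geom_graph R)
    (z v : cplx R) : Prop :=
  exists x, rhombus_edge delta G z v x \/ rhombus_edge delta G z x v.

Definition Bdiamond {R : realType} (delta : R) (G : geom_graph R)
    (v0 : cplx R) (r : R) : set (cplx R) :=
  [set z | exists2 v, rhombus_vert delta G z v & cabs (v - v0) < r].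

Definition BLambda {R : realType} (delta : R) (G : geom_graph R)
    (v0 : cplx R) (r : R) : set (cplx R) :=
  [set v | exists2 z, Bdiamond delta G v0 r z & rhombus_vert delta G z v].

Definition Proj {R : realType} (X u : cplx R) : cplx R :=
  X / 2 + X^* * u ^+ 2 / (2 * `|u| ^+ 2).

(* [i (w - u)]^{-1/2}; Proj does not depend on the branch of the root. *)
Definition edge_dir {R : realType} (u w : cplx R) : cplx R :=
  (sqrtC (ii * (w - u)))^-1.

(* Functions on a set D of rhombi centers are total functions of which only the
   values on D are used. *)
Definition s_holomorphic {R : realType} (delta : R) (G : geom_graph R)
    (D : set (cplx R)) (F : cplx R -> cplx R) : Prop :=
  forall z0 z1 u w, D z0 -> D z1 ->
    rhombus_edge delta G z0 u w -> rhombus_edge delta G z1 u w ->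
    Proj (F z0) (edge_dir u w) = Proj (F z1) (edge_dir u w).

(* H is a discrete primitive Im \int (F(z))^2 dz over the rhombi in D. *)
Definition Im_int_sq {R : realType} (delta : R) (G : geom_graph R)
    (D : set (cplx R)) (F : cplx R -> cplx R) (H : cplx R -> R) : Prop :=
  forall z u w, D z -> rhombus_edge delta G z u w ->
    H u - H w = 2 * delta * cabs (Proj (F z) (edge_dir u w)) ^+ 2.

(* Main.v *)
(* Across a rhombus, [H] at opposite points of [Gamma] is comparable, and
   [H w <= H u] on every edge [[uw]].  Going once around the face of a center [w]
   changes the sign of the square roots [[i (w - u)]^(-1/2)], so that some rhombus at
   [w] satisfies [delta * |F|^2 <= C * H w]; hence [H <= C * H w] at all corners of
   the face.  This controls [H] at distances [O(delta)] from [v0].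

   At larger scales, [H] is subharmonic on [Gamma] and superharmonic on [Gamma^*]
   for the isoradial Laplacian, which is exact on quadratic polynomials.
   Cut-off logarithmic barriers bound [H] at a point of [Gamma] by its average on a
   ball of size comparable to [R], and the sum of [H] over a larger ball of [Gamma^*]
   by its sum over the [O(delta)]-neighbourhood of a point of [Gamma^*] next to
   [v0].  The sums over [Gamma] and [Gamma^*] compare by the first step. *)

Require Import Defs.
From mathcomp Require Import all_boot all_order all_algebra.
From mathcomp Require Import all_classical all_reals all_analysis.
From mathcomp Require Import complex.
From mathcomp Require Import ring lra.

Import Order.TTheory GRing.Theory Num.Theory.
Import numFieldNormedType.Exports.

Local Open Scope ring_scope.
Local Open Scope classical_set_scope.

Set Implicit Arguments.
Unset Strict Implicit.
Unset Printing Implicit Defensive.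

(** Faces are only given as connected components of the complement of the drawing, so the cyclic
    order of the corners of a face, the two faces along an edge and the fact that rhombi are faces
    of [Lambda] all have to be derived. The inscribed circles make faces convex, after which
    everything reduces to side tests by cross products.

    Neither colour class has a Harnack inequality of its own: subharmonicity only bounds a value by
    averages, superharmonicity only averages by a value. The potential theory is done once, for an
    abstract [colour_class]; multiplying [F] by i exchanges the subharmonic and superharmonic cases.

    The Laplacian is exact only up to degree two, so the cubic Taylor remainder of the logarithm
    leaves an error of relative size delta / distance, too large next to the pole. Hence the squared
    distance is shifted by [a ^+ 2] with [a] at least 1000 delta, and the barriers carry a
    correction whose coefficient 448 delta / S is tuned to dominate that error. *)

Notation Re := complex.Re.
Notation Im := complex.Im.

(** * Plane geometry *)

Section Plane.
Variable R : realType.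
Implicit Types (a b c x y z : cplx R) (t : R) (A B : set (cplx R)).

Lemma cplx_eq a b : Re a = Re b -> Im a = Im b -> a = b.
Proof. by case: a b => [? ?] [? ?] /= -> ->. Qed.

Lemma cReD a b : Re (a + b) = Re a + Re b.
Proof. by case: a b => [? ?] [? ?]. Qed.
Lemma cImD a b : Im (a + b) = Im a + Im b.
Proof. by case: a b => [? ?] [? ?]. Qed.
Lemma cReN a : Re (- a) = - Re a. Proof. by case: a. Qed.
Lemma cImN a : Im (- a) = - Im a. Proof. by case: a. Qed.
Lemma cReM a b : Re (a * b) = Re a * Re b - Im a * Im b.
Proof. by case: a b => [? ?] [? ?]. Qed.
Lemma cImM a b : Im (a * b) = Re a * Im b + Im a * Re b.
Proof. by case: a b => [? ?] [? ?]. Qed.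
Lemma conjcE a : a^* = Complex (Re a) (- Im a) :> cplx R.
Proof. by case: a. Qed.
Lemma invcE a : a^-1 = Complex (Re a / (Re a ^+ 2 + Im a ^+ 2))
  (- Im a / (Re a ^+ 2 + Im a ^+ 2)) :> cplx R.
Proof. by case: a => u v; rewrite /= mulNr. Qed.
Lemma normcE a : `|a| = rc (Num.sqrt (Re a ^+ 2 + Im a ^+ 2)) :> cplx R.
Proof. by case: a. Qed.
Lemma ltcRE a b : (a < b) = (Im b == Im a) && (Re a < Re b).
Proof. by case: a => u v; case: b. Qed.
Lemma two_rc : 2 = rc 2 :> cplx R.
Proof. by rewrite -[2]/(1 + 1); apply: cplx_eq; rewrite ?cReD ?cImD /= ?addr0. Qed.

Lemma Re_half a : Re (a / 2) = Re a / 2.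
Proof. by rewrite two_rc cReM invcE /=; field. Qed.
Lemma Im_half a : Im (a / 2) = Im a / 2.
Proof. by rewrite two_rc cImM invcE /=; field. Qed.

Definition cE := (Re_half, Im_half, cReD, cImD, cReN, cImN, cReM, cImM).

Definition dot a b := Re a * Re b + Im a * Im b.
Definition crs a b := Re a * Im b - Im a * Re b.
Definition nrm2 a := Re a ^+ 2 + Im a ^+ 2.
Definition lerp a b t : cplx R := a + rc t * (b - a).

Lemma Re_lerp a b t : Re (lerp a b t) = Re a + t * (Re b - Re a).
Proof. by rewrite /lerp !cE /=; ring. Qed.
Lemma Im_lerp a b t : Im (lerp a b t) = Im a + t * (Im b - Im a).
Proof. by rewrite /lerp !cE /=; ring. Qed.

Lemma nrm2_ge0 a : 0 <= nrm2 a.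
Proof. by rewrite addr_ge0 // sqr_ge0. Qed.

Lemma nrm2_eq0 a : nrm2 a = 0 -> a = 0.
Proof.
move/eqP; rewrite /nrm2 paddr_eq0 ?sqr_ge0// !sqrf_eq0 => /andP[/eqP h1 /eqP h2].
exact: cplx_eq.
Qed.

Lemma nrm2_gt0 a : a <> 0 -> 0 < nrm2 a.
Proof. by move=> h; rewrite lt_neqAle nrm2_ge0 andbT; apply/eqP => /esym/nrm2_eq0. Qed.

Lemma cabsE a : cabs a = Num.sqrt (nrm2 a).
Proof. by rewrite /cabs normcE. Qed.
Lemma cabs_ge0 a : 0 <= cabs a. Proof. by rewrite cabsE sqrtr_ge0. Qed.
Lemma cabs_sq a : cabs a ^+ 2 = nrm2 a.
Proof. by rewrite cabsE sqr_sqrtr // nrm2_ge0. Qed.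
Lemma cabs_lt a (r : R) : 0 <= r -> (cabs a < r) = (nrm2 a < r ^+ 2).
Proof. by move=> r0; rewrite -cabs_sq ltr_sqr // nnegrE cabs_ge0. Qed.
Lemma cabs_le a (r : R) : 0 <= r -> (cabs a <= r) = (nrm2 a <= r ^+ 2).
Proof. by move=> r0; rewrite -cabs_sq ler_sqr // nnegrE cabs_ge0. Qed.
Lemma cabs_ge a (r : R) : 0 <= r -> (r <= cabs a) = (r ^+ 2 <= nrm2 a).
Proof. by move=> r0; rewrite -cabs_sq ler_sqr // nnegrE cabs_ge0. Qed.
Lemma cabs_eq a (r : R) : 0 <= r -> (cabs a = r) <-> (nrm2 a = r ^+ 2).
Proof.
move=> r0; split=> [<-|h]; first by rewrite cabs_sq.
by rewrite cabsE h sqrtr_sqr ger0_norm.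
Qed.

Lemma nrm2N a : nrm2 (- a) = nrm2 a.
Proof. by rewrite /nrm2 !cE !sqrrN. Qed.
Lemma cabsN a : cabs (- a) = cabs a. Proof. by rewrite !cabsE nrm2N. Qed.
Lemma cabsC a b : cabs (a - b) = cabs (b - a). Proof. by rewrite -cabsN opprB. Qed.
Lemma nrm2C a b : nrm2 (a - b) = nrm2 (b - a). Proof. by rewrite -nrm2N opprB. Qed.
Lemma cabs0 : cabs (0 : cplx R) = 0.
Proof. by rewrite cabsE /nrm2 /= expr0n /= addr0 sqrtr0. Qed.
Lemma cabs_eq0 a : cabs a = 0 -> a = 0.
Proof. by move=> h; apply: nrm2_eq0; rewrite -cabs_sq h expr0n. Qed.

Lemma dot_le a b : dot a b <= cabs a * cabs b.
Proof.
case: (leP (dot a b) 0) => [h|h].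
  by apply: (le_trans h); rewrite mulr_ge0 // cabs_ge0.
rewrite -ler_sqr ?nnegrE ?mulr_ge0 ?cabs_ge0 ?(ltW h) // exprMn !cabs_sq.
rewrite /nrm2 /dot; have := sqr_ge0 (crs a b); rewrite /crs; nra.
Qed.

Lemma cabsD a b : cabs (a + b) <= cabs a + cabs b.
Proof.
rewrite cabs_le ?addr_ge0 ?cabs_ge0 // sqrrD !cabs_sq.
have := dot_le a b; rewrite /dot /nrm2 !cE; nra.
Qed.

Lemma cabs_triangle a b c : cabs (a - c) <= cabs (a - b) + cabs (b - c).
Proof. by rewrite (_ : a - c = (a - b) + (b - c)) ?cabsD //; ring. Qed.

Lemma cabs_rc t a : cabs (rc t * a) = `|t| * cabs a.
Proof.
rewrite !cabsE -sqrtr_sqr -sqrtrM ?sqr_ge0 //; congr Num.sqrt.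
by rewrite /nrm2 !cE /=; ring.
Qed.

Lemma Re_le_cabs a : `|Re a| <= cabs a.
Proof. by rewrite cabsE -sqrtr_sqr ler_sqrt ?nrm2_ge0 // lerDl sqr_ge0. Qed.
Lemma Im_le_cabs a : `|Im a| <= cabs a.
Proof. by rewrite cabsE -sqrtr_sqr ler_sqrt ?nrm2_ge0 // lerDr sqr_ge0. Qed.

Lemma lerp_dist a b s t : cabs (lerp a b s - lerp a b t) = `|s - t| * cabs (b - a).
Proof.
rewrite -cabs_rc; congr cabs; apply: cplx_eq;
  by rewrite !cE ?Re_lerp ?Im_lerp /=; ring.
Qed.

Lemma lerp0 a b : lerp a b 0 = a.
Proof. by apply: cplx_eq; rewrite ?Re_lerp ?Im_lerp mul0r addr0. Qed.
Lemma lerp1 a b : lerp a b 1 = b.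
Proof. by apply: cplx_eq; rewrite ?Re_lerp ?Im_lerp; ring. Qed.

Lemma segmentC a b x : segment a b x -> segment b a x.
Proof.
move=> [t [t0 t1 ->]]; exists (1 - t); split; [lra|lra|].
by rewrite -!/(lerp _ _ _); apply: cplx_eq; rewrite ?Re_lerp ?Im_lerp; ring.
Qed.
Lemma segmentl a b : segment a b a.
Proof. by exists 0; split => //; rewrite -/(lerp _ _ _) lerp0. Qed.
Lemma segmentr a b : segment a b b.
Proof. by exists 1; split => //; rewrite -/(lerp _ _ _) lerp1. Qed.

Lemma nbhs_cabs x A :
  nbhs x A <-> exists2 e : R, 0 < e & forall y, cabs (y - x) < e -> A y.
Proof.
split.
  move/nbhs_ballP => [e /= e0 H].
  move: e0; rewrite ltcRE => /andP[/eqP /= h1 h2].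
  exists (Re e) => // y Hy; apply: H.
  rewrite -ball_normE /= ltcRE normcE /= h1 eqxx /=.
  by move: Hy; rewrite cabsC cabsE.
move=> [e e0 H]; apply/nbhs_ballP; exists (rc e); first by rewrite /= ltcRE /= eqxx.
move=> y; rewrite -ball_normE /= ltcRE normcE /= eqxx /= => Hy; apply: H.
by rewrite cabsC cabsE.
Qed.

Lemma open_cabs A :
  open A <-> forall x, A x -> exists2 e : R, 0 < e & forall y, cabs (y - x) < e -> A y.
Proof.
rewrite openE; split=> H x Ax; first by apply/nbhs_cabs/H.
by apply/nbhs_cabs/H.
Qed.

Lemma closure_cabs A x :
  closure A x <-> forall e : R, 0 < e -> exists2 y, A y & cabs (y - x) < e.
Proof.
split=> H.
  move=> e e0; have /H [y [Ay By]] : nbhs x [set y | cabs (y - x) < e].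
    by apply/nbhs_cabs; exists e.
  by exists y.
move=> B /nbhs_cabs [e e0 He]; have [y Ay Hy] := H e e0.
by exists y; split => //; apply: He.
Qed.

Lemma lerp_continuous a b : continuous (lerp a b).
Proof.
move=> t A /nbhs_cabs [e e0 He].
have L0 : 0 < cabs (b - a) + 1 by rewrite ltr_wpDl ?cabs_ge0.
apply/nbhs_ballP; exists (e / (cabs (b - a) + 1)); first by rewrite /= divr_gt0.
move=> s; rewrite -ball_normE /= ltr_pdivlMr // => Hs.
apply: He; rewrite lerp_dist distrC.
have := normr_ge0 (t - s); nra.
Qed.

Lemma image_lerp_connected a b (I : set R) :
  is_interval I -> connected (lerp a b @` I).
Proof.
move=> /connected_intervalP Ic; apply: connected_continuous_connected => //.
by apply: continuous_subspaceT; apply: lerp_continuous.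
Qed.

Lemma plane_segment_connected a b : connected (segment a b).
Proof.
suff -> : segment a b = lerp a b @` `[0, 1]%classic.
  exact/image_lerp_connected/interval_is_interval.
apply/seteqP; split => x.
  by move=> [t [t0 t1 ->]]; exists t => //=; rewrite in_itv /= t0 t1.
by move=> [t /=]; rewrite in_itv /= => /andP[t0 t1] <-; exists t.
Qed.

Lemma starshaped_connected A c :
  (forall x, A x -> segment c x `<=` A) -> connected A.
Proof.
move=> H; suff -> : A = \bigcup_(x in A) segment c x.
  apply: bigcup_connected; last by move=> x _; apply: plane_segment_connected.
  by exists c => x Ax; apply: segmentl.
apply/seteqP; split => x.
  by move=> Ax; exists x => //; apply: segmentr.
by move=> [y Ay]; apply: H.
Qed.

Definition lipschitz (f : cplx R -> R) :=
  exists L : R, forall x y, `|f x - f y| <= L * cabs (x - y).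

Lemma lipschitz_continuous f : lipschitz f -> continuous f.
Proof.
move=> [L HL] x A /nbhs_ballP [e /= e0 He].
have L0 : 0 < `|L| + 1 by rewrite ltr_wpDl.
apply/nbhs_cabs; exists (e / (`|L| + 1)); first by rewrite divr_gt0.
move=> y; rewrite ltr_pdivlMr // => Hy; apply: He; rewrite -ball_normE /=.
apply: (le_lt_trans (HL _ _)); rewrite cabsC.
have := cabs_ge0 (y - x); have := ler_norm L; nra.
Qed.

Lemma crs_lipschitz a c : lipschitz (fun x => crs a (x - c)).
Proof.
exists (`|Re a| + `|Im a|) => x y.
have -> : crs a (x - c) - crs a (y - c) = Re a * Im (x - y) - Im a * Re (x - y).
  by rewrite /crs !cE; ring.
apply: (le_trans (ler_normB _ _)); rewrite !normrM mulrDl.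
by rewrite lerD // ler_wpM2l // ?Im_le_cabs ?Re_le_cabs.
Qed.

Lemma open_gt0 f : lipschitz f -> open [set x | 0 < f x].
Proof.
move=> /lipschitz_continuous fc; rewrite (_ : [set _ | _] = f @^-1` [set t | 0 < t]) //.
by apply: open_comp => [x _|]; [exact: fc | exact: open_gt].
Qed.
Lemma closed_ge0 f : lipschitz f -> closed [set x | 0 <= f x].
Proof.
move=> /lipschitz_continuous fc; rewrite (_ : [set _ | _] = f @^-1` [set t | 0 <= t]) //.
by apply: closed_comp => [x _|]; [exact: fc | exact: closed_ge].
Qed.

Lemma closure_ge0 A f x : lipschitz f -> (forall y, A y -> 0 <= f y) -> closure A x -> 0 <= f x.
Proof.
move=> fl H Ax; have /closure_id cl := closed_ge0 fl.
suff : closure [set x | 0 <= f x] x by rewrite -cl.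
by apply: closure_subset Ax => y /H.
Qed.

Lemma connected_side A f x y : connected A -> lipschitz f ->
  (forall z, A z -> f z <> 0) -> A x -> A y -> 0 < f x -> 0 < f y.
Proof.
move=> Ac fl H Ax Ay fx; rewrite ltNge; apply/negP => fy.
have : connected (f @` A).
  apply: connected_continuous_connected => //.
  by apply: continuous_subspaceT; apply: lipschitz_continuous.
move/connected_intervalP => /(_ (f y) (f x)) HI.
have [] : (f @` A) 0.
  by apply: HI; [exists y|exists x|rewrite fy (ltW fx)].
by move=> z /H.
Qed.

(** Clopen arguments below get openness and closedness from two different ambient sets, such as an
    open rhombus and the closed one, which agree only inside [A]. *)
Lemma connected_clopen A B C x : connected A -> open B -> closed C ->
  A `&` B = A `&` C -> A x -> B x -> A `<=` B.
Proof.
move=> Ac Bo Cc E Ax Bx.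
suff <- : A `&` B = A by apply: subIsetr.
by apply: Ac; [exists x | exists B | exists C].
Qed.
End Plane.

(** * Faces and polygons *)

Section Faces.
Variable R : realType.
Implicit Types (a b c x y z v w : cplx R) (t e : R) (A B f : set (cplx R)).

Lemma segment_dist a b x : ~ segment a b x ->
  exists2 e : R, 0 < e & forall y, segment a b y -> e <= cabs (y - x).
Proof.
move=> Nx; pose g t := cabs (lerp a b t - x).
have gc : {within `[0, 1], continuous g}.
  apply: continuous_subspaceT => t.
  apply: (@continuous_comp _ _ _ (lerp a b) (fun y => cabs (y - x))).
    exact: lerp_continuous.
  apply: lipschitz_continuous; exists 1 => y z; rewrite mul1r ler_norml.
  have := cabs_triangle y z x; have := cabs_triangle z y x.
  rewrite (cabsC z y); lra.
have [t0 t01 Ht] := EVT_min (@ler01 R) gc.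
exists (g t0).
  rewrite lt_neqAle cabs_ge0 andbT; apply/eqP => /esym/cabs_eq0/subr0_eq E.
  apply: Nx; exists t0; move: t01; rewrite in_itv /= => /andP[? ?]; split => //.
by move=> y [t [h1 h2 ->]]; apply: Ht; rewrite in_itv /= h1 h2.
Qed.

Lemma collinear_lerp a b z : a <> b -> crs (b - a) (z - a) = 0 -> exists s, z = lerp a b s.
Proof.
move=> ab E; have ba0 : b - a <> 0 by move/subr0_eq => /esym.
have := nrm2_gt0 ba0; move: E; rewrite /crs /nrm2 !cE => E D0.
exists (dot (b - a) (z - a) / nrm2 (b - a)).
have key (ux uy px py : R) : ux * py - uy * px = 0 -> 0 < ux ^+ 2 + uy ^+ 2 ->
    px = (ux * px + uy * py) / (ux ^+ 2 + uy ^+ 2) * ux /\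
    py = (ux * px + uy * py) / (ux ^+ 2 + uy ^+ 2) * uy.
  move=> h N0; split; apply: (mulIf (lt0r_neq0 N0)); rewrite mulrAC divfK ?lt0r_neq0 //;
    apply/eqP; rewrite -subr_eq0; apply/eqP.
    by rewrite -[RHS](mulr0 (- uy)) -h; ring.
  by rewrite -[RHS](mulr0 ux) -h; ring.
have [kx ky] := key _ _ _ _ E D0.
apply: cplx_eq; rewrite ?Re_lerp ?Im_lerp /dot /nrm2 !cE.
  by rewrite -kx; ring.
by rewrite -ky; ring.
Qed.

Lemma collinear_near a b x z : a <> b -> segment a b x ->
  crs (b - a) (z - a) = 0 -> cabs (z - x) < cabs (x - a) -> cabs (z - x) < cabs (x - b) ->
  segment a b z.
Proof.
move=> ab [t [t0 t1 ->]] /(collinear_lerp ab)[s ->].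
have ha : cabs (lerp a b t - a) = t * cabs (b - a).
  by rewrite -{2}(lerp0 a b) lerp_dist subr0 ger0_norm.
have hb : cabs (lerp a b t - b) = (1 - t) * cabs (b - a).
  by rewrite -{2}(lerp1 a b) lerp_dist distrC ger0_norm ?subr_ge0.
rewrite -/(lerp a b t) ha hb lerp_dist.
have ba : 0 < cabs (b - a).
  by rewrite lt_neqAle cabs_ge0 andbT; apply/eqP => /esym/cabs_eq0/subr0_eq/esym.
rewrite !ltr_pM2r // !ltr_norml => /andP[? ?] /andP[? ?].
by exists s; split => //; lra.
Qed.

Lemma seq_min_radius (T : eqType) (s : seq T) (P : T -> R -> Prop) :
  (forall i e e', e' <= e -> P i e -> P i e') ->
  (forall i, i \in s -> exists2 e : R, 0 < e & P i e) ->
  exists2 e : R, 0 < e & forall i, i \in s -> P i e.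
Proof.
move=> Pm; elim: s => [|i s IH] H; first by exists 1.
have [|e e0 He] := IH; first by move=> j js; apply: H; rewrite inE js orbT.
have [e' e'0 He'] := H i (mem_head _ _).
exists (Num.min e e'); first by rewrite lt_min e0.
move=> j; rewrite inE => /orP[/eqP ->|/He].
  by apply: Pm He'; rewrite ge_min lexx orbT.
by apply: Pm; rewrite ge_min lexx.
Qed.

Variable G : geom_graph R.
Hypothesis pG : plane_graph G.

(** Local finiteness leaves finitely many edges near [x], and each one missing [x] stays at a
    positive distance. *)
Lemma edge_isolated x : exists2 e : R, 0 < e &
  forall a b y, gedge G a b -> segment a b y -> cabs (y - x) < e -> segment a b x.
Proof.
have [s /= Hs] := (finite_seqP _).1 (plane_finite_edge pG (cabs x + 1)).
pose P (d : cplx R * cplx R) e :=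
  ~ segment d.1 d.2 x -> forall y, segment d.1 d.2 y -> e <= cabs (y - x).
have [||e e0 He] := @seq_min_radius _ s P.
- by move=> i e e' ee H N y /(H N); apply: le_trans.
- move=> i _; have [S|N] := pselect (segment i.1 i.2 x).
    by exists 1; [exact: ltr01 | move=> N; case: (N S)].
  by have [e e0 He] := segment_dist N; exists e => // _; exact: He.
exists (Num.min e 1); first by rewrite lt_min e0 ltr01.
move=> a b y ab Sy; rewrite lt_min => /andP[h1 h2].
apply: contrapT => N.
have : (a, b) \in s.
  have : [set` s] (a, b).
    rewrite -Hs /=; split => //; exists y => //.
    have := cabs_triangle y x 0; rewrite !subr0; lra.
  by [].
by move=> /He /(_ N y Sy); rewrite leNgt h1.
Qed.

Lemma vert_isolated x : exists2 e : R, 0 < e &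
  forall v, gvert G v -> cabs (v - x) < e -> v = x.
Proof.
have [s /= Hs] := (finite_seqP _).1 (plane_finite_vert pG (cabs x + 1)).
pose P v e := v <> x -> e <= cabs (v - x).
have [||e e0 He] := @seq_min_radius _ s P.
- by move=> i e e' ee H N; apply: le_trans (H N).
- move=> i _; have [S|N] := pselect (i = x); first by exists 1; [exact: ltr01 | move=> N; case: (N S)].
  exists (cabs (i - x)); last by move=> _; apply: lexx.
  rewrite lt_neqAle cabs_ge0 andbT.
  by apply/eqP => /esym/cabs_eq0/subr0_eq.
exists (Num.min e 1); first by rewrite lt_min e0 ltr01.
move=> v Vv; rewrite lt_min => /andP[h1 h2].
apply: contrapT => N.
have : v \in s.
  have : [set` s] v.
    rewrite -Hs /=; split => //.
    have := cabs_triangle v x 0; rewrite !subr0; lra.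
  by [].
by move=> /He /(_ N); rewrite leNgt h1.
Qed.

Lemma notin_drawing_ball x : ~ drawing G x -> exists2 e : R, 0 < e &
  forall y, cabs (y - x) < e -> ~ drawing G y.
Proof.
move=> Nx; have [e e0 He] := edge_isolated x; have [e' e'0 He'] := vert_isolated x.
exists (Num.min e e'); first by rewrite lt_min e0.
move=> y; rewrite lt_min => /andP[h1 h2] [Vy|[a [b [ab Sy]]]]; apply: Nx.
  by left; rewrite -(He' y).
by right; exists a, b; split => //; apply: He Sy h1.
Qed.

Lemma edge_point_isolated a b x : gedge G a b -> segment a b x -> ~ gvert G x ->
  exists2 e : R, 0 < e &
  forall y, cabs (y - x) < e -> drawing G y -> segment a b y.
Proof.
move=> ab Sx Nx; have [e e0 He] := edge_isolated x.
have [e' e'0 He'] := vert_isolated x.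
exists (Num.min e e'); first by rewrite lt_min e0.
move=> y; rewrite lt_min => /andP[h1 h2] [Vy|[c [d [cd Sy]]]].
  by case: Nx; rewrite -(He' y).
have Sx' := He _ _ _ cd Sy h1.
have [//|[-> ->]//|[-> ->]] := plane_noncrossing pG ab cd Sx Sx'.
exact: segmentC.
Qed.

Lemma ball_segment x e y z : cabs (y - x) < e -> cabs (z - x) < e ->
  forall p, segment y z p -> cabs (p - x) < e.
Proof.
move=> hy hz p [t [t0 t1 ->]].
have -> : y + rc t * (z - y) - x = rc (1 - t) * (y - x) + rc t * (z - x).
  by apply: cplx_eq; rewrite !cE /=; ring.
apply: (le_lt_trans (cabsD _ _)); rewrite !cabs_rc !ger0_norm; [|lra|lra].
have [->|t_neq0] := eqVneq t 0; first by rewrite subr0 mul1r mul0r addr0.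
have : 0 < t by rewrite lt_neqAle eq_sym t_neq0.
nra.
Qed.

Section OneFace.
Variable f : set (cplx R).
Hypothesis ff : face G f.

Lemma face_notin_drawing x : f x -> ~ drawing G x.
Proof. by case: ff => c _ -> /connected_component_sub. Qed.

Lemma face_component x : f x -> f = connected_component (~` drawing G) x.
Proof. by case: ff => c _ -> fx; apply: same_connected_component. Qed.

Lemma face_connected : connected f.
Proof. by case: ff => c _ ->; apply: component_connected. Qed.

Lemma face_max A x : connected A -> A `<=` ~` drawing G -> A x -> f x -> A `<=` f.
Proof.
by move=> Ac AD Ax fx; rewrite (face_component fx); apply: connected_component_max.
Qed.

Lemma face_segment x y : f x -> (forall z, segment x y z -> ~ drawing G z) -> f y.
Proof.
move=> fx H.
exact: (face_max (@plane_segment_connected _ x y) H (segmentl x y) fx (segmentr x y)).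
Qed.

Lemma face_open_ball x : f x -> exists2 e : R, 0 < e & forall y, cabs (y - x) < e -> f y.
Proof.
move=> fx; have [e e0 He] := notin_drawing_ball (face_notin_drawing fx).
exists e => // y hy; apply: (face_segment fx) => z Sz; apply: He.
by apply: ball_segment Sz => //; rewrite subrr cabs0.
Qed.

Lemma face_open : open f.
Proof. by apply/open_cabs => x /face_open_ball. Qed.

Lemma face_closure_in x : closure f x -> ~ drawing G x -> f x.
Proof.
move=> /closure_cabs cx Nx; have [e e0 He] := notin_drawing_ball Nx.
have [y fy hy] := cx e e0.
apply: (face_segment fy) => z Sz; apply: He.
by apply: ball_segment Sz => //; rewrite subrr cabs0.
Qed.

Lemma closure_line x y : (forall t, 0 < t -> t <= 1 -> f (lerp x y t)) -> closure f x.
Proof.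
move=> H; apply/closure_cabs => e e0.
pose L := cabs (y - x) + 1.
have L0 : 0 < L by rewrite ltr_wpDl ?cabs_ge0.
pose t := Num.min 1 (e / L).
have t0 : 0 < t by rewrite lt_min ltr01 divr_gt0.
exists (lerp x y t); first by apply: H => //; rewrite ge_min lexx.
have -> : lerp x y t - x = rc t * (y - x) by apply: cplx_eq; rewrite !cE /= ; ring.
rewrite cabs_rc ger0_norm ?(ltW t0) //.
have : t <= e / L by rewrite ge_min lexx orbT.
rewrite ler_pdivlMr // => h; apply: lt_le_trans h.
by rewrite ltr_pM2l // /L ltrDl.
Qed.

(** Near an inner point of an edge the drawing is just that edge. A nearby point [z] of the face is
    off the line of the edge, so a segment from [z] to a nearby edge point [y] meets the drawing
    only at [y], which is therefore a limit of face points. *)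
Lemma edge_point_closure a b x : gedge G a b -> segment a b x -> ~ gvert G x ->
  closure f x -> exists2 e : R, 0 < e & forall y, segment a b y -> cabs (y - x) < e -> closure f y.
Proof.
move=> ab Sx Nx /closure_cabs cx; have [e e0 He] := edge_point_isolated ab Sx Nx.
have aneb : a <> b by move=> E; apply: (plane_irrefl pG (a := a)); rewrite {2}E.
have [Va Vb] := plane_vert pG ab.
have xpos c : gvert G c -> 0 < cabs (x - c).
  move=> Vc; rewrite lt_neqAle cabs_ge0 andbT.
  by apply/eqP => /esym/cabs_eq0/subr0_eq xc; apply: Nx; rewrite xc.
pose e' := Num.min e (Num.min (cabs (x - a)) (cabs (x - b))).
have e'0 : 0 < e' by rewrite !lt_min e0 !xpos.
have ee' : e' <= e by rewrite ge_min lexx.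
have [z fz hz] := cx e' e'0.
exists e' => // y Sy hy.
have line p : segment a b p -> crs (b - a) (p - a) = 0.
  by move=> [t [_ _ ->]]; rewrite /crs !cE /=; ring.
have zline : crs (b - a) (z - a) <> 0.
  move=> E; apply: (face_notin_drawing fz); right; exists a, b; split => //.
  by apply: (collinear_near aneb Sx E); apply: lt_le_trans hz _; rewrite !ge_min lexx ?orbT.
have lerpz t : crs (b - a) (lerp y z t - a) = (1 - t) * crs (b - a) (y - a) + t * crs (b - a) (z - a).
  by rewrite /crs !cE /=; ring.
apply: (@closure_line y z) => t t0 t1.
apply: (face_segment fz) => p Sp Dp.
have : segment a b p.
  apply: He => //; apply: lt_le_trans ee'; apply: (ball_segment hz _ Sp).
  by apply: (ball_segment hy hz); exists t; split => //; exact: ltW.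
move/line; case: Sp => s [s0 s1 ->].
have -> : crs (b - a) (z + rc s * (lerp y z t - z) - a) =
  (1 - s) * crs (b - a) (z - a) + s * crs (b - a) (lerp y z t - a).
  by rewrite /crs !cE /=; ring.
rewrite lerpz (line y Sy) mulr0 add0r mulrA -mulrDl => /eqP.
rewrite mulf_eq0 => /orP[/eqP h|/eqP //]; nra.
Qed.
End OneFace.
End Faces.

Section EdgeClosure.
Variable R : realType.
Variable G : geom_graph R.
Hypothesis pG : plane_graph G.
Implicit Types (a b c x y z v w : cplx R).

Lemma edge_neq a b : gedge G a b -> a <> b.
Proof. by move=> ab E; apply: (plane_irrefl pG (a := a)); rewrite {2}E. Qed.

Lemma lerp_inj a b s t : a <> b -> lerp a b s = lerp a b t -> s = t.
Proof.
move=> ab E; have : cabs (lerp a b s - lerp a b t) = 0 by rewrite E subrr cabs0.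
rewrite lerp_dist => /eqP; rewrite mulf_eq0 normr_eq0 subr_eq0 => /orP[/eqP //|/eqP].
by move/cabs_eq0/subr0_eq/esym.
Qed.

Lemma edge_inner_notvert a b t : gedge G a b -> 0 < t -> t < 1 -> ~ gvert G (lerp a b t).
Proof.
move=> ab t0 t1 Vt; have St : segment a b (lerp a b t).
  by exists t; split => //; apply: ltW.
have [E|E] := plane_vertex_edge pG ab Vt St.
  by move: E t0; rewrite -{2}(lerp0 a b) => /(lerp_inj (edge_neq ab)) ->; rewrite ltxx.
by move: E t1; rewrite -{2}(lerp1 a b) => /(lerp_inj (edge_neq ab)) ->; rewrite ltxx.
Qed.

Lemma segment_notvert a b x : gedge G a b -> segment a b x -> ~ gvert G x ->
  exists t, [/\ 0 < t, t < 1 & x = lerp a b t].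
Proof.
move=> ab [t [t0 t1 E]] Nx; have [Va Vb] := plane_vert pG ab.
exists t; split => //; rewrite lt_neqAle ?t0 ?t1 andbT; apply/eqP => h; apply: Nx;
  rewrite E -/(lerp a b t).
  by rewrite -h lerp0.
by rewrite h lerp1.
Qed.

(** The inner points of the edge in the closure of [f] form a relatively closed set, and a
    relatively open one by [edge_point_closure]; the open edge is connected. The endpoints follow
    because a closure is closed. *)
Lemma edge_closure f a b x : face G f -> gedge G a b -> segment a b x -> ~ gvert G x ->
  closure f x -> forall t, 0 <= t -> t <= 1 -> closure f (lerp a b t).
Proof.
move=> ff ab Sx Nx cx.
pose A := lerp a b @` `]0, 1[%classic.
have Ac : connected A by exact/image_lerp_connected/interval_is_interval.
pose good y (e : R) := 0 < e /\ forall z, segment a b z -> cabs (z - y) < e -> closure f z.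
pose B := [set y | exists x' e, good x' e /\ cabs (y - x') < e].
have Bo : open B.
  apply/open_cabs => y [x' [e [g hy]]]; exists (e - cabs (y - x')); first by rewrite subr_gt0.
  move=> z hz; exists x', e; split => //.
  by have := cabs_triangle z y x'; lra.
have AS y : A y -> segment a b y /\ ~ gvert G y.
  move=> [t /=]; rewrite in_itv /= => /andP[t0 t1] <-; split; last exact: edge_inner_notvert.
  by exists t; split => //; apply: ltW.
have AB : A `&` B = A `&` closure f.
  apply/seteqP; split => y [Ay h]; (split; first exact: Ay).
    have [Sy _] := AS y Ay; case: h => x' [e [[_ g] hy]]; exact: g.
  have [Sy Ny] := AS y Ay.
  have [e e0 He] := edge_point_closure pG ff ab Sy Ny h.
  by exists y, e; rewrite subrr cabs0.
have [t [t0 t1 Ex]] := segment_notvert ab Sx Nx.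
have Ax : A x by exists t => //=; rewrite in_itv /= t0 t1.
have Bx : B x.
  suff [] : (A `&` B) x by [].
  by rewrite AB; split.
have AB' := connected_clopen Ac Bo (@closed_closure _ f) AB Ax Bx.
have Af y : A y -> closure f y.
  move=> Ay; suff [] : (A `&` closure f) y by [].
  by rewrite -AB; split; [exact: Ay | exact: AB'].
have fin := @closed_closure _ f : closure (closure f) `<=` closure f.
move=> s s0 s1; apply: fin; apply: (@closure_line _ _ _ x) => r r0 r1; apply: Af.
rewrite Ex; exists (s + r * (t - s)); last first.
  by apply: cplx_eq; rewrite ?Re_lerp ?Im_lerp; ring.
rewrite /= in_itv /=; apply/andP; split; nra.
Qed.
End EdgeClosure.

(** * Convexity of the faces of an isoradial graph *)

Section Isoradial.
Variable R : realType.
Variables (delta : R) (G : geom_graph R).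
Hypothesis delta0 : 0 < delta.
Hypothesis iG : isoradial delta G.
Implicit Types (a b c u x y z v w : cplx R).
Let pG : plane_graph G := iG.1.

(** Indexes faces by their centers: for [w] in [dual_vert] this is the face with center [w], by
    [dual_face_center]. *)
Definition fc w : set (cplx R) := connected_component (~` drawing G) w.

(* [[a, b]] is a side of the face of center [w], which lies on its left. *)
Definition bd w a b :=
  [/\ gedge G a b, incident delta G a w, incident delta G b w & 0 < crs (a - w) (b - w)].

Lemma dual_face_center w : dual_vert delta G w -> face_center delta G (fc w) w.
Proof.
move=> [f [ff fw inf]]; have <- : f = fc w by rewrite /fc -(face_component ff).
by split.
Qed.

Lemma incidentE u w : incident delta G u w ->
  [/\ dual_vert delta G w, gvert G u & closure (fc w) u].
Proof.
move=> [f fcw [Vu Cu]]; case: (fcw) => ff fw inf.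
have E : f = fc w by rewrite /fc -(face_component ff).
by split => //; [exists f | rewrite -E].
Qed.

Lemma incidentI u w : dual_vert delta G w -> gvert G u -> closure (fc w) u -> incident delta G u w.
Proof. by move=> /dual_face_center h Vu Cu; exists (fc w). Qed.

Lemma incident_dist u w : incident delta G u w -> nrm2 (u - w) = delta ^+ 2.
Proof.
move=> [f [ff fw [_ inf]] Vu]; rewrite -cabs_sq; congr (_ ^+ 2); exact: inf.
Qed.

Section OneCenter.
Variable w : cplx R.
Hypothesis dw : dual_vert delta G w.
Let ff : face G (fc w). Proof. by case: (dual_face_center dw). Qed.

Lemma fc_face : face G (fc w). Proof. exact: ff. Qed.
Lemma fc_center : fc w w. Proof. by case: (dual_face_center dw). Qed.

Lemma closure_fc_disc x : closure (fc w) x -> cabs (x - w) <= delta.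
Proof.
case: (dual_face_center dw) => _ _ [h _] /closure_cabs cx.
rewrite leNgt; apply/negP => /[dup] hx; rewrite -subr_gt0 => /cx [y /h hy hxy].
have := cabs_triangle x y w; rewrite (cabsC x y); lra.
Qed.

(** An open face cannot touch its circle: a face point at distance [delta] could be pushed outwards,
    by the factor [s] > 1, without leaving the face. *)
Lemma fc_disc x : fc w x -> cabs (x - w) < delta.
Proof.
move=> fx; have := closure_fc_disc (subset_closure fx).
rewrite le_eqVlt => /orP[/eqP E|//].
have [e e0 He] := face_open_ball pG ff fx.
pose s := 1 + e / (2 * delta).
have s1 : 0 < e / (2 * delta) by rewrite divr_gt0 // mulr_gt0.
have : closure (fc w) (lerp w x s).
  apply/subset_closure/He.
  rewrite -{2}(lerp1 w x) lerp_dist E /s addrAC subrr add0r ger0_norm ?(ltW s1) //.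
  rewrite (_ : e / (2 * delta) * delta = e / 2); first lra.
  by field; rewrite gt_eqF.
move/closure_fc_disc; rewrite -{2}(lerp0 w x) lerp_dist E subr0 ger0_norm; last by rewrite /s; lra.
by rewrite /s mulrDl mul1r gerDl leNgt mulr_gt0.
Qed.

(** A boundary point that is not a vertex is inside an edge whose ends are corners of the face, and
    an inner point of a chord is strictly inside the circle. *)
Lemma closure_fc_notvert x : closure (fc w) x -> ~ gvert G x -> cabs (x - w) < delta.
Proof.
move=> cx Nx; have [Dx|Dx] := pselect (drawing G x); last first.
  exact/fc_disc/(face_closure_in pG ff cx Dx).
case: Dx => [//|[a [b [ab Sx]]]].
have H := edge_closure pG ff ab Sx Nx cx.
have [t [t0 t1 ->]] := segment_notvert pG ab Sx Nx.
have [Va Vb] := plane_vert pG ab.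
have ia : incident delta G a w by apply: (incidentI dw Va); rewrite -(lerp0 a b); apply: H; [exact: lexx|exact: ler01].
have ib : incident delta G b w by apply: (incidentI dw Vb); rewrite -(lerp1 a b); apply: H; [exact: ler01|exact: lexx].
have ab0 : 0 < nrm2 (a - b) by apply/nrm2_gt0 => /subr0_eq; apply: edge_neq ab.
rewrite cabs_lt ?ltW //.
have := incident_dist ia; have := incident_dist ib; move: ab0.
rewrite /nrm2 !cE /= => h1 h2 h3.
rewrite -subr_gt0.
rewrite [X in 0 < X](_ : _ = t * (1 - t) * ((Re a - Re b) ^+ 2 + (Im a - Im b) ^+ 2)).
  by rewrite !mulr_gt0 // subr_gt0.
have -> : delta ^+ 2 = (1 - t) * delta ^+ 2 + t * delta ^+ 2 by ring.
by rewrite -{1}h3 -h2; ring.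
Qed.

Lemma edge_closure_incident a b x : gedge G a b -> segment a b x -> ~ gvert G x ->
  closure (fc w) x -> incident delta G a w /\ incident delta G b w.
Proof.
move=> ab Sx Nx cx; have H := edge_closure pG ff ab Sx Nx cx.
have [Va Vb] := plane_vert pG ab.
split; [apply: (incidentI dw Va)|apply: (incidentI dw Vb)].
  by rewrite -(lerp0 a b); apply: H; [exact: lexx|exact: ler01].
by rewrite -(lerp1 a b); apply: H; [exact: ler01|exact: lexx].
Qed.

(** With x = lerp a b s, the power of [x] with respect to the circle is s (1 - s) |a - b|^2 =
    delta^2 - |x - w|^2 > 0, so 0 < s < 1. *)
Lemma chord_segment a b x : a <> b -> nrm2 (a - w) = delta ^+ 2 -> nrm2 (b - w) = delta ^+ 2 ->
  cabs (x - w) < delta -> crs (b - a) (x - a) = 0 -> segment a b x.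
Proof.
move=> ab ha hb; rewrite cabs_lt ?ltW // => hx /(collinear_lerp ab) [s E].
have ab0 : 0 < nrm2 (a - b) by apply/nrm2_gt0 => /subr0_eq.
have : 0 < s * (1 - s) * nrm2 (a - b).
  rewrite [X in 0 < X](_ : _ = delta ^+ 2 - nrm2 (x - w)) ?subr_gt0 //.
  have -> : delta ^+ 2 = (1 - s) * nrm2 (a - w) + s * nrm2 (b - w) by rewrite ha hb; ring.
  rewrite E.
  by rewrite /nrm2 !cE /=; ring.
rewrite pmulr_lgt0 // => h; exists s; split => //; nra.
Qed.

Lemma edge_crs_neq0 a b : gedge G a b -> incident delta G a w -> incident delta G b w ->
  forall x, fc w x -> crs (b - a) (x - a) <> 0.
Proof.
move=> ab ia ib x fx E; apply: (face_notin_drawing ff fx); right; exists a, b; split => //.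
apply: chord_segment E; [exact: edge_neq ab|exact: incident_dist|exact: incident_dist|].
exact: fc_disc.
Qed.

Lemma crs_center a b : crs (b - a) (w - a) = crs (a - w) (b - w).
Proof. by rewrite /crs !cE; ring. Qed.

Lemma bd_or a b : gedge G a b -> incident delta G a w -> incident delta G b w ->
  bd w a b \/ bd w b a.
Proof.
move=> ab ia ib; have := edge_crs_neq0 ab ia ib fc_center; rewrite crs_center => /eqP.
rewrite neq_lt => /orP[h|h]; last by left; split.
right; split => //; first exact: plane_sym.
by move: h; rewrite /crs !cE; lra.
Qed.

Lemma bd_side a b x : bd w a b -> fc w x -> 0 < crs (b - a) (x - a).
Proof.
move=> [ab ia ib]; rewrite -crs_center => h fx.
exact: (connected_side (face_connected ff) (crs_lipschitz (b - a) a)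
  (edge_crs_neq0 ab ia ib) fc_center fx h).
Qed.

Lemma bd_side_closure a b x : bd w a b -> closure (fc w) x -> 0 <= crs (b - a) (x - a).
Proof.
move=> h; apply: (closure_ge0 (crs_lipschitz (b - a) a)) => y fy.
exact/ltW/bd_side.
Qed.

Lemma crs_lerp a b c d t : crs (b - a) (lerp c d t - a) =
  (1 - t) * crs (b - a) (c - a) + t * crs (b - a) (d - a).
Proof. by rewrite /crs !cE /=; ring. Qed.

(** On the segment from [w] to [x] the face is relatively clopen: a point of its closure on the
    drawing would be a vertex, at distance [delta], or lie on a side, where the cross product
    vanishes. A face is thus the disc cut by the half-planes of its sides. *)
Lemma halfplanes_fc x : cabs (x - w) < delta ->
  (forall a b, bd w a b -> 0 < crs (b - a) (x - a)) -> fc w x.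
Proof.
move=> hx H; have cl := @closed_closure _ (fc w).
suff S : segment w x `<=` fc w by apply/S/segmentr.
apply: (connected_clopen (@plane_segment_connected _ w x) (face_open pG ff) cl _ (segmentl _ _) fc_center).
apply/seteqP; split => y [Sy h]; (split; first exact: Sy); first exact: subset_closure.
have [Dy|] := pselect (drawing G y); last exact: face_closure_in.
have hy : cabs (y - w) < delta.
  by apply: ball_segment Sy => //; rewrite subrr cabs0.
case: Dy => [Vy|[a [b [ab Sab]]]].
  have /incident_dist : incident delta G y w by apply: (incidentI dw).
  by move=> E; move: hy; rewrite cabs_lt ?ltW // E ltxx.
have [Vy|Ny] := pselect (gvert G y).
  have /incident_dist : incident delta G y w by apply: (incidentI dw).
  by move=> E; move: hy; rewrite cabs_lt ?ltW // E ltxx.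
have [ia ib] := edge_closure_incident ab Sab Ny h.
have on a' b' : bd w a' b' -> segment a' b' y -> False.
  move=> B [t [_ _ E]].
  have : 0 < crs (b' - a') (y - a').
    case: Sy => s [s0 s1 ->]; rewrite -/(lerp w x s) crs_lerp.
    have := H _ _ B; have := bd_side B fc_center; nra.
  by rewrite E -/(lerp _ _ _) crs_lerp subrr /crs !cE; nra.
have [B|B] := bd_or ab ia ib; first by case: (on _ _ B Sab).
by case: (on _ _ B (segmentC Sab)).
Qed.

Lemma fc_convex x y t : fc w x -> closure (fc w) y -> 0 <= t -> t < 1 -> fc w (lerp x y t).
Proof.
move=> fx cy t0 t1; apply: halfplanes_fc; last first.
  move=> a b B; rewrite crs_lerp.
  have := bd_side B fx; have := bd_side_closure B cy; nra.
have := fc_disc fx; have := closure_fc_disc cy.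
have -> : lerp x y t - w = rc (1 - t) * (x - w) + rc t * (y - w).
  by apply: cplx_eq; rewrite !cE /=; ring.
move=> h1 h2; apply: (le_lt_trans (cabsD _ _)).
rewrite !cabs_rc !ger0_norm //; [nra|lra].
Qed.

(** If every side had [m] on its inner side, the radius to [m] would lie in the face by
    [halfplanes_fc], so [m] would be a closure point on the circle, hence a corner. This is how
    sides are shown to exist. *)
Lemma circle_separated m : nrm2 (m - w) = delta ^+ 2 -> ~ incident delta G m w ->
  exists a b, bd w a b /\ crs (b - a) (m - a) < 0.
Proof.
move=> hm Nm; apply: contrapT => H; apply: Nm.
have H' a b : bd w a b -> 0 <= crs (b - a) (m - a).
  by move=> B; rewrite leNgt; apply/negP => h; apply: H; exists a, b.
have cm : closure (fc w) m.
  apply: (@closure_line _ _ _ w) => t t0 t1; apply: halfplanes_fc; last first.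
    move=> a b B; rewrite crs_lerp; have := H' _ _ B; have := bd_side B fc_center; nra.
  have -> : lerp m w t - w = rc (1 - t) * (m - w) by apply: cplx_eq; rewrite !cE /=; ring.
  rewrite cabs_rc.
  have -> : cabs (m - w) = delta by apply/cabs_eq; [apply: ltW|].
  have := mulr_gt0 t0 delta0; rewrite ger0_norm; lra.
apply: (fun V => incidentI dw V cm); apply: contrapT => Nv.
by have := closure_fc_notvert cm Nv; rewrite cabs_lt ?ltW // hm ltxx.
Qed.
End OneCenter.
End Isoradial.

(** * Cyclic order on a circle *)

Section FiniteChoice.
Variable R : realType.

Lemma seq_argmax (T : eqType) (s : seq T) (g : T -> R) (x0 : T) : x0 \in s ->
  exists2 x, x \in s & forall y, y \in s -> g y <= g x.
Proof.
elim: s x0 => // a [|b s] IH x0 _.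
  by exists a; rewrite ?mem_head // => y; rewrite inE => /eqP ->.
have [x xs Hx] := IH b (mem_head _ _).
have [h|h] := leP (g x) (g a).
  exists a; rewrite ?mem_head // => y; rewrite inE => /orP[/eqP ->//|/Hx h'].
  exact: le_trans h.
exists x; first by rewrite inE xs orbT.
by move=> y; rewrite inE => /orP[/eqP ->|/Hx//]; apply: ltW.
Qed.

Lemma count_lt (T : eqType) (s : seq T) (P Q : pred T) (x : T) : x \in s -> Q x -> ~~ P x ->
  (forall y, P y -> Q y) -> (count P s < count Q s)%N.
Proof.
move=> + Qx Px PQ; elim: s => //= y s IH; rewrite inE => /orP[/eqP <-|/IH h].
  by rewrite (negPf Px) Qx add0n add1n ltnS sub_count.
rewrite -addnS leq_add //; case Py: (P y) => //=.
by rewrite PQ.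
Qed.

Lemma set_argmax (T : choiceType) (A : set T) (g : T -> R) : finite_set A -> A !=set0 ->
  exists2 x, A x & forall y, A y -> g y <= g x.
Proof.
move=> /finite_seqP [s ->] [x0 /= xs].
by have [x xs' Hx] := seq_argmax g xs; exists x.
Qed.

End FiniteChoice.

Section Circle.
Variable R : realType.
Implicit Types (a b c m p w x y z : cplx R) (k : R).

Definition orient a b c := crs (b - a) (c - a).

Lemma orient_rot a b c : orient a b c = orient b c a.
Proof. by rewrite /orient /crs !cE; ring. Qed.
Lemma orient_swap a b c : orient a c b = - orient a b c.
Proof. by rewrite /orient /crs !cE; ring. Qed.

(* Stereographic coordinate of [x] on the circle of centre [w] through [p], seen
   from [p]: the cotangent of half the angle from [p] to [x].  It decreases from
   [+oo] to [-oo] along the counterclockwise circle. *)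
Definition ctg w p x := crs (p - w) (x - w) / (nrm2 (p - w) - dot (p - w) (x - w)).

(** Inverse of [ctg]: the factor is (k + i)^2 / (k^2 + 1), the unit number whose half-angle has
    cotangent [k]. Orientation tests on the circle become comparisons of coordinates. *)
Definition circ w p k : cplx R := w + (p - w) *
  Complex ((k ^+ 2 - 1) / (k ^+ 2 + 1)) (2 * k / (k ^+ 2 + 1)).

Lemma sq1_gt0 k : 0 < k ^+ 2 + 1.
Proof. by rewrite ltr_wpDl ?sqr_ge0. Qed.
Lemma sq1_neq0 k : k ^+ 2 + 1 != 0. Proof. by rewrite gt_eqF // sq1_gt0. Qed.

Lemma circ_nrm2 w p k : nrm2 (circ w p k - w) = nrm2 (p - w).
Proof. by rewrite /nrm2 /circ !cE /=; field; rewrite sq1_neq0. Qed.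

Lemma ctgK w p x : nrm2 (x - w) = nrm2 (p - w) -> x <> p -> circ w p (ctg w p x) = x.
Proof.
move=> h xp.
have D0 : 0 < nrm2 (p - w) - dot (p - w) (x - w).
  have : 0 < nrm2 (x - p) by apply/nrm2_gt0 => /subr0_eq.
  have -> : nrm2 (x - p) = nrm2 (x - w) + nrm2 (p - w) - 2 * dot (p - w) (x - w).
    by rewrite /nrm2 /dot !cE; ring.
  by rewrite h; lra.
have D1 : 0 < nrm2 (p - w).
  rewrite lt_neqAle nrm2_ge0 andbT; apply/eqP => E; move: h; rewrite -E.
  move/nrm2_eq0/subr0_eq => xw; move/esym/nrm2_eq0/subr0_eq: E => pw.
  by apply: xp; rewrite xw pw.
have E : crs (p - w) (x - w) ^+ 2 = nrm2 (p - w) ^+ 2 - dot (p - w) (x - w) ^+ 2.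
  have : crs (p - w) (x - w) ^+ 2 + dot (p - w) (x - w) ^+ 2 = nrm2 (p - w) * nrm2 (x - w).
    by rewrite /nrm2 /dot /crs; ring.
  by rewrite h; lra.
have k1 : ctg w p x ^+ 2 + 1 = 2 * nrm2 (p - w) / (nrm2 (p - w) - dot (p - w) (x - w)).
  by rewrite /ctg exprMn E exprVn; field; rewrite gt_eqF.
have k2 : (ctg w p x ^+ 2 - 1) / (ctg w p x ^+ 2 + 1) = dot (p - w) (x - w) / nrm2 (p - w).
  rewrite k1 (_ : ctg w p x ^+ 2 - 1 = (ctg w p x ^+ 2 + 1) - 2); last by ring.
  by rewrite k1; field; rewrite !gt_eqF.
have k3 : 2 * ctg w p x / (ctg w p x ^+ 2 + 1) = crs (p - w) (x - w) / nrm2 (p - w).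
  by rewrite k1 /ctg; field; rewrite !gt_eqF.
rewrite /circ k2 k3; apply: cplx_eq; rewrite !cE /=; move: D1; rewrite /dot /crs /nrm2 !cE => D1.
  by field; rewrite gt_eqF.
by field; rewrite gt_eqF.
Qed.

Lemma orient_circ_base w p k1 k2 : orient p (circ w p k1) (circ w p k2) =
  4 * nrm2 (p - w) * (k1 - k2) / ((k1 ^+ 2 + 1) * (k2 ^+ 2 + 1)).
Proof.
by rewrite /orient /crs /nrm2 /circ !cE /=; field; rewrite !sq1_neq0.
Qed.

Lemma orient_circ w p k1 k2 k3 : orient (circ w p k1) (circ w p k2) (circ w p k3) =
  4 * nrm2 (p - w) * ((k1 - k2) * (k2 - k3) * (k1 - k3)) /
  ((k1 ^+ 2 + 1) * (k2 ^+ 2 + 1) * (k3 ^+ 2 + 1)).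
Proof.
by rewrite /orient /crs /nrm2 /circ !cE /=; field; rewrite !sq1_neq0.
Qed.

Section OnCircle.
Variables (w p : cplx R).
Hypothesis p0 : 0 < nrm2 (p - w).
Let K := ctg w p.

Lemma orient_ctg x y : nrm2 (x - w) = nrm2 (p - w) -> nrm2 (y - w) = nrm2 (p - w) ->
  x <> p -> y <> p -> (0 < orient p x y) = (K y < K x).
Proof.
move=> hx hy xp yp; rewrite -{1}(ctgK hx xp) -{1}(ctgK hy yp) orient_circ_base.
rewrite pmulr_lgt0; last by rewrite invr_gt0 mulr_gt0 ?sq1_gt0.
by rewrite pmulr_rgt0 ?subr_gt0 // mulr_gt0.
Qed.

Lemma orient3_ctg x y z : nrm2 (x - w) = nrm2 (p - w) -> nrm2 (y - w) = nrm2 (p - w) ->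
  nrm2 (z - w) = nrm2 (p - w) -> x <> p -> y <> p -> z <> p ->
  (0 < orient x y z) = (0 < (K x - K y) * (K y - K z) * (K x - K z)).
Proof.
move=> hx hy hz xp yp zp; rewrite -{1}(ctgK hx xp) -{1}(ctgK hy yp) -{1}(ctgK hz zp).
rewrite orient_circ pmulr_lgt0; last by rewrite invr_gt0 !mulr_gt0 ?sq1_gt0.
by rewrite pmulr_rgt0 // mulr_gt0.
Qed.

Lemma circ_neq k : circ w p k <> p.
Proof.
move=> E; have : nrm2 (circ w p k - p) = 0 by rewrite E subrr /nrm2 /= expr0n /= addr0.
have -> : nrm2 (circ w p k - p) = 4 * nrm2 (p - w) / (k ^+ 2 + 1).
  by rewrite /nrm2 /circ !cE /=; field; rewrite sq1_neq0.
by apply/eqP; rewrite gt_eqF // divr_gt0 ?mulr_gt0 ?sq1_gt0.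
Qed.

Lemma ctg_circ k : K (circ w p k) = k.
Proof.
rewrite /K /ctg.
have -> : crs (p - w) (circ w p k - w) = 2 * k * nrm2 (p - w) / (k ^+ 2 + 1).
  by rewrite /crs /circ /nrm2 !cE /=; field; rewrite sq1_neq0.
have -> : nrm2 (p - w) - dot (p - w) (circ w p k - w) = 2 * nrm2 (p - w) / (k ^+ 2 + 1).
  by rewrite /dot /circ /nrm2 !cE /=; field; rewrite sq1_neq0.
by field; rewrite sq1_neq0 gt_eqF.
Qed.

Lemma ctg_inj x y : nrm2 (x - w) = nrm2 (p - w) -> nrm2 (y - w) = nrm2 (p - w) ->
  x <> p -> y <> p -> K x = K y -> x = y.
Proof. by move=> hx hy xp yp E; rewrite -(ctgK hx xp) -(ctgK hy yp) -!/(K _) E. Qed.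
End OnCircle.

Section Cyclic.
(** [E a b] stands for: [b] follows [a] counterclockwise. [Eempty] keeps the other points of [N] off
    the arc from [a] to [b], which is to the right of the chord. *)
Variables (w : cplx R) (D : R) (N : set (cplx R)) (E : cplx R -> cplx R -> Prop).
Hypothesis D0 : 0 < D.
Hypothesis Nfin : finite_set N.
Hypothesis Ncirc : forall a, N a -> nrm2 (a - w) = D.
Hypothesis EN : forall a b, E a b -> N a /\ N b.
Hypothesis Ecrs : forall a b, E a b -> 0 < crs (a - w) (b - w).
Hypothesis Eempty : forall a b c, E a b -> N c -> c <> a -> c <> b -> 0 < orient a b c.

Lemma cyclic_neq a b : E a b -> a <> b.
Proof. by move=> /Ecrs + E'; rewrite E' /crs mulrC subrr ltxx. Qed.

Lemma cyclic_next_uniq a b b' : E a b -> E a b' -> b = b'.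
Proof.
move=> h h'; apply: contrapT => bb.
have [_ Nb] := EN h; have [_ Nb'] := EN h'.
have := Eempty h Nb' (nesym (cyclic_neq h')) (nesym bb).
by have := Eempty h' Nb (nesym (cyclic_neq h)) bb; rewrite orient_swap; lra.
Qed.

Lemma cyclic_prev_uniq a a' b : E a b -> E a' b -> a = a'.
Proof.
move=> h h'; apply: contrapT => aa.
have [Na _] := EN h; have [Na' _] := EN h'.
have := Eempty h Na' (nesym aa) (cyclic_neq h').
by have := Eempty h' Na aa (cyclic_neq h); rewrite !(orient_rot _ b) orient_swap; lra.
Qed.

(** The successor map is injective on a finite set, hence onto. *)
Lemma cyclic_prev : (forall a, N a -> exists b, E a b) -> forall b, N b -> exists a, E a b.
Proof.
move=> next; have [s Es] := (finite_seqP _).1 Nfin.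
have /choice [f Hf] : forall a, exists b, N a -> E a b.
  by move=> a; have [/next [b ab]|Na] := pselect (N a); [exists b|exists a].
pose t := undup s.
have tN a : (a \in t) <-> N a by rewrite mem_undup Es.
have ut : uniq (map f t).
  rewrite map_inj_in_uniq ?undup_uniq // => a b /tN Na /tN Nb fab.
  by apply: (cyclic_prev_uniq (Hf a Na)); rewrite fab; apply: Hf.
have sub : {subset map f t <= t}.
  by move=> x /mapP [a /tN Na ->]; apply/tN; have [] := EN (Hf a Na).
have [_ eqi] := uniq_min_size ut sub (eq_leq (esym (size_map f t))).
by move=> b /tN; rewrite -eqi => /mapP [a /tN Na ->]; exists a; apply: Hf.
Qed.

(** Take the point [c] of least coordinate seen from [m], the last one before the turn returns to
    [m]. Its successor has a larger coordinate, so the arc from [c] to it contains [m]. *)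
Lemma cyclic_cover m : N !=set0 -> (forall a, N a -> exists b, E a b) ->
  nrm2 (m - w) = D -> ~ N m -> exists c d, E c d /\ orient c d m < 0.
Proof.
move=> N0 next hm Nm.
have [c Nc Hc] := set_argmax (fun x => - ctg w m x) Nfin N0.
have [d cd] := next c Nc; exists c, d; split => //.
have [_ Nd] := EN cd.
have cm : c <> m by move=> cm; apply: Nm; rewrite -cm.
have dm : d <> m by move=> dm; apply: Nm; rewrite -dm.
rewrite -orient_rot orient_swap oppr_lt0 (@orient_ctg w) ?hm ?Ncirc //.
have := Hc d Nd; rewrite lerN2 le_eqVlt => /orP[/eqP h|//].
case: (cyclic_neq cd); apply: (@ctg_inj w m) => //; rewrite ?hm ?Ncirc //.
Qed.

(* The successor map is a single cycle: it visits the points in decreasing order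
   of their coordinate. *)
Lemma cyclic_ind a0 (P : nat -> cplx R -> Prop) : N a0 -> P 0%N a0 ->
  (forall b, N b -> exists a, E a b) ->
  (forall (k : nat) a b, E a b -> P k a -> P k.+1 b) ->
  (forall (k l : nat) a, (k <= l)%N -> P k a -> P l a) ->
  forall s : seq (cplx R), N = [set` s] -> forall a, N a -> P (size s) a.
Proof.
move=> Na0 P0 prev step mono s Es.
(* Counts the points met from [a0], excluded, up to [a]; the predecessor of [a] has smaller rank. *)
pose rk a := size [seq x <- s | (x != a0) && (ctg w a0 a <= ctg w a0 x)].
have H : forall n a, N a -> a <> a0 -> (rk a <= n)%N -> P n a.
  elim=> [|n IH] a Na aa0.
    rewrite leqn0 size_eq0 => /eqP h.
    have : a \in [seq x <- s | (x != a0) && (ctg w a0 a <= ctg w a0 x)].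
      rewrite mem_filter lexx andbT; apply/andP; split; first exact/eqP.
      by move: Na; rewrite Es.
    by rewrite h.
  move=> rka; have [b ba] := prev a Na; have [Nb _] := EN ba.
  apply: (step _ _ _ ba).
  have [->|/eqP bb] := eqVneq b a0; first exact: mono P0.
  apply: IH => //; rewrite -ltnS; apply: leq_trans rka.
  have lt : ctg w a0 a < ctg w a0 b.
    rewrite -(@orient_ctg w) ?Ncirc //.
    by rewrite orient_rot; apply: Eempty => //; apply: nesym.
  rewrite /rk !size_filter; apply: (@count_lt _ _ _ _ a).
  - by move: Na; rewrite Es.
  - by rewrite lexx andbT; apply/eqP.
  - by rewrite negb_and -ltNge lt orbT.
  - by move=> y /andP[-> h] /=; apply: le_trans h; apply: ltW.
move=> a Na; have [->|/eqP aa] := eqVneq a a0; first exact: mono P0.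
by apply: H => //; rewrite /rk size_filter count_size.
Qed.
End Cyclic.
End Circle.

(** * Edges and rhombi *)

Section Apex.
Variable R : realType.
Implicit Types (a b c u x y z v w : cplx R) (delta : R).

(* Tangent of the half-angle at [a] of the rhombus of side [delta] with diagonal
   [[a, b]]. *)
Definition tanw delta a b := Num.sqrt (4 * delta ^+ 2 / nrm2 (b - a) - 1).

(* The corner to the left of the diagonal from [a] to [b]; the right corner is
   [lft delta b a]. *)
Definition lft delta a b : cplx R :=
  Complex ((Re a + Re b - tanw delta a b * (Im b - Im a)) / 2)
          ((Im a + Im b + tanw delta a b * (Re b - Re a)) / 2).

Lemma tanwC delta a b : tanw delta a b = tanw delta b a.
Proof. by rewrite /tanw nrm2C. Qed.

Lemma lft_sum delta a b : lft delta a b + lft delta b a = a + b.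
Proof.
apply: cplx_eq; rewrite /lft !cE /= (tanwC _ b a).
  by field.
by field.
Qed.

(** For A and B of equal length, |A + B|^2 |B - A|^2 = (2 crs A B)^2, and the parallelogram law
    turns the radicand of [tanw] into |A + B|^2 / |B - A|^2. *)
Lemma tanwE delta w a b : nrm2 (a - w) = delta ^+ 2 -> nrm2 (b - w) = delta ^+ 2 ->
  0 < crs (a - w) (b - w) ->
  tanw delta a b = nrm2 (a + b - 2 * w) / (2 * crs (a - w) (b - w)).
Proof.
move=> ha hb h; set A := a - w; set B := b - w.
have hAB : nrm2 (a + b - 2 * w) = nrm2 (A + B) by congr nrm2; rewrite /A /B; ring.
have hBA : nrm2 (b - a) = nrm2 (B - A) by congr nrm2; rewrite /A /B; ring.
have prod : nrm2 (A + B) * nrm2 (B - A) = (2 * crs A B) ^+ 2.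
  have e : nrm2 B - nrm2 A = 0 by rewrite /A /B ha hb subrr.
  have -> : nrm2 (A + B) * nrm2 (B - A) = (nrm2 B - nrm2 A) ^+ 2 + (2 * crs A B) ^+ 2.
    by rewrite /nrm2 /crs !cE; ring.
  by rewrite e expr0n add0r.
have par : nrm2 (A + B) + nrm2 (B - A) = 4 * delta ^+ 2.
  have -> : nrm2 (A + B) + nrm2 (B - A) = 2 * nrm2 A + 2 * nrm2 B.
    by rewrite /nrm2 !cE; ring.
  by rewrite /A /B ha hb; ring.
have c0 : 0 < 2 * crs A B by rewrite mulr_gt0.
have BA0 : 0 < nrm2 (B - A).
  rewrite lt_neqAle nrm2_ge0 andbT; apply/eqP => E.
  by move: prod; rewrite -E mulr0 => /esym/eqP; rewrite sqrf_eq0 gt_eqF.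
rewrite /tanw hAB hBA -par mulrDl divff ?gt_eqF // addrK.
have -> : nrm2 (A + B) / nrm2 (B - A) = (nrm2 (A + B) / (2 * crs A B)) ^+ 2.
  have AB0 : 0 < nrm2 (A + B).
    rewrite lt_neqAle nrm2_ge0 andbT; apply/eqP => E.
    by move: prod; rewrite -E mul0r => /esym/eqP; rewrite sqrf_eq0 gt_eqF.
  by rewrite expr_div_n -prod; field; rewrite !gt_eqF.
by rewrite sqrtr_sqr ger0_norm // divr_ge0 ?nrm2_ge0 // ltW.
Qed.

Lemma lftE delta w a b : nrm2 (a - w) = delta ^+ 2 -> nrm2 (b - w) = delta ^+ 2 ->
  0 < crs (a - w) (b - w) -> w = lft delta a b.
Proof.
move=> ha hb h; have := tanwE ha hb h.
set k := tanw delta a b => hk.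
have {}hk : k * (2 * crs (a - w) (b - w)) = nrm2 (a + b - 2 * w).
  by rewrite hk divfK // gt_eqF // mulr_gt0.
have e : nrm2 (b - w) - nrm2 (a - w) = 0 by rewrite ha hb subrr.
have c0 : crs (a - w) (b - w) != 0 by rewrite gt_eqF.
have two : (2 : R) != 0 by rewrite pnatr_eq0.
have kx : k * (Im b - Im a) = Re a + Re b - 2 * Re w.
  apply: (mulIf c0); apply: (mulIf two); apply/eqP; rewrite -subr_eq0.
  rewrite [X in X == 0](_ : _ = (Im b - Im a) * (k * (2 * crs (a - w) (b - w))) -
    2 * crs (a - w) (b - w) * (Re a + Re b - 2 * Re w)); last by ring.
  apply/eqP; rewrite hk -[RHS](mulr0 (Im a + Im b - 2 * Im w)) -e.
  by rewrite /nrm2 /crs !cE /=; ring.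
have ky : k * (Re b - Re a) = 2 * Im w - Im a - Im b.
  apply: (mulIf c0); apply: (mulIf two); apply/eqP; rewrite -subr_eq0.
  rewrite [X in X == 0](_ : _ = (Re b - Re a) * (k * (2 * crs (a - w) (b - w))) -
    2 * crs (a - w) (b - w) * (2 * Im w - Im a - Im b)); last by ring.
  apply/eqP; rewrite hk -[RHS](mulr0 (Re a + Re b - 2 * Re w)) -e.
  by rewrite /nrm2 /crs !cE /=; ring.
apply: cplx_eq; rewrite /lft /= -/k ?kx ?ky.
  by field.
by field.
Qed.

End Apex.

(** * Successive sides of a face, adjacent faces and the empty circle property *)

Section Polygon.
Variable R : realType.
Variables (delta : R) (G : geom_graph R).
Hypothesis delta0 : 0 < delta.
Hypothesis iG : isoradial delta G.
Implicit Types (a b c u x y z v w : cplx R).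
Let pG : plane_graph G := iG.1.
Notation bd := (bd delta G).
Notation inc := (incident delta G).
Notation dual := (dual_vert delta G).
Notation lft := (lft delta).

Lemma bd_dual w a b : bd w a b -> dual w.
Proof. by case=> _ /incidentE []. Qed.

Lemma bd_lft w a b : bd w a b -> w = lft a b.
Proof. by case=> _ ia ib h; exact: (lftE (incident_dist ia) (incident_dist ib) h). Qed.

(** The other corners are on the inner side of the line of a side, and not on it since a line meets
    the circle at most twice. *)
Lemma bd_empty w a b c : bd w a b -> inc c w -> c <> a -> c <> b -> 0 < orient a b c.
Proof.
move=> B ic ca cb; have [dw Vc Cc] := incidentE ic.
have h := bd_side_closure delta0 iG dw B Cc.
rewrite lt_neqAle h andbT; apply/eqP => /esym E.
have [ab ia ib _] := B.
have [s Es] := collinear_lerp (edge_neq pG ab) E.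
have ab0 : 0 < nrm2 (a - b) by apply/nrm2_gt0 => /subr0_eq; apply: edge_neq ab.
have : s * (1 - s) * nrm2 (a - b) = delta ^+ 2 - nrm2 (c - w).
  have -> : delta ^+ 2 = (1 - s) * nrm2 (a - w) + s * nrm2 (b - w).
    by rewrite (incident_dist ia) (incident_dist ib); ring.
  by rewrite Es /nrm2 !cE /=; ring.
rewrite (incident_dist ic) subrr => /eqP; rewrite !mulf_eq0 (gt_eqF ab0) orbF.
move=> /orP[/eqP s0|]; first by apply: ca; rewrite Es s0 lerp0.
by rewrite subr_eq0 => /eqP s1; apply: cb; rewrite Es -s1 lerp1.
Qed.

Lemma inc_finite w : finite_set [set u | inc u w].
Proof.
apply: sub_finite_set (plane_finite_vert pG (cabs w + delta)) => u /= iu.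
have [_ Vu _] := incidentE iu; split => //.
have := cabs_triangle u w 0; rewrite !subr0.
have -> : cabs (u - w) = delta by apply/cabs_eq; [exact: ltW|exact: (incident_dist iu)].
by rewrite [X in _ <= X]addrC.
Qed.

Lemma bd_inc w a b : bd w a b -> inc a w /\ inc b w.
Proof. by case. Qed.
Lemma bd_crs w a b : bd w a b -> 0 < crs (a - w) (b - w).
Proof. by case. Qed.

Lemma bd_neq w a b : bd w a b -> a <> b.
Proof. by case=> ab _ _ _; apply: edge_neq ab. Qed.

Lemma sqr_delta_gt0 : 0 < delta ^+ 2. Proof. by rewrite exprn_gt0. Qed.

(** The next corner [b] has the largest coordinate seen from [a]. No corner lies on the arc between
    them, so a point [m] of that arc is cut off by a side, which can only be the one from [a] to
    [b]. *)
Lemma bd_next w a : inc a w -> exists b, bd w a b.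
Proof.
move=> ia; have [dw Va _] := incidentE ia; have D0 := sqr_delta_gt0.
have ha := incident_dist ia.
have p0 : 0 < nrm2 (a - w) by rewrite ha.
pose N := [set c | inc c w /\ c <> a].
have Nfin : finite_set N by apply: sub_finite_set (inc_finite w) => c [].
pose K := ctg w a.
have sep m : nrm2 (m - w) = delta ^+ 2 -> m <> a -> ~ N m -> exists c d, bd w c d /\ orient c d m < 0.
  by move=> hm ma Nm; apply: circle_separated => // im; apply: Nm.
have hK c : inc c w -> nrm2 (c - w) = nrm2 (a - w) by move/incident_dist => ->.
(* A second corner exists: the antipode of [a], of coordinate 0, is either a corner or cut off by a
   side. *)
have [b [ib ba] Hb] : exists2 b, N b & forall c, N c -> K c <= K b.
  apply: set_argmax => //; apply: contrapT => N0.
  have [|||c [d [B _]]] := sep (circ w a 0).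
  - by rewrite circ_nrm2.
  - exact: circ_neq.
  - by move=> Nm; apply: N0; eexists; exact: Nm.
  have [ic id] := bd_inc B.
  have [E|/eqP E] := eqVneq c a; apply: N0; last by exists c.
  by exists d; split => // E'; apply: (bd_neq B); rewrite E E'.
pose m := circ w a (K b + 1).
have Km : K m = K b + 1 by apply: ctg_circ.
have ma : m <> a by apply: circ_neq.
have hm : nrm2 (m - w) = nrm2 (a - w) by apply: circ_nrm2.
have [|||c [d [B om]]] := sep m => //.
- by rewrite hm.
- by move=> /Hb; rewrite Km; lra.
have [ic id] := bd_inc B; exists b.
have KM x : inc x w -> x <> a -> K x < K m.
  by move=> ix xa; have := Hb x (conj ix xa); rewrite Km; lra.
have [E|/eqP ca] := eqVneq c a.
  have [<-|/eqP db] := eqVneq d b; first by rewrite -E.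
  have da : d <> a by move=> da; apply: (bd_neq B); rewrite E da.
  have := bd_empty B ib; rewrite E (orient_ctg p0 (hK d id) (hK b ib) da ba) => /(_ ba (nesym db)).
  by have := Hb d (conj id da); rewrite -/K; lra.
have := KM c ic ca.
have [E|/eqP da] := eqVneq d a.
  move: om; rewrite E orient_rot orient_swap oppr_lt0 (orient_ctg p0 (hK c ic) hm ca ma).
  by rewrite -/K; lra.
have := KM d id da; have := bd_empty B ia (nesym ca) (nesym da).
rewrite -orient_rot (orient_ctg p0 (hK c ic) (hK d id) ca da) -/K.
move: om; rewrite -oppr_gt0 -orient_swap => + h1 h2 h3.
rewrite (orient3_ctg p0 (hK c ic) hm (hK d id) ca ma da) -/K => h4.
suff : (K c - K m) * (K m - K d) * (K c - K d) <= 0 by rewrite leNgt h4.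
have h5 : 0 < (K m - K c) * (K m - K d) by rewrite mulr_gt0 ?subr_gt0.
nra.
Qed.

Lemma bd_prev w b : inc b w -> exists a, bd w a b.
Proof.
apply: (cyclic_prev (inc_finite w) (@bd_inc w) (@bd_crs w)) => //.
- by move=> a c d; exact: bd_empty.
- exact: bd_next.
Qed.

Lemma bd_next_uniq w a b b' : bd w a b -> bd w a b' -> b = b'.
Proof.
apply: (cyclic_next_uniq (@bd_inc w) (@bd_crs w)) => ? ? ?; exact: bd_empty.
Qed.

Lemma bd_prev_uniq w a a' b : bd w a b -> bd w a' b -> a = a'.
Proof.
apply: (cyclic_prev_uniq (@bd_inc w) (@bd_crs w)) => ? ? ?; exact: bd_empty.
Qed.

Lemma component_face x : ~ drawing G x -> exists2 w, dual w & fc G w x.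
Proof.
move=> Nx; pose f := connected_component (~` drawing G) x.
have ff : face G f by exists x.
have fx : f x by apply: connected_component_refl.
have [w fw inf] := iG.2 f ff.
have dw : dual w by exists f.
by exists w => //; rewrite /fc -(face_component ff fw).
Qed.

(** The midpoint pushed to the left by less than the isolation radius is off the drawing, in a face
    with the edge in its closure. [bd_or] makes the edge a side of that face, and the position of
    the pushed point decides the orientation. *)
Lemma left_face a b : gedge G a b -> exists w, bd w a b.
Proof.
move=> ab; pose x := lerp a b 2^-1.
have aneb := edge_neq pG ab.
have h0 : 0 < (2^-1 : R) by rewrite invr_gt0.
have h1 : (2^-1 : R) < 1 by rewrite invf_lt1 ?ltr1n.
have Nx : ~ gvert G x by apply: edge_inner_notvert.
have Sx : segment a b x by exists 2^-1; split => //; apply: ltW.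
have [e e0 He] := edge_point_isolated pG ab Sx Nx.
have n0 : 0 < nrm2 (b - a) by apply/nrm2_gt0 => /subr0_eq /esym.
pose L := cabs (b - a).
have L0 : 0 < L by rewrite /L cabsE sqrtr_gt0.
pose y : cplx R := x + rc (e / (2 * L)) * (Complex 0 1 * (b - a)).
have xy : cabs (y - x) < e.
  have -> : y - x = rc (e / (2 * L)) * (Complex 0 1 * (b - a)) by rewrite /y; ring.
  have -> : cabs (rc (e / (2 * L)) * (Complex 0 1 * (b - a))) = e / (2 * L) * L.
    rewrite cabs_rc ger0_norm ?divr_ge0 ?mulr_ge0 ?(ltW L0) ?(ltW e0) //.
    by congr (_ * _); rewrite /L !cabsE; congr Num.sqrt; rewrite /nrm2 !cE /=; ring.
  rewrite (_ : e / (2 * L) * L = e / 2); first lra.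
  by field; rewrite gt_eqF.
have cx : crs (b - a) (x - a) = 0 by rewrite /x crs_lerp /crs !cE; ring.
have cy : 0 < crs (b - a) (y - a).
  have -> : crs (b - a) (y - a) = e / (2 * L) * nrm2 (b - a) + crs (b - a) (x - a).
    by rewrite /y /crs /nrm2 !cE /=; ring.
  by rewrite cx addr0 mulr_gt0 // divr_gt0 // mulr_gt0.
have off z : cabs (z - x) < e -> 0 < crs (b - a) (z - a) -> ~ drawing G z.
  move=> hz cz Dz; case: (He z hz Dz) => t [_ _ E]; move: cz.
  by rewrite E -/(lerp a b t) crs_lerp /crs !cE; nra.
have [w dw fy] := component_face (off y xy cy).
have ff := fc_face dw.
have fxy t : 0 < t -> t <= 1 -> fc G w (lerp x y t).
  move=> t0 t1; apply: (face_segment ff fy) => z Sz; apply: off.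
    apply: (ball_segment xy _ Sz).
    rewrite (_ : lerp x y t - x = rc t * (y - x)); last by rewrite /lerp; ring.
    rewrite cabs_rc ger0_norm ?(ltW t0) //.
    by apply: le_lt_trans xy; rewrite ler_piMl ?cabs_ge0.
  case: Sz => s [s0 s1 ->]; rewrite -/(lerp y (lerp x y t) s).
  rewrite (crs_lerp a b y (lerp x y t)) (crs_lerp a b x y) cx.
  have := mulr_gt0 t0 cy => h; have [s_eq|/eqP s_eq] := eqVneq s 0.
    by rewrite s_eq; lra.
  have s00 : 0 < s by rewrite lt_neqAle s0 andbT; apply/eqP => /esym.
  have := mulr_gt0 s00 h; have : 0 <= (1 - s) * crs (b - a) (y - a).
    by rewrite mulr_ge0 ?(ltW cy) // subr_ge0.
  nra.
have cfx : closure (fc G w) x := closure_line fxy.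
have [ia ib] := edge_closure_incident iG dw ab Sx Nx cfx.
have [B|B] := bd_or delta0 iG dw ab ia ib; first by exists w.
have rev z : crs (a - b) (z - b) = - crs (b - a) (z - a) by rewrite /crs !cE; ring.
by have := bd_side delta0 iG dw B fy; rewrite rev oppr_gt0 ltNge (ltW cy).
Qed.

(** Both centers along an edge are values of [lft], and [lft_sum] makes them symmetric about its
    midpoint. *)
Lemma bd_refl w a b : bd w a b -> bd (a + b - w) b a.
Proof.
move=> B; have [ab _ _ _] := B.
have [w' B'] := left_face (plane_sym pG ab).
by rewrite (bd_lft B) -(lft_sum delta a b) addrAC subrr add0r -(bd_lft B').
Qed.

Lemma tanw_gt0 w a b : bd w a b -> 0 < tanw delta a b.
Proof.
move=> B; have [_ ia ib h] := B.
rewrite (tanwE (incident_dist ia) (incident_dist ib) h) divr_gt0 ?mulr_gt0 //.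
rewrite lt_neqAle nrm2_ge0 andbT; apply/eqP => /esym/nrm2_eq0 E.
move: h; have -> : b - w = - (a - w) by rewrite -[LHS]subr0 -E; ring.
have -> : crs (a - w) (- (a - w)) = 0 by rewrite /crs !cE; ring.
by rewrite ltxx.
Qed.

Lemma lft_reflect_dist a b v :
  nrm2 (v - lft b a) - nrm2 (v - lft a b) = 2 * tanw delta a b * crs (b - a) (v - a).
Proof. by rewrite /nrm2 /crs /lft !cE /= (tanwC _ b a); field. Qed.

Lemma dual_bd w : dual w -> exists a b, bd w a b.
Proof.
move=> dw; have hm : nrm2 (w + rc delta - w) = delta ^+ 2.
  by rewrite (_ : w + rc delta - w = rc delta) /nrm2 /= ?expr0n ?addr0 //; ring.
have [i|Ni] := pselect (inc (w + rc delta) w).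
  by have [b B] := bd_next i; exists (w + rc delta), b.
by have [a [b [B _]]] := circle_separated delta0 iG dw hm Ni; exists a, b.
Qed.

Lemma inc_cabs u w : inc u w -> cabs (u - w) = delta.
Proof. by move=> i; apply/cabs_eq; [exact: ltW|exact: (incident_dist i)]. Qed.

Lemma dual_finite p (r : R) : finite_set [set w | dual w /\ cabs (w - p) <= r].
Proof.
have F := plane_finite_edge pG (r + cabs p + delta).
apply: sub_finite_set (finite_image (fun e => lft e.1 e.2) F) => w [dw wp].
have [a [b B]] := dual_bd dw.
exists (a, b); last by rewrite /= -(bd_lft B).
have [ab ia _ _] := B.
split => //=; exists a; first exact: segmentl.
have := cabs_triangle a w 0; have := cabs_triangle w p 0; rewrite !subr0 (inc_cabs ia).
lra.
Qed.

(** Among the finitely many centers whose circle strictly contains [v], take the nearest to [v]. A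
    vertex is in no face, so [v] is beyond one of the sides, and the center across that side is
    strictly nearer. *)
Lemma delaunay v w : gvert G v -> dual w -> delta ^+ 2 <= nrm2 (v - w).
Proof.
move=> Vv; move: w.
pose W := [set w | dual w /\ nrm2 (v - w) < delta ^+ 2].
have Wfin : finite_set W.
  apply: sub_finite_set (dual_finite v delta) => w [dw h]; split => //.
  by rewrite cabsC cabs_le ?ltW.
suff : ~ (W !=set0).
  by move=> H w dw; rewrite leNgt; apply/negP => h; apply: H; exists w.
move=> W0; have [w [dw h] Hw] := set_argmax (fun w => - nrm2 (v - w)) Wfin W0.
have Ni a : inc a w -> v <> a.
  by move=> ia E; move: h; rewrite E (incident_dist ia) ltxx.
have [a [b [B le0]]] : exists a b, bd w a b /\ crs (b - a) (v - a) <= 0.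
  apply: contrapT => N; have fv : fc G w v.
    apply: (halfplanes_fc delta0 iG dw); first by rewrite cabs_lt ?ltW.
    by move=> a b B; rewrite ltNge; apply/negP => le0; apply: N; exists a, b.
  by apply: (face_notin_drawing (fc_face dw) fv); left.
have [ab ia ib _] := B.
have lt0 : crs (b - a) (v - a) < 0.
  rewrite lt_neqAle le0 andbT; apply/eqP => E.
  have hv : cabs (v - w) < delta by rewrite cabs_lt ?ltW.
  have S := chord_segment delta0 (edge_neq pG ab) (incident_dist ia) (incident_dist ib) hv E.
  by have [E'|E'] := plane_vertex_edge pG ab Vv S; [apply: (Ni a)|apply: (Ni b)].
have B' := bd_refl B.
have : nrm2 (v - (a + b - w)) < nrm2 (v - w).
  rewrite -subr_lt0 (bd_lft B') (bd_lft B) lft_reflect_dist.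
  by rewrite pmulr_rlt0 // mulr_gt0 // (tanw_gt0 B).
move=> lt; have /Hw : W (a + b - w) by split; [exact: bd_dual B'|exact: lt_trans lt h].
by rewrite lerN2 leNgt lt.
Qed.

(** An edge at [u] gives a face by [left_face]. Without edges, a short segment from [u] avoids the
    drawing except at [u], and the face containing the rest of it has [u] in its closure. *)
Lemma vert_incident u : gvert G u -> exists w, inc u w.
Proof.
move=> Vu; apply: contrapT => N.
have NE b : ~ gedge G u b.
  by move=> /left_face [w [_ i _ _]]; apply: N; exists w.
have NE' a : ~ gedge G a u by move=> /(plane_sym pG)/NE.
have [e e0 He] := edge_isolated pG u; have [e' e'0 He'] := vert_isolated pG u.
pose d := Num.min e e' / 2.
have d0 : 0 < d by rewrite divr_gt0 // lt_min e0.
have de : d < e /\ d < e'.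
  have : Num.min e e' <= e by rewrite ge_min lexx.
  have : Num.min e e' <= e' by rewrite ge_min lexx orbT.
  by move: d0; rewrite /d; lra.
have cd : cabs (rc d : cplx R) = d.
  by rewrite cabsE /nrm2 /= expr0n /= addr0 sqrtr_sqr ger0_norm ?ltW.
have off t : 0 < t -> t <= 1 -> ~ drawing G (lerp u (u + rc d) t).
  have Et : cabs (lerp u (u + rc d) t - u) = `|t| * d.
    rewrite -[X in _ * X]cd -cabs_rc; congr cabs; rewrite /lerp; ring.
  move=> t0 t1; have td : `|t| * d <= d by rewrite ger0_norm ?(ltW t0) // ler_piMl // ltW.
  move=> [V|[a [b [ab S]]]].
    have E : lerp u (u + rc d) t = u by apply: He' V _; rewrite Et; case: de; lra.
    by move: Et; rewrite E subrr cabs0 => /esym/eqP; rewrite mulf_eq0 normr_eq0 !gt_eqF.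
  have S' : segment a b u by apply: He ab S _; rewrite Et; case: de; lra.
  by have [E|E] := plane_vertex_edge pG ab Vu S'; rewrite -E in ab; [apply: NE ab|apply: NE' ab].
have := off 1 ltr01 (lexx _); rewrite lerp1 => Ny.
have [w dw fy] := component_face Ny.
have ff := fc_face dw.
apply: N; exists w; apply: (incidentI dw Vu).
apply: (@closure_line _ _ _ (u + rc d)) => t t0 t1; apply: (face_segment ff fy) => z.
move=> [s [s0 s1 ->]].
rewrite (_ : _ + _ = lerp u (u + rc d) ((1 - s) + s * t)).
  by apply: off; nra.
by apply: cplx_eq; rewrite /lerp !cE /=; ring.
Qed.

Lemma vert_edge u : gvert G u -> exists o, gedge G u o.
Proof. by move=> /vert_incident [w /bd_next [b [ub _ _ _]]]; exists b. Qed.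
End Polygon.

Section Triangle.
Variable R : realType.
Variables (delta : R) (G : geom_graph R).
Hypothesis delta0 : 0 < delta.
Hypothesis iG : isoradial delta G.
Implicit Types (a b c u x y z v w : cplx R) (p q s t : R).
Let pG : plane_graph G := iG.1.
Notation bd := (bd delta G).
Notation inc := (incident delta G).
Notation dual := (dual_vert delta G).
Notation lft := (lft delta).

(** A center is recovered from any side of its face by [lft]. *)
Lemma dual_uniq w w' y : dual w -> dual w' -> fc G w y -> fc G w' y -> w = w'.
Proof.
move=> dw dw' fy fy'.
have E : fc G w = fc G w'.
  by rewrite (face_component (fc_face dw) fy) (face_component (fc_face dw') fy').
have [a [b B]] := dual_bd delta0 iG dw; have [ab ia ib h] := B.
have I x : inc x w -> inc x w'.
  by move=> /incidentE [_ Vx Cx]; apply: (incidentI dw' Vx); rewrite -E.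
have fw' : fc G w w' by rewrite E; exact: (fc_center dw').
have h' := bd_side delta0 iG dw B fw'; rewrite crs_center in h'.
have B' : bd w' a b by split; [exact: ab|exact: I ia|exact: I ib|exact: h'].
by rewrite (bd_lft B) (bd_lft B').
Qed.

Lemma bd_dot w a b : bd w a b -> dot (a - w) (b - w) < delta ^+ 2.
Proof.
move=> [_ ia ib h]; have D0 : 0 < delta ^+ 2 by rewrite exprn_gt0.
have : dot (a - w) (b - w) ^+ 2 + crs (a - w) (b - w) ^+ 2 = delta ^+ 2 * delta ^+ 2.
  rewrite -{1}(incident_dist ia) -(incident_dist ib) /dot /crs /nrm2; ring.
have := mulr_gt0 h h; set k := crs _ _; set d := dot _ _; set D := delta ^+ 2 in D0 *.
by move=> k0 E; rewrite ltNge; apply/negP => dD; nra.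
Qed.

Lemma triangle_fc w a b p q : dual w -> closure (fc G w) a -> closure (fc G w) b ->
  0 <= p -> 0 <= q -> p + q < 1 -> fc G w (w + rc p * (a - w) + rc q * (b - w)).
Proof.
move=> dw ca cb p0 q0 pq; have p1 : 0 < 1 - p by lra.
have -> : w + rc p * (a - w) + rc q * (b - w) = lerp (lerp w b (q / (1 - p))) a p.
  have E : q = (1 - p) * (q / (1 - p)) by rewrite mulrC divfK // gt_eqF.
  by rewrite {1}E; apply: cplx_eq; rewrite /lerp !cE /=; ring.
apply: (fc_convex delta0 iG dw _ ca p0); last lra.
apply: (fc_convex delta0 iG dw (fc_center dw) cb); first by rewrite divr_ge0 // ltW.
by rewrite ltr_pdivrMr // mul1r; lra.
Qed.

(** If the point were w + t (v - w), then t >= p + q because [v] is on the inner side of the line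
    from [a] to [b], whereas t < p + q by comparing norms, the scalar product of a - w and b - w
    being less than delta^2. *)
Lemma triangle_avoid w a b p q v : bd w a b -> inc v w -> 0 < p -> 0 < q ->
  p + q < 1 -> ~ segment w v (w + rc p * (a - w) + rc q * (b - w)).
Proof.
move=> B iv p0 q0 pq [t [t0 t1 E]]; have [dw Vv Cv] := incidentE iv.
have [_ ia ib h] := B; have := bd_dot B; have := bd_side_closure delta0 iG dw B Cv.
have Ex : p * Re (a - w) + q * Re (b - w) = t * Re (v - w).
  by have := congr1 (fun z : cplx R => Re z) E; rewrite !cE /=; lra.
have Ey : p * Im (a - w) + q * Im (b - w) = t * Im (v - w).
  by have := congr1 (fun z : cplx R => Im z) E; rewrite !cE /=; lra.
have : t * t * nrm2 (v - w) = p * p * nrm2 (a - w) + q * q * nrm2 (b - w) +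
    2 * p * q * dot (a - w) (b - w).
  have -> : t * t * nrm2 (v - w) = (t * Re (v - w)) ^+ 2 + (t * Im (v - w)) ^+ 2.
    by rewrite /nrm2; ring.
  by rewrite -Ex -Ey /nrm2 /dot; ring.
have : t * crs (b - a) (v - a) = (t - p - q) * crs (a - w) (b - w).
  have -> : t * crs (b - a) (v - a) = (Re (b - w) - Re (a - w)) * (t * Im (v - w))
      - (Im (b - w) - Im (a - w)) * (t * Re (v - w)) + t * crs (a - w) (b - w).
    by rewrite /crs !cE; ring.
  by rewrite -Ex -Ey /crs; ring.
rewrite (incident_dist ia) (incident_dist ib) (incident_dist iv).
set D := delta ^+ 2; set d := dot _ _; set k := crs (a - w) (b - w).
set l := crs (b - a) (v - a) => e1 e2 l0 dD.
have D0 : 0 < D by rewrite exprn_gt0.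
have k0 : 0 < k by [].
have tpq : 0 <= t - p - q.
  rewrite leNgt; apply/negP => n.
  have : (t - p - q) * k < 0 by rewrite nmulr_rlt0.
  by rewrite -e1 ltNge mulr_ge0.
have e3 : (t * t - (p + q) * (p + q)) * D = 2 * p * q * (d - D).
  have -> : (t * t - (p + q) * (p + q)) * D = t * t * D - (p + q) * (p + q) * D by ring.
  by rewrite e2; ring.
have : (t * t - (p + q) * (p + q)) * D < 0.
  by rewrite e3 pmulr_rlt0 ?subr_lt0 // !mulr_gt0.
by rewrite pmulr_llt0 // ltNge; nra.
Qed.
End Triangle.

(** * Rhombi as faces of [Lambda] *)

Section Rhombus.
Variable R : realType.
Variables (delta : R) (G : geom_graph R).
Hypothesis delta0 : 0 < delta.
Hypothesis iG : isoradial delta G.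
Implicit Types (a b c x y z v : cplx R) (p q s t : R).
Let pG : plane_graph G := iG.1.
Notation bd := (bd delta G).
Notation inc := (incident delta G).
Notation dual := (dual_vert delta G).
Notation lft := (lft delta).
Variables (u w u' w' : cplx R).
Hypothesis B : bd w u' u.
Hypothesis B' : bd w' u u'.

(** In the affine coordinates [pt], the corners u, w, w', u' are (0,0), (1,0), (0,1), (1,1). The
    half t < s lies in the face of [w], the half s < t in that of [w'], and the diagonal s = t is an
    edge of [G]. *)
Let al := w - u.
Let be := w' - u.
Let pt s t : cplx R := u + rc s * al + rc t * be.
Let k := crs al be.

Lemma rh_sum : u' = w + w' - u.
Proof. by rewrite (bd_lft B) (bd_lft B') (lft_sum delta u' u); ring. Qed.

Lemma rh_crs : 0 < k.
Proof.
have [_ _ _] := B'; rewrite rh_sum /k /al /be; congr (0 < _).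
by rewrite /crs !cE; ring.
Qed.
Let k0 := rh_crs.

Let ug : gedge G u u'. Proof. by case: B'. Qed.
Let dw : dual w. Proof. exact: bd_dual B. Qed.
Let dw' : dual w'. Proof. exact: bd_dual B'. Qed.
Let iuw : inc u w. Proof. by case: B. Qed.
Let iu'w : inc u' w. Proof. by case: B. Qed.
Let iuw' : inc u w'. Proof. by case: B'. Qed.
Let iu'w' : inc u' w'. Proof. by case: B'. Qed.

Lemma rh_fc s t : 0 <= t -> s <= 1 -> t < s -> fc G w (pt s t).
Proof.
move=> t0 s1 ts; have -> : pt s t = w + rc t * (u' - w) + rc (1 - s) * (u - w).
  by rewrite rh_sum /pt /al /be; apply: cplx_eq; rewrite !cE /=; ring.
apply: (triangle_fc delta0 iG) => //; [| |lra|lra].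
  by have [] := incidentE iu'w.
by have [] := incidentE iuw.
Qed.

Lemma rh_fc' s t : 0 <= s -> t <= 1 -> s < t -> fc G w' (pt s t).
Proof.
move=> s0 t1 st; have -> : pt s t = w' + rc (1 - t) * (u - w') + rc s * (u' - w').
  by rewrite rh_sum /pt /al /be; apply: cplx_eq; rewrite !cE /=; ring.
apply: (triangle_fc delta0 iG) => //; [| |lra|lra].
  by have [] := incidentE iuw'.
by have [] := incidentE iu'w'.
Qed.

Lemma rh_diag s : pt s s = lerp u u' s.
Proof.
by rewrite rh_sum /pt /al /be /lerp; apply: cplx_eq; rewrite !cE /=; ring.
Qed.

Lemma rh_diag_drawing s : 0 <= s -> s <= 1 -> drawing G (pt s s).
Proof. by move=> s0 s1; right; exists u, u'; split => //; exists s; split => //; exact: rh_diag. Qed.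

Lemma rh_vert s t : 0 <= s -> 0 <= t -> s <= 1 -> t <= 1 -> gvert G (pt s t) ->
  s = t /\ (s = 0 \/ s = 1).
Proof.
move=> s0 t0 s1 t1 V; have [ts|st|E] := ltgtP t s.
- by case: (face_notin_drawing (fc_face dw) (rh_fc t0 s1 ts)); left.
- by case: (face_notin_drawing (fc_face dw') (rh_fc' s0 t1 st)); left.
split => //; move: V; rewrite E rh_diag => V.
have [|/eqP] := eqVneq s 0; first by left.
have [|/eqP] := eqVneq s 1; first by right.
move=> n1 n0; case: (@edge_inner_notvert _ _ pG _ _ s ug) => //.
  by rewrite lt_neqAle s0 andbT; apply/eqP => /esym.
by rewrite lt_neqAle s1 andbT; apply/eqP.
Qed.

Lemma rh_dual s t : 0 <= s -> 0 <= t -> s <= 1 -> t <= 1 -> dual (pt s t) ->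
  pt s t = w \/ pt s t = w'.
Proof.
move=> s0 t0 s1 t1 dx; have fx := fc_center dx.
have [ts|st|E] := ltgtP t s.
- by left; apply: (dual_uniq delta0 iG dx dw fx); apply: rh_fc.
- by right; apply: (dual_uniq delta0 iG dx dw' fx); apply: rh_fc'.
case: (face_notin_drawing (fc_face dx) fx); move: fx; rewrite E => _.
exact: rh_diag_drawing.
Qed.

Lemma rh_l1 s t : crs (- be) (pt s t - u) = k * s.
Proof. by rewrite /pt /k /crs /al /be !cE /=; ring. Qed.
Lemma rh_l2 s t : crs al (pt s t - u) = k * t.
Proof. by rewrite /pt /k /crs /al /be !cE /=; ring. Qed.
Lemma rh_l3 s t : crs be (pt s t - w) = k * (1 - s).
Proof. by rewrite /pt /k /crs /al /be !cE /=; ring. Qed.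
Lemma rh_l4 s t : crs (- al) (pt s t - w') = k * (1 - t).
Proof. by rewrite /pt /k /crs /al /be !cE /=; ring. Qed.

Lemma rh_coord x : x = pt (crs (- be) (x - u) / k) (crs al (x - u) / k).
Proof.
have kn : k != 0 by rewrite gt_eqF.
have ex : crs (- be) (x - u) * Re al + crs al (x - u) * Re be = k * (Re x - Re u).
  by rewrite /k /crs !cE; ring.
have ey : crs (- be) (x - u) * Im al + crs al (x - u) * Im be = k * (Im x - Im u).
  by rewrite /k /crs !cE; ring.
have Rept s t : Re (pt s t) = Re u + s * Re al + t * Re be by rewrite /pt !cE /=; ring.
have Impt s t : Im (pt s t) = Im u + s * Im al + t * Im be by rewrite /pt !cE /=; ring.
apply: cplx_eq; rewrite ?Rept ?Impt.
  by rewrite -addrA ![_ / k * _]mulrAC -mulrDl ex mulrAC divff // mul1r addrC subrK.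
by rewrite -addrA ![_ / k * _]mulrAC -mulrDl ey mulrAC divff // mul1r addrC subrK.
Qed.

Let I : set (cplx R) := [set x | exists s t, [/\ 0 < s, s < 1, 0 < t, t < 1 & x = pt s t]].
Let Cl : set (cplx R) := [set x | exists s t, [/\ 0 <= s, s <= 1, 0 <= t, t <= 1 & x = pt s t]].

Lemma rh_IE : I = [set x | 0 < crs (- be) (x - u)] `&` [set x | 0 < crs al (x - u)] `&`
  ([set x | 0 < crs be (x - w)] `&` [set x | 0 < crs (- al) (x - w')]).
Proof.
apply/seteqP; split => x.
  move=> [s [t [s0 s1 t0 t1 ->]]]; rewrite /setI /= rh_l1 rh_l2 rh_l3 rh_l4.
  by rewrite !mulr_gt0 // subr_gt0.
move: (rh_coord x); move: (crs (- be) (x - u) / k) (crs al (x - u) / k) => s t ->.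
rewrite /setI /= rh_l1 rh_l2 rh_l3 rh_l4 !pmulr_rgt0 // !subr_gt0 => -[[s0 t0] [s1 t1]].
by exists s, t.
Qed.

Lemma rh_ClE : Cl = [set x | 0 <= crs (- be) (x - u)] `&` [set x | 0 <= crs al (x - u)] `&`
  ([set x | 0 <= crs be (x - w)] `&` [set x | 0 <= crs (- al) (x - w')]).
Proof.
apply/seteqP; split => x.
  move=> [s [t [s0 s1 t0 t1 ->]]]; rewrite /setI /= rh_l1 rh_l2 rh_l3 rh_l4.
  have k1 := ltW k0; split; split; apply: mulr_ge0 => //; rewrite subr_ge0 //.
move: (rh_coord x); move: (crs (- be) (x - u) / k) (crs al (x - u) / k) => s t ->.
rewrite /setI /= rh_l1 rh_l2 rh_l3 rh_l4 !pmulr_rge0 // !subr_ge0 => -[[s0 t0] [s1 t1]].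
by exists s, t.
Qed.

Lemma rh_I_open : open I.
Proof.
by rewrite rh_IE; repeat (apply: openI); apply/open_gt0/crs_lipschitz.
Qed.

Lemma rh_Cl_closed : closed Cl.
Proof.
by rewrite rh_ClE; repeat (apply: closedI); apply/closed_ge0/crs_lipschitz.
Qed.

(** A radius from [c] to [v] through an inner point puts it in the face of [c], so off the diagonal
    [c] is [w] or [w'] and [triangle_avoid] applies; a point of the diagonal is on the drawing of
    [G], hence in no face. *)
Lemma rh_avoid x : I x -> ~ drawing (Lambda delta G) x.
Proof.
move=> [s [t [s0 s1 t0 t1 ->]]].
have NV : ~ gvert G (pt s t).
  move=> /rh_vert [| | | |E [h|h]]; try exact: ltW.
    by move: s0; rewrite h ltxx.
  by move: s1; rewrite h ltxx.
have ND : ~ dual (pt s t).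
  move=> /rh_dual [| | | |h|h]; try exact: ltW.
    have := rh_l3 s t; rewrite h subrr {1}/crs !cE /= => /eqP.
    by rewrite !mulr0 subrr eq_sym mulf_eq0 gt_eqF //= subr_eq0 gt_eqF.
  have := rh_l4 s t; rewrite h subrr {1}/crs !cE /= => /eqP.
  by rewrite !mulr0 subrr eq_sym mulf_eq0 gt_eqF //= subr_eq0 gt_eqF.
have NE v c : inc v c -> ~ segment c v (pt s t).
  move=> ivc S; have [dc Vv Cv] := incidentE ivc.
  have [r [r0 r1 E]] := S.
  have r1' : r < 1.
    rewrite lt_neqAle r1 andbT; apply/eqP => r_1; apply: NV.
    by rewrite E r_1 -/(lerp c v 1) lerp1.
  have fx : fc G c (pt s t) by rewrite E; apply: (fc_convex delta0 iG dc (fc_center dc) Cv).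
  have [ts|st|Est] := ltgtP t s.
  - have cw : c = w.
      by apply: (dual_uniq delta0 iG dc dw fx); apply: rh_fc => //; exact: ltW.
    subst c; move: S; have -> : pt s t = w + rc t * (u' - w) + rc (1 - s) * (u - w).
      by rewrite rh_sum /pt /al /be; apply: cplx_eq; rewrite !cE /=; ring.
    by apply: (triangle_avoid delta0 iG B ivc) => //; lra.
  - have cw : c = w'.
      by apply: (dual_uniq delta0 iG dc dw' fx); apply: rh_fc' => //; exact: ltW.
    subst c; move: S; have -> : pt s t = w' + rc (1 - t) * (u - w') + rc s * (u' - w').
      by rewrite rh_sum /pt /al /be; apply: cplx_eq; rewrite !cE /=; ring.
    by apply: (triangle_avoid delta0 iG B' ivc) => //; lra.
  apply: (face_notin_drawing (fc_face dc) fx); rewrite Est.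
  by apply: rh_diag_drawing; exact: ltW.
move=> [[//|//]|[v [c [[i|i] S]]]].
  exact: (NE _ _ i (segmentC S)).
exact: (NE _ _ i S).
Qed.

Lemma rh_boundary x : Cl x -> ~ drawing (Lambda delta G) x -> I x.
Proof.
move=> [s [t [s0 s1 t0 t1 E]]] N.
have D a b : inc a b -> ~ segment a b x.
  by move=> i S; apply: N; right; exists a, b; split => //; left.
exists s, t; split => //; rewrite lt_neqAle ?s0 ?s1 ?t0 ?t1 andbT; apply/eqP => h.
- apply: (D _ _ iuw'); exists t; split => //; rewrite E -h /pt /be.
  by apply: cplx_eq; rewrite !cE /=; ring.
- apply: (D _ _ iu'w); exists (1 - t); split; [lra|lra|]; rewrite E h /pt /be /al rh_sum.
  by apply: cplx_eq; rewrite !cE /=; ring.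
- apply: (D _ _ iuw); exists s; split => //; rewrite E -h /pt /al.
  by apply: cplx_eq; rewrite !cE /=; ring.
- apply: (D _ _ iu'w'); exists (1 - s); split; [lra|lra|]; rewrite E h /pt /be /al rh_sum.
  by apply: cplx_eq; rewrite !cE /=; ring.
Qed.

(** The open rhombus [I] avoids the drawing and agrees with the closed one [Cl] off the drawing, so
    it is clopen in its component. *)
Lemma rh_face : face (Lambda delta G) I.
Proof.
have h0 : 0 < (2^-1 : R) by rewrite invr_gt0.
have h1 : (2^-1 : R) < 1 by rewrite invf_lt1 ?ltr1n.
have Ic : I (pt 2^-1 2^-1) by exists 2^-1, 2^-1.
exists (pt 2^-1 2^-1); first exact: rh_avoid.
apply/seteqP; split.
  apply: connected_component_max => //; last first.
    apply: (@starshaped_connected _ _ (pt 2^-1 2^-1)) => x [s [t [s0 s1 t0 t1 ->]]] y.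
    move=> [r [r0 r1 ->]]; exists (2^-1 + r * (s - 2^-1)), (2^-1 + r * (t - 2^-1)).
    split; [nra|nra|nra|nra|].
    by rewrite /pt; apply: cplx_eq; rewrite !cE /=; ring.
  by move=> x; exact: rh_avoid.
apply: (connected_clopen _ rh_I_open rh_Cl_closed _ _ Ic); first exact: component_connected.
- apply/seteqP; split => x [Cx h]; (split; first exact: Cx).
    by case: h => s [t [s0 s1 t0 t1 ->]]; exists s, t; split => //; exact: ltW.
  by apply: (rh_boundary h); apply: (connected_component_sub Cx).
- by apply: connected_component_refl; apply: rh_avoid.
Qed.

Lemma rh_corner s t : 0 <= s -> s <= 1 -> 0 <= t -> t <= 1 -> closure I (pt s t).
Proof.
move=> s0 s1 t0 t1; apply: (@closure_line _ _ _ (pt 2^-1 2^-1)) => r r0 r1.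
exists (s + r * (2^-1 - s)), (t + r * (2^-1 - t)).
have h2 : (2^-1 : R) * 2 = 1 by rewrite mulVf // pnatr_eq0.
split; [nra|nra|nra|nra|].
by rewrite /pt; apply: cplx_eq; rewrite !cE /=; ring.
Qed.

Lemma rh_closure : closure I `<=` Cl.
Proof.
move=> x cx; suff : closure Cl x by apply: rh_Cl_closed.
apply: closure_subset cx => y [s [t [s0 s1 t0 t1 ->]]].
by exists s, t; split => //; exact: ltW.
Qed.

Lemma rh_face_vert : face_vert (Lambda delta G) I = [set u; w; u'; w'].
Proof.
have Eu : u = pt 0 0 by rewrite /pt; apply: cplx_eq; rewrite !cE /=; ring.
have Eu' : u' = pt 1 1 by rewrite rh_sum /pt /al /be; apply: cplx_eq; rewrite !cE /=; ring.
have Ew : w = pt 1 0 by rewrite /pt /al; apply: cplx_eq; rewrite !cE /=; ring.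
have Ew' : w' = pt 0 1 by rewrite /pt /be; apply: cplx_eq; rewrite !cE /=; ring.
have [Vu Vu'] := plane_vert pG ug.
apply/seteqP; split => x; rewrite /face_vert /setI /=.
  move=> [V /rh_closure [s [t [s0 s1 t0 t1 E]]]].
  case: V => [V|V]; rewrite E in V.
    have [st [s_0|s_1]] := rh_vert s0 t0 s1 t1 V; left.
      by left; left; rewrite E -st s_0 -Eu.
    by right; rewrite E -st s_1 -Eu'.
  by have [h|h] := rh_dual s0 t0 s1 t1 V; rewrite E h; [left; left; right|right].
by move=> [[[->|->]|->]|->]; split; [left|rewrite Eu|right|rewrite Ew|left|rewrite Eu'|right|rewrite Ew'] => //;
  apply: rh_corner.
Qed.

Lemma rhombusP : rhombus delta G u w u' w'.
Proof.
have [Vu Vu'] := plane_vert pG ug.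
split => //; first exact: edge_neq ug.
  move=> E; move: k0; rewrite /k /al /be E /crs; rewrite [X in 0 < X - _]mulrC subrr.
  by rewrite ltxx.
by exists I; [exact: rh_face|exact: rh_face_vert].
Qed.
End Rhombus.

(** * The two colour classes *)

Section Angle.
Variable R : realType.
Implicit Types (a b : cplx R).

(* For [eta > pi / 2] the angle condition excludes every rhombus; any positive
   value would do there. *)
Definition angle_gap (eta : R) : R := if eta <= pi / 2 then 1 - cos eta else 1.

Lemma angle_gap_bounds eta : 0 < eta -> 0 < angle_gap eta <= 1.
Proof.
move=> e0; rewrite /angle_gap; case: ifP => [h|_]; last by rewrite ltr01 lexx.
have p0 := pi_gt0 R.
have c0 : 0 <= cos eta by apply: cos_ge0_pihalf; apply/andP; split => //; lra.
have c1 : cos eta < 1.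
  rewrite -(cos0 R) ltr_cos ?in_itv /= ?lexx ?(ltW p0) //; apply/andP; split; lra.
by rewrite subr_gt0 c1 gerBl.
Qed.

Lemma angle_dot (eta delta : R) a b : 0 < eta -> 0 < delta ->
  cabs a = delta -> cabs b = delta -> eta <= angle a b <= pi - eta ->
  `|dot a b| <= (1 - angle_gap eta) * delta ^+ 2.
Proof.
move=> e0 d0 ha hb; have p0 := pi_gt0 R.
have D0 : 0 < delta * delta by rewrite mulr_gt0.
rewrite /angle (_ : complex.Re (a * b^* : cplx R) = dot a b); last first.
  by rewrite conjcE /dot !cE /=; ring.
rewrite ha hb; set x := dot a b / (delta * delta).
have Ex : dot a b = x * (delta * delta) by rewrite divfK // gt_eqF.
have x1 : -1 <= x <= 1.
  have h1 := dot_le a b; have h2 := dot_le (- a) b.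
  have E : dot (- a) b = - dot a b by rewrite /dot !cE; ring.
  move: h1 h2; rewrite E cabsN ha hb Ex => h1 h2.
  apply/andP; split.
    by rewrite -(ler_pM2r D0); lra.
  by rewrite -(ler_pM2r D0); lra.
have [/andP[a0 api] ca] := acos_def x1.
move=> /andP[h1 h2].
have eh : eta <= pi / 2 by lra.
rewrite /angle_gap eh opprB addrC subrK Ex normrM (gtr0_norm D0) -expr2 ler_pM2r ?expr2 //.
rewrite -ca ler_norml; apply/andP; split.
  have -> : - cos eta = cos (pi - eta) by rewrite cosB cospi sinpi; ring.
  rewrite leNgt ltr_cos ?in_itv /=; [|apply/andP; split; lra|apply/andP; split; lra].
  by rewrite -leNgt.
rewrite leNgt ltr_cos ?in_itv /=; [|apply/andP; split; lra|apply/andP; split; lra].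
by rewrite -leNgt.
Qed.
End Angle.

(* One colour class [V] of a rhombic tiling: [nb v] lists the opposite corners
   [o] of the rhombi at [v]; the remaining corners [lft o v] and [lft v o], to the
   right and to the left of the diagonal from [v] to [o], have the other colour. *)
Record colour_class (R : realType) (delta kap : R) (V W : set (cplx R))
    (nb : cplx R -> seq (cplx R)) : Prop := ColourClass {
  cc_uniq : forall v, V v -> uniq (nb v);
  cc_nonempty : forall v, V v -> exists o, o \in nb v;
  cc_nb : forall v o, V v -> o \in nb v ->
    [/\ V o, v \in nb o, W (lft delta o v) & W (lft delta v o)];
  cc_dist : forall v o, V v -> o \in nb v ->
    nrm2 (lft delta o v - v) = delta ^+ 2 /\ nrm2 (lft delta v o - v) = delta ^+ 2;
  cc_crs : forall v o, V v -> o \in nb v -> 0 < crs (lft delta o v - v) (lft delta v o - v);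
  cc_dot : forall v o, V v -> o \in nb v ->
    `|dot (lft delta o v - v) (lft delta v o - v)| <= (1 - kap) * delta ^+ 2;
  cc_next : forall v o, V v -> o \in nb v ->
    exists2 o', o' \in nb v & lft delta o' v = lft delta v o;
  cc_injl : forall v o o', V v -> o \in nb v -> o' \in nb v ->
    lft delta v o = lft delta v o' -> o = o';
  cc_injr : forall v o o', V v -> o \in nb v -> o' \in nb v ->
    lft delta o v = lft delta o' v -> o = o';
  cc_empty : forall v o o', V v -> o \in nb v -> o' \in nb v ->
    lft delta o' v <> lft delta o v -> lft delta o' v <> lft delta v o ->
    0 < orient (lft delta o v) (lft delta v o) (lft delta o' v);
  cc_delaunay : forall v w, V v -> W w -> delta ^+ 2 <= nrm2 (v - w);
  cc_finite : forall p (r : R), finite_set [set v | V v /\ cabs (v - p) <= r]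
}.

Section RealAux.
Variable R : realType.

Lemma lt_of_sqr_sum (d k D : R) : d ^+ 2 + k ^+ 2 = D * D -> 0 < D -> 0 < k -> d < D.
Proof. by move=> e D0 k0; rewrite ltNge; apply/negP => dD; nra. Qed.

Lemma nneg_of_sum_prod (s t : R) : 1 <= s + t -> 0 <= s * t -> 0 <= s /\ 0 <= t.
Proof. by move=> h1 h2; split; nra. Qed.

Lemma shrink (s t : R) : 0 <= s -> 0 <= t ->
  exists2 e, 0 < e & e <= 1 /\ e * s <= 1 /\ e * t <= 1.
Proof.
move=> s0 t0; have e0 : 0 < (s + t + 1)^-1 by rewrite invr_gt0; lra.
exists (s + t + 1)^-1 => //.
have ee : (s + t + 1)^-1 * (s + t + 1) = 1 by rewrite mulVf // gt_eqF //; lra.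
by move: e0 ee; set e := _^-1 => e0 ee; split; [nra|split; nra].
Qed.
End RealAux.

Section Sector.
Variable R : realType.
Implicit Types (v a b m : cplx R).

(** The coordinates come from Cramer's rule. Being on or beyond the chord means s + t >= 1, and |m -
    v|^2 = D then forces s t >= 0, the scalar product of a - v and b - v being less than [D]. *)
Lemma sector_coords v a b m (D : R) : 0 < D -> nrm2 (a - v) = D -> nrm2 (b - v) = D ->
  nrm2 (m - v) = D -> 0 < crs (a - v) (b - v) -> orient a b m <= 0 ->
  exists s t : R, [/\ 0 <= s, 0 <= t & m = v + rc s * (a - v) + rc t * (b - v)].
Proof.
move=> D0 ha hb hm k0 le0; pose k := crs (a - v) (b - v).
have kn : k != 0 by rewrite gt_eqF.
pose s := - crs (b - v) (m - v) / k; pose t := crs (a - v) (m - v) / k.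
have sk : k * s = - crs (b - v) (m - v) by rewrite mulrC divfK.
have tk : k * t = crs (a - v) (m - v) by rewrite mulrC divfK.
have Rem : Re m = Re v + s * Re (a - v) + t * Re (b - v).
  apply: (mulfI kn).
  have -> : k * (Re v + s * Re (a - v) + t * Re (b - v)) =
    k * Re v + (k * s) * Re (a - v) + (k * t) * Re (b - v) by ring.
  rewrite sk tk.
  by rewrite /k /crs !cE; ring.
have Imm : Im m = Im v + s * Im (a - v) + t * Im (b - v).
  apply: (mulfI kn).
  have -> : k * (Im v + s * Im (a - v) + t * Im (b - v)) =
    k * Im v + (k * s) * Im (a - v) + (k * t) * Im (b - v) by ring.
  rewrite sk tk.
  by rewrite /k /crs !cE; ring.
have Em : m = v + rc s * (a - v) + rc t * (b - v).
  by apply: cplx_eq; rewrite ?Rem ?Imm !cE /=; ring.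
exists s, t.
have st1 : 1 <= s + t.
  move: le0; have -> : orient a b m = (1 - s - t) * k.
    by rewrite {1}Em /orient /k /crs !cE /=; ring.
  by rewrite pmulr_lle0 //; clear Em; lra.
have dD : dot (a - v) (b - v) < D.
  apply: lt_of_sqr_sum D0 k0; rewrite -{1}ha -hb /dot /crs /nrm2; ring.
have est : (s + t) ^+ 2 * D - 2 * (s * t) * (D - dot (a - v) (b - v)) = D.
  rewrite -[RHS]hm.
  have -> : nrm2 (m - v) = s ^+ 2 * nrm2 (a - v) + t ^+ 2 * nrm2 (b - v) +
      2 * (s * t) * dot (a - v) (b - v).
    by rewrite {1}Em /nrm2 /dot !cE /=; ring.
  by rewrite ha hb; ring.
have st0 : 0 <= s * t.
  have : 0 <= 2 * (s * t) * (D - dot (a - v) (b - v)).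
    have -> : 2 * (s * t) * (D - dot (a - v) (b - v)) = ((s + t) ^+ 2 - 1) * D.
      by rewrite mulrBl mul1r -{3}est; ring.
    rewrite mulr_ge0 ?(ltW D0) // subr_ge0 -(expr1n _ 2) ler_sqr ?nnegrE //.
    exact: le_trans st1.
  by rewrite pmulr_lge0 ?subr_gt0 // pmulr_rge0.
by have [s0 t0] := nneg_of_sum_prod st1 st0.
Qed.
End Sector.

Section Classes.
Variable R : realType.
Variables (delta eta : R) (G : geom_graph R).
Hypothesis eta0 : 0 < eta.
Hypothesis delta0 : 0 < delta.
Hypothesis iG : isoradial delta G.
Hypothesis aG : rhombi_angles_in delta G eta (pi - eta).
Implicit Types (a b c o u x y z v w : cplx R).
Let pG : plane_graph G := iG.1.
Notation bd := (bd delta G).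
Notation inc := (incident delta G).
Notation dual := (dual_vert delta G).
Notation lft := (lft delta).
Let kap := angle_gap eta.

(** Centers of the adjacent faces: by [bd_refl], the center across a side is the reflection of [w]
    in its midpoint. *)
Definition dnb w : set (cplx R) := [set o | exists a b, bd w a b /\ o = a + b - w].

Lemma edges_at_finite x : finite_set [set e : cplx R * cplx R | gedge G e.1 e.2 /\ cabs (e.1 - x) <= delta].
Proof.
apply: sub_finite_set (plane_finite_edge pG (cabs x + delta)) => -[a b] /= [ab h].
split => //; exists a; first exact: segmentl.
by have := cabs_triangle a x 0; rewrite !subr0; lra.
Qed.

Lemma gnb_finite u : finite_set [set o | gedge G u o].
Proof.
apply: sub_finite_set (finite_image snd (edges_at_finite u)) => o uo.
by exists (u, o) => //; split => //=; rewrite subrr cabs0 ltW.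
Qed.

Lemma dnb_finite w : finite_set (dnb w).
Proof.
apply: sub_finite_set (finite_image (fun e => e.1 + e.2 - w) (edges_at_finite w)) => o.
move=> [a [b [B ->]]]; have [ab ia _ _] := B.
by exists (a, b) => //; split => //=; rewrite (inc_cabs delta0 ia).
Qed.

Definition seq_of (A : set (cplx R)) (fA : finite_set A) : seq (cplx R) :=
  undup (projT1 (cid ((finite_seqP A).1 fA))).

Lemma mem_seq_of A (fA : finite_set A) x : (x \in seq_of fA) <-> A x.
Proof.
rewrite /seq_of mem_undup; case: (cid _) => s /= ->; split; first by [].
by [].
Qed.

Definition gnb u := seq_of (gnb_finite u).
Definition dnb_seq w := seq_of (dnb_finite w).

Lemma mem_gnb u o : (o \in gnb u) <-> gedge G u o.
Proof. exact: mem_seq_of. Qed.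
Lemma mem_dnb w o : (o \in dnb_seq w) <-> dnb w o.
Proof. exact: mem_seq_of. Qed.

Lemma edge_bd a b : gedge G a b -> bd (lft a b) a b.
Proof. by move=> /(left_face delta0 iG) [w B]; rewrite -(bd_lft B). Qed.

Lemma gedge_bds u o : o \in gnb u -> bd (lft o u) o u /\ bd (lft u o) u o.
Proof.
move=> /mem_gnb uo; split; first exact/edge_bd/(plane_sym pG).
exact: edge_bd.
Qed.

Lemma rhombus_angle u w u' w' : bd w u' u -> bd w' u u' ->
  `|dot (w - u) (w' - u)| <= (1 - kap) * delta ^+ 2 /\
  `|dot (u - w) (u' - w)| <= (1 - kap) * delta ^+ 2.
Proof.
move=> B B'; have Rh := rhombusP delta0 iG B B'.
have [h1 h2] := aG Rh; have [_ i1 i2 _] := B; have [_ i3 i4 _] := B'.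
have c1 := inc_cabs delta0 i1; have c2 := inc_cabs delta0 i2.
have c3 := inc_cabs delta0 i3.
by split; apply: angle_dot => //; rewrite cabsC.
Qed.

(* A center strictly inside the sector of a rhombus at [u] would have its face
   meet one of the two faces adjacent to the diagonal. *)
Lemma gamma_empty u o o' : o \in gnb u -> o' \in gnb u ->
  lft o' u <> lft o u -> lft o' u <> lft u o -> 0 < orient (lft o u) (lft u o) (lft o' u).
Proof.
move=> uo uo'; have [B B'] := gedge_bds uo; have [C _] := gedge_bds uo'.
set w := lft o u; set w' := lft u o; set c := lft o' u => cw cw'.
rewrite ltNge; apply/negP => le0.
have iuc : inc u c by case: C.
have dc := bd_dual C; have dw := bd_dual B; have dw' := bd_dual B'.
have [_ _ iuw _] := B; have [_ iuw' _ _] := B'.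
have k0 := rh_crs B B'.
have hs : nrm2 (w - u) = delta ^+ 2 by rewrite nrm2C (incident_dist iuw).
have ht : nrm2 (w' - u) = delta ^+ 2 by rewrite nrm2C (incident_dist iuw').
have hc : nrm2 (c - u) = delta ^+ 2 by rewrite nrm2C (incident_dist iuc).
have D0 : 0 < delta ^+ 2 by rewrite exprn_gt0.
have [s [t [s0 t0 Ec]]] := sector_coords D0 hs ht hc k0 le0.
(* Scaling towards [u] brings a point of the sector into the rhombus. *)
have [e e0 [e1 [es1 et1]]] := shrink s0 t0.
have es0 : 0 <= e * s by rewrite mulr_ge0 // ltW.
have et0 : 0 <= e * t by rewrite mulr_ge0 // ltW.
have [_ Vu Cu] := incidentE iuc.
have fx : fc G c (u + rc (e * s) * (w - u) + rc (e * t) * (w' - u)).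
  have -> : u + rc (e * s) * (w - u) + rc (e * t) * (w' - u) = lerp c u (1 - e).
    by rewrite Ec; apply: cplx_eq; rewrite /lerp !cE /=; ring.
  by apply: (fc_convex delta0 iG dc (fc_center dc) Cu); lra.
have [ts|st|E] := ltgtP t s.
- apply: cw; apply: (dual_uniq delta0 iG dc dw fx).
  by apply: (rh_fc delta0 iG B B') => //; rewrite ltr_pM2l.
- apply: cw'; apply: (dual_uniq delta0 iG dc dw' fx).
  by apply: (rh_fc' delta0 iG B B') => //; rewrite ltr_pM2l.
- apply: (face_notin_drawing (fc_face dc) fx); rewrite E.
  exact: (rh_diag_drawing B B').
Qed.

Lemma gamma_class : colour_class delta kap (gvert G) dual gnb.
Proof.
have D0 : 0 < delta ^+ 2 by rewrite exprn_gt0.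
split.
- by move=> v _; apply: undup_uniq.
- by move=> v Vv; have [x h] := vert_edge delta0 iG Vv; exists x; apply/mem_gnb.
- move=> v o Vv vo; have [B B'] := gedge_bds vo; move: (vo) => /mem_gnb h.
  have [_ Vo] := plane_vert pG h.
  by split; [exact: Vo|exact/mem_gnb/(plane_sym pG)|exact: bd_dual B|exact: bd_dual B'].
- move=> v o Vv vo; have [[_ _ i _] [_ i' _ _]] := gedge_bds vo.
  by rewrite nrm2C (incident_dist i) nrm2C (incident_dist i').
- by move=> v o Vv vo; have [B B'] := gedge_bds vo; exact: rh_crs B B'.
- by move=> v o Vv vo; have [B B'] := gedge_bds vo; have [] := rhombus_angle B B'.
- move=> v o Vv vo; have [_ B'] := gedge_bds vo; have [_ i _ _] := B'.
  (* The next rhombus counterclockwise at [v] is that of the side arriving at [v] in the face to the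
     left of the edge from [v] to [o]. *)
  have [x B2] := bd_prev delta0 iG i.
  exists x; last by rewrite -(bd_lft B2).
  by apply/mem_gnb; have [h _ _ _] := B2; apply: (plane_sym pG).
- move=> v o o' Vv vo vo' E; have [_ B] := gedge_bds vo; have [_ B'] := gedge_bds vo'.
  by rewrite -E in B'; exact: (bd_next_uniq delta0 iG B B').
- move=> v o o' Vv vo vo' E; have [B _] := gedge_bds vo; have [B' _] := gedge_bds vo'.
  by rewrite -E in B'; exact: (bd_prev_uniq delta0 iG B B').
- by move=> v o o' _; exact: gamma_empty.
- exact: delaunay.
- move=> p r; apply: sub_finite_set (plane_finite_vert pG (r + cabs p)) => v [Vv h].
  by split => //; have := cabs_triangle v p 0; rewrite !subr0; lra.
Qed.

Lemma bd_dnb w a b : bd w a b ->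
  [/\ a + b - w \in dnb_seq w, lft w (a + b - w) = b & lft (a + b - w) w = a].
Proof.
move=> B; have B' := bd_refl delta0 iG B.
have [_ ia ib h] := B; have [_ ib' ia' _] := B'.
split; first by apply/mem_dnb; exists a, b.
  apply: esym; apply: lftE; [by rewrite nrm2C (incident_dist ib)|by rewrite nrm2C (incident_dist ib')|].
  by move: h; congr (0 < _); rewrite /crs !cE; ring.
apply: esym; apply: lftE; [by rewrite nrm2C (incident_dist ia')|by rewrite nrm2C (incident_dist ia)|].
by move: h; congr (0 < _); rewrite /crs !cE; ring.
Qed.

Lemma dnb_bds w o : o \in dnb_seq w ->
  [/\ bd w (lft o w) (lft w o), bd o (lft w o) (lft o w) & o = lft o w + lft w o - w].
Proof.
move=> /mem_dnb [a [b [B ->]]]; have [_ Eb Ea] := bd_dnb B.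
by rewrite Eb Ea; split => //; exact: bd_refl.
Qed.

Lemma dual_class : colour_class delta kap dual (gvert G) dnb_seq.
Proof.
split.
- by move=> v _; apply: undup_uniq.
- move=> w dw; have [a [b B]] := dual_bd delta0 iG dw.
  by exists (a + b - w); have [] := bd_dnb B.
- move=> w o dw wo; have [B B' E] := dnb_bds wo.
  have [_ /incidentE [_ V1 _] /incidentE [_ V2 _] _] := B.
  split; [exact: bd_dual B'| |exact: V1|exact: V2].
  by have [] := bd_dnb B'; rewrite {3}E (_ : _ + _ - _ = w) //; ring.
- move=> w o dw /dnb_bds [[_ i i' _] _ _].
  by rewrite (incident_dist i) (incident_dist i').
- by move=> w o dw /dnb_bds [[_ _ _ h] _ _].
- move=> w o dw /dnb_bds [B B' E]; have [_] := rhombus_angle B' B.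
  have -> : dot (lft o w - o) (lft w o - o) = dot (lft o w - w) (lft w o - w); last by [].
  by rewrite {2 4}E /dot !cE; ring.
- move=> w o dw /dnb_bds [[_ _ i _] _ _].
  have [b B] := bd_next delta0 iG i; have [h1 _ h2] := bd_dnb B.
  by exists (lft w o + b - w).
- move=> w o o' dw /dnb_bds [B _ E] /dnb_bds [B' _ E'] H.
  rewrite -H in B'; have H' := bd_prev_uniq delta0 iG B B'.
  by rewrite E E' H H'.
- move=> w o o' dw /dnb_bds [B _ E] /dnb_bds [B' _ E'] H.
  rewrite -H in B'; have H' := bd_next_uniq delta0 iG B B'.
  by rewrite E E' H H'.
- move=> w o o' dw /dnb_bds [B _ _] /dnb_bds [B' _ _] h1 h2.
  by have [_ i _ _] := B'; exact: (bd_empty delta0 iG B i h1 h2).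
- by move=> w v dw Vv; rewrite nrm2C; exact: (delaunay delta0 iG Vv dw).
- exact: (dual_finite delta0 iG).
Qed.
End Classes.

Section Packing.
Variable R : realType.

Lemma rcM (s t : R) : rc (s * t) = rc s * rc t.
Proof. by apply: cplx_eq; rewrite !cE /=; ring. Qed.

(* A ball of radius [r] meets at most [cells (r / h)] squares of side [h / 2], each
   of which contains at most one point of an [h]-separated set. *)
Definition cells (x : R) : nat := ((Num.truncn (4 * x)).+1 ^ 2)%N.

(** Two points in the same square are at squared distance less than h^2 / 2. *)
Lemma packing (p : cplx R) (h r : R) (s : seq (cplx R)) : 0 < h -> uniq s ->
  (forall v, v \in s -> cabs (v - p) <= r) ->
  (forall v v', v \in s -> v' \in s -> v <> v' -> h ^+ 2 <= nrm2 (v - v')) ->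
  (size s <= cells (r / h))%N.
Proof.
move=> h0 us sr sep.
pose f (y : R) := Num.truncn ((y + r) / (h / 2)).
pose cell v := (f (Re (v - p)), f (Im (v - p))).
have r0 v : v \in s -> 0 <= r by move=> /sr; apply: le_trans; exact: cabs_ge0.
have h2 : 0 < h / 2 by rewrite divr_gt0.
have fE y z : - r <= y -> - r <= z -> f y = f z -> `|y - z| < h / 2.
  move=> hy hz E.
  have ay : 0 <= (y + r) / (h / 2) by rewrite divr_ge0 ?(ltW h2) //; lra.
  have az : 0 <= (z + r) / (h / 2) by rewrite divr_ge0 ?(ltW h2) //; lra.
  have := truncn_itv ay; have := truncn_itv az; rewrite -/(f y) -/(f z) E.
  rewrite !ler_pdivlMr // !ltr_pdivrMr // -natr1 ltr_norml => /andP[? ?] /andP[? ?].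
  by apply/andP; split; lra.
have coord v : v \in s -> (`|Re (v - p)| <= r) /\ (`|Im (v - p)| <= r).
  by move=> /sr h1; split; apply: le_trans h1; rewrite ?Re_le_cabs ?Im_le_cabs.
have cinj : {in s &, injective cell}.
  move=> v v' vs vs' [E1 E2]; apply: contrapT => vv.
  have := sep v v' vs vs' vv; apply/negP; rewrite -ltNge.
  have [] := coord v vs; have [] := coord v' vs'.
  rewrite !ler_norml => /andP[? ?] /andP[? ?] /andP[? ?] /andP[? ?].
  have := fE _ _ _ _ E1; have := fE _ _ _ _ E2.
  move=> /(_ ltac:(by []) ltac:(by [])) d2 /(_ ltac:(by []) ltac:(by [])) d1.
  have e1 : Re (v - v') = Re (v - p) - Re (v' - p) by rewrite !cE; ring.
  have e2 : Im (v - v') = Im (v - p) - Im (v' - p) by rewrite !cE; ring.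
  rewrite /nrm2 e1 e2 -[X in X + _]real_normK ?num_real // -[X in _ + X]real_normK ?num_real //.
  have := normr_ge0 (Re (v - p) - Re (v' - p)); have := normr_ge0 (Im (v - p) - Im (v' - p)).
  move: d1 d2; set a := `|_|; set b := `|_| => d1 d2 b0 a0.
  have : a ^+ 2 <= (h / 2) ^+ 2 by rewrite ler_sqr ?nnegrE // ltW.
  have : b ^+ 2 <= (h / 2) ^+ 2 by rewrite ler_sqr ?nnegrE // ltW.
  by have := mulr_gt0 h0 h0; rewrite !expr2; lra.
pose M := (Num.truncn (4 * (r / h))).+1.
have fM v (y : R) : v \in s -> `|y| <= r -> (f y < M)%N.
  move=> vs; rewrite ler_norml => /andP[y1 y2].
  rewrite /M /f ltnS; apply: le_truncn; rewrite ler_pdivrMr //.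
  have -> : 4 * (r / h) * (h / 2) = 2 * r by field; rewrite gt_eqF.
  lra.
have -> : cells (r / h) = size (allpairs pair (iota 0 M) (iota 0 M)).
  by rewrite size_allpairs size_iota /cells -/M mulnn.
rewrite -(size_map cell); apply: uniq_leq_size; first by rewrite map_inj_in_uniq.
move=> c /mapP [v vs ->]; have [c1 c2] := coord v vs.
by apply/allpairsP; exists (cell v); rewrite !mem_iota /= !add0n !(fM v) //.
Qed.
End Packing.

Section RealAux2.
Variable R : realType.

Lemma crs_lower (k d D c : R) : 0 < k -> k <= 1 -> 0 < D -> `|d| <= (1 - k) * D ->
  0 < c -> c ^+ 2 = D * D - d ^+ 2 -> k * D <= c.
Proof.
move=> k0 k1 D0; rewrite ler_norml => /andP[h1 h2] c0 E.
rewrite leNgt; apply/negP => h.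
have : c * c < k * D * (k * D) by apply: ltr_pM => //; exact: ltW.
have : 0 <= ((1 - k) * D - d) * ((1 - k) * D + d) by apply: mulr_ge0; lra.
have : 0 <= 2 * k * (1 - k) * (D * D).
  by apply: mulr_ge0; [apply: mulr_ge0; [lra|lra]|apply: mulr_ge0; exact: ltW].
move: E; rewrite !expr2; lra.
Qed.
End RealAux2.

(** * Weights, moments and sectors of a colour class *)

Section ClassGeometry.
Variable R : realType.
Variables (delta kap : R) (V W : set (cplx R)) (nb : cplx R -> seq (cplx R)).
Hypothesis delta0 : 0 < delta.
Hypothesis kap01 : 0 < kap <= 1.
Hypothesis cc : colour_class delta kap V W nb.
Implicit Types (a b c m o v x y z : cplx R).
Notation lft := (lft delta).
Notation tanw := (tanw delta).
Let kap0 : 0 < kap. Proof. by case/andP: kap01. Qed.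
Let kap1 : kap <= 1. Proof. by case/andP: kap01. Qed.
Let D0 : 0 < delta ^+ 2. Proof. by rewrite exprn_gt0. Qed.

Lemma opp_corner v o : o - v = (lft o v - v) + (lft v o - v).
Proof. by rewrite addrACA [lft o v + _]addrC lft_sum; ring. Qed.

(** In complex form, tanw v o * (o - v) = - i (lft v o - lft o v): the diagonals are perpendicular
    and the weight is their ratio. *)
Lemma tanw_Re v o : tanw v o * (Re o - Re v) = Im (lft v o) - Im (lft o v).
Proof. by rewrite /lft /= (tanwC _ o v); field. Qed.
Lemma tanw_Im v o : tanw v o * (Im o - Im v) = Re (lft o v) - Re (lft v o).
Proof. by rewrite /lft /= (tanwC _ o v); field. Qed.

Lemma nrm2D a b : nrm2 (a + b) = nrm2 a + nrm2 b + 2 * dot a b.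
Proof. by rewrite /nrm2 /dot !cE; ring. Qed.

Lemma nb_nrm2 v o : V v -> o \in nb v ->
  nrm2 (o - v) = 2 * delta ^+ 2 + 2 * dot (lft o v - v) (lft v o - v).
Proof.
move=> Vv vo; have [h1 h2] := cc_dist cc Vv vo.
by rewrite {1}opp_corner nrm2D h1 h2; ring.
Qed.

Lemma tanw_crs v o : tanw v o * nrm2 (o - v) = 2 * crs (lft o v - v) (lft v o - v).
Proof. by rewrite /nrm2 /crs /lft !cE /= (tanwC _ o v); field. Qed.

Lemma tanw_sqr v o : V v -> o \in nb v ->
  (1 + tanw v o ^+ 2) * nrm2 (o - v) = 4 * delta ^+ 2.
Proof.
move=> Vv vo; have [_ <-] := cc_dist cc Vv vo.
by rewrite /nrm2 /lft !cE /=; field.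
Qed.

Lemma nb_tanw_gt0 v o : V v -> o \in nb v -> 0 < tanw v o.
Proof.
move=> Vv vo; have := cc_crs cc Vv vo; have := tanw_crs v o => E h.
have : 0 < tanw v o * nrm2 (o - v) by rewrite E mulr_gt0.
by have := nrm2_ge0 (o - v); rewrite ltNge => n0 p; rewrite ltNge; apply/negP => c0; nra.
Qed.

Lemma nb_nrm2_ge v o : V v -> o \in nb v -> 2 * kap * delta ^+ 2 <= nrm2 (o - v).
Proof.
move=> Vv vo; rewrite (nb_nrm2 Vv vo); have := cc_dot cc Vv vo.
by rewrite ler_norml => /andP[h _]; lra.
Qed.

Lemma nb_nrm2_le v o : V v -> o \in nb v -> nrm2 (o - v) <= 4 * delta ^+ 2.
Proof.
move=> Vv vo; rewrite -(tanw_sqr Vv vo) ler_peMl ?nrm2_ge0 //.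
by rewrite lerDl sqr_ge0.
Qed.

Lemma nb_cabs_le v o : V v -> o \in nb v -> cabs (o - v) <= 2 * delta.
Proof.
move=> Vv vo; rewrite cabs_le ?mulr_ge0 ?(ltW delta0) // exprMn.
by have := nb_nrm2_le Vv vo; rewrite (_ : (2 : R) ^+ 2 = 4) //; ring.
Qed.

Lemma nb_tanw_le v o : V v -> o \in nb v -> tanw v o <= 2 / kap.
Proof.
move=> Vv vo; have t0 := nb_tanw_gt0 Vv vo.
have h1 := nb_nrm2_ge Vv vo; have h2 := tanw_sqr Vv vo.
rewrite ler_pdivlMr // -ler_sqr ?nnegrE ?mulr_ge0 ?(ltW t0) ?(ltW kap0) //.
rewrite -(ler_pM2r D0) exprMn.
have h3 : tanw v o ^+ 2 * (2 * kap * delta ^+ 2) <= tanw v o ^+ 2 * nrm2 (o - v).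
  by rewrite ler_wpM2l ?sqr_ge0.
have h4 := nrm2_ge0 (o - v).
have h5 : tanw v o ^+ 2 * kap * delta ^+ 2 <= 2 * delta ^+ 2.
  by move: h2 h3; rewrite mulrDl mul1r; lra.
have h6 : tanw v o ^+ 2 * kap ^+ 2 * delta ^+ 2 <= 1 * (2 * delta ^+ 2).
  rewrite (_ : _ * _ * _ = kap * (tanw v o ^+ 2 * kap * delta ^+ 2)); last by ring.
  apply: ler_pM => //; first exact: ltW.
  apply: mulr_ge0; last exact: ltW.
  by rewrite mulr_ge0 ?sqr_ge0 // ltW.
by apply: (le_trans h6); rewrite mul1r ler_pM2r // expr2; lra.
Qed.

Lemma nb_area_ge v o : V v -> o \in nb v -> 2 * kap * delta ^+ 2 <= tanw v o * nrm2 (o - v).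
Proof.
move=> Vv vo; have [ha hb] := cc_dist cc Vv vo; have k0 := cc_crs cc Vv vo.
rewrite tanw_crs -mulrA ler_pM2l //.
apply: (crs_lower kap0 kap1 D0 (cc_dot cc Vv vo) k0).
by rewrite -{1}ha -hb /dot /crs /nrm2; ring.
Qed.

(** Around [v], each corner is the left one of one rhombus and the right one of the next. *)
Lemma lft_perm v : V v -> perm_eq [seq lft v o | o <- nb v] [seq lft o v | o <- nb v].
Proof.
move=> Vv; have un := cc_uniq cc Vv.
have ul : uniq [seq lft v o | o <- nb v].
  by rewrite map_inj_in_uniq // => o o' vo vo'; apply: (cc_injl cc Vv vo vo').
have ur : uniq [seq lft o v | o <- nb v].
  by rewrite map_inj_in_uniq // => o o' vo vo'; apply: (cc_injr cc Vv vo vo').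
have sub : {subset [seq lft v o | o <- nb v] <= [seq lft o v | o <- nb v]}.
  move=> x /mapP [ o vo ->]; have [ o' vo' <-] := cc_next cc Vv vo.
  by apply/mapP; exists o'.
apply: uniq_perm => //; apply: (uniq_min_size ul sub _).2.
by rewrite !size_map.
Qed.

Lemma telescope_nb (T : nmodType) v (g : cplx R -> T) : V v ->
  \sum_(o <- nb v) g (lft v o) = \sum_(o <- nb v) g (lft o v).
Proof.
move=> Vv; transitivity (\sum_(a <- [seq lft v o | o <- nb v]) g a); first by rewrite big_map.
by rewrite (perm_big _ (lft_perm Vv)) /= big_map.
Qed.

Lemma telescope0 v (g : cplx R -> R) : V v ->
  \sum_(o <- nb v) (g (lft v o) - g (lft o v)) = 0.
Proof. by move=> Vv; rewrite sumrB telescope_nb // subrr. Qed.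

Lemma moment_Re v : V v -> \sum_(o <- nb v) tanw v o * Re (o - v) = 0.
Proof.
move=> Vv; rewrite -[RHS](telescope0 (fun z => Im z) Vv).
by apply: eq_bigr => o _; rewrite !cE tanw_Re.
Qed.

Lemma moment_Im v : V v -> \sum_(o <- nb v) tanw v o * Im (o - v) = 0.
Proof.
move=> Vv; rewrite -[RHS](telescope0 (fun z => - Re z) Vv).
by apply: eq_bigr => o _; rewrite !cE tanw_Im; ring.
Qed.

(** With l and r the left and right corners relative to [v], o - v = l + r and tanw v o * (o - v) =
    - i (l - r), so tanw v o * (o - v)^2 = - i (l^2 - r^2) telescopes. This identity and
    [moment_Re2Im2] are its two components, up to a factor. *)
Lemma moment_ReIm v : V v -> \sum_(o <- nb v) tanw v o * (Re (o - v) * Im (o - v)) = 0.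
Proof.
move=> Vv; rewrite -[RHS](telescope0 (fun z => (Im (z - v) ^+ 2 - Re (z - v) ^+ 2) / 2) Vv).
apply: eq_bigr => o _.
have -> : tanw v o * (Re (o - v) * Im (o - v)) =
    ((tanw v o * (Re o - Re v)) * Im (o - v) + (tanw v o * (Im o - Im v)) * Re (o - v)) / 2.
  by rewrite !cE; field.
by rewrite tanw_Re tanw_Im opp_corner !(cReD, cImD, cReN, cImN); field.
Qed.

Lemma moment_Re2Im2 v : V v ->
  \sum_(o <- nb v) tanw v o * (Re (o - v) ^+ 2 - Im (o - v) ^+ 2) = 0.
Proof.
move=> Vv; rewrite -[RHS](telescope0 (fun z => 2 * (Im (z - v) * Re (z - v))) Vv).
apply: eq_bigr => o _.
have -> : tanw v o * (Re (o - v) ^+ 2 - Im (o - v) ^+ 2) =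
    (tanw v o * (Re o - Re v)) * Re (o - v) - (tanw v o * (Im o - Im v)) * Im (o - v).
  by rewrite !cE; ring.
rewrite tanw_Re tanw_Im opp_corner !(cReD, cImD, cReN, cImN); ring.
Qed.

(** Project [x] radially to the circle of radius [delta] about [v], which carries the corners in
    cyclic order: the image is a corner or, by [cyclic_cover], is cut off by the chord of some
    rhombus. *)
Lemma sector_cover v x : V v -> x <> v -> exists2 o, o \in nb v &
  exists s t : R, [/\ 0 <= s, 0 <= t & x = v + rc s * (lft o v - v) + rc t * (lft v o - v)].
Proof.
move=> Vv xv.
have L0 : 0 < cabs (x - v).
  by rewrite lt_neqAle cabs_ge0 andbT; apply/eqP => /esym/cabs_eq0/subr0_eq.
pose l := cabs (x - v) / delta.
have l0 : 0 < l by rewrite divr_gt0.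
pose m : cplx R := v + rc l^-1 * (x - v).
have hm : nrm2 (m - v) = delta ^+ 2.
  rewrite -cabs_sq; have -> : m - v = rc l^-1 * (x - v) by rewrite /m; ring.
  rewrite cabs_rc ger0_norm ?invr_ge0 ?(ltW l0) // /l; congr (_ ^+ 2).
  by field; rewrite !gt_eqF.
have Ex : x = v + rc l * (m - v).
  have ll : l * l^-1 = 1 by rewrite mulfV // gt_eqF.
  apply: cplx_eq; rewrite /m !cE /=.
    have -> : Re v + (l * (Re v + (l^-1 * (Re x - Re v) - 0 * (Im x - Im v)) - Re v) -
      0 * (Im v + (l^-1 * (Im x - Im v) + 0 * (Re x - Re v)) - Im v)) =
      Re v + l * l^-1 * (Re x - Re v) by ring.
    by rewrite ll; ring.
  have -> : Im v + (l * (Im v + (l^-1 * (Im x - Im v) + 0 * (Re x - Re v)) - Im v) +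
      0 * (Re v + (l^-1 * (Re x - Re v) - 0 * (Im x - Im v)) - Re v)) =
      Im v + l * l^-1 * (Im x - Im v) by ring.
  by rewrite ll; ring.
suff [ o vo [s [t [s0 t0 Em]]]] : exists2 o, o \in nb v & exists s t : R,
    [/\ 0 <= s, 0 <= t & m = v + rc s * (lft o v - v) + rc t * (lft v o - v)].
  exists o => //; exists (l * s), (l * t); split; [exact: mulr_ge0 (ltW l0) s0|exact: mulr_ge0 (ltW l0) t0|].
  by rewrite (rcM l s) (rcM l t) Ex Em; ring.
pose N : set (cplx R) := [set a | exists2 o, o \in nb v & a = lft o v].
pose E a b := exists2 o, o \in nb v & a = lft o v /\ b = lft v o.
have [[ o vo Em]|Nm] := pselect (N m).
  exists o => //; exists 1, 0; split => //.
  by rewrite Em (_ : rc 1 = 1) // (_ : rc 0 = 0) // mul1r mul0r addr0 addrC subrK.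
have Nfin : finite_set N.
  apply: sub_finite_set (finite_image (fun o => lft o v) (finite_seq (nb v))) => a [ o vo ->].
  by exists o.
have [c [d [[ o vo [-> ->]] lt]]] : exists c d, E c d /\ orient c d m < 0.
  apply: (@cyclic_cover R v (delta ^+ 2) N E D0 Nfin) => //.
  - by move=> a [ o vo ->]; have [] := cc_dist cc Vv vo.
  - move=> a b [ o vo [-> ->]]; split; first by exists o.
    by have [ o' vo' <-] := cc_next cc Vv vo; exists o'.
  - by move=> a b [ o vo [-> ->]]; exact: (cc_crs cc Vv vo).
  - by have [ o vo] := cc_nonempty cc Vv; exists (lft o v), o.
  - by move=> a [ o vo ->]; exists (lft v o), o.
exists o => //; have [ha hb] := cc_dist cc Vv vo.
exact: (sector_coords D0 ha hb hm (cc_crs cc Vv vo) (ltW lt)).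
Qed.
End ClassGeometry.

(** * Separation, greedy paths and areas *)

Section ClassMetric.
Variable R : realType.
Variables (delta kap : R) (V W : set (cplx R)) (nb : cplx R -> seq (cplx R)).
Hypothesis delta0 : 0 < delta.
Hypothesis kap01 : 0 < kap <= 1.
Hypothesis cc : colour_class delta kap V W nb.
Implicit Types (a b c m o v x y z : cplx R).
Notation lft := (lft delta).
Notation tanw := (tanw delta).
Let kap0 : 0 < kap. Proof. by case/andP: kap01. Qed.
Let kap1 : kap <= 1. Proof. by case/andP: kap01. Qed.
Let D0 : 0 < delta ^+ 2. Proof. by rewrite exprn_gt0. Qed.

Lemma nrm2B a b : nrm2 (a - b) = nrm2 a + nrm2 b - 2 * dot a b.
Proof. by rewrite /nrm2 /dot !cE; ring. Qed.

Lemma delaunay_dot v x a : V x -> W a -> nrm2 (a - v) = delta ^+ 2 ->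
  2 * dot (x - v) (a - v) <= nrm2 (x - v).
Proof.
move=> Vx Wa h; have := cc_delaunay cc Vx Wa.
have -> : x - a = (x - v) - (a - v) by ring.
by rewrite nrm2B h; lra.
Qed.

(** Here x - v = s A + t B with A and B sides of a rhombus at [v], of squared length [D] and scalar
    product [d], and Y = |x - v|^2. The last two hypotheses keep [x] out of the open discs about the
    corners; weighted by [s] and [t] they add up to 2 Y <= (s + t) Y, hence s + t >= 2. *)
Lemma sector_far (k D d s t Y : R) : 0 < k -> k <= 1 -> 0 < D -> `|d| <= (1 - k) * D ->
  0 < Y -> 0 <= s -> 0 <= t -> Y = s * (s * D + t * d) + t * (s * d + t * D) ->
  2 * (s * D + t * d) <= Y -> 2 * (s * d + t * D) <= Y ->
  2 * (D + d) * (1 - (s + t)) < 0 /\ k * D <= Y.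
Proof.
move=> k0 k1 D_0; rewrite ler_norml => /andP[d1 d2] Y0 s0 t0 E h1 h2.
have kD : 0 < k * D by rewrite mulr_gt0.
have st2 : 2 <= s + t.
  rewrite -subr_ge0 -(pmulr_rge0 _ Y0).
  have := ler_wpM2l s0 h1; have := ler_wpM2l t0 h2; lra.
have kD' : 0 <= (1 - k) * D by rewrite mulr_ge0 ?subr_ge0 // ltW.
split; first by rewrite pmulr_rlt0; lra.
have [ts|st] := leP t s.
  have h := ler_wpM2r kD' ts.
  have h3 : t * - ((1 - k) * D) <= t * d by rewrite ler_wpM2l // lerNl; lra.
  have h4 : k * D <= s * (k * D) by rewrite ler_peMl ?(ltW kD) //; lra.
  lra.
have h := ler_wpM2r kD' (ltW st).
have h3 : s * - ((1 - k) * D) <= s * d by rewrite ler_wpM2l // lerNl; lra.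
have h4 : k * D <= t * (k * D) by rewrite ler_peMl ?(ltW kD) //; lra.
lra.
Qed.

Lemma dot_comb y v a b (s t : R) :
  dot y (v + rc s * a + rc t * b - v) = s * dot y a + t * dot y b.
Proof. by rewrite /dot !cE /=; ring. Qed.

Lemma dotC a b : dot a b = dot b a.
Proof. by rewrite /dot; ring. Qed.

Lemma dot_nrm2 a : dot a a = nrm2 a.
Proof. by rewrite /dot /nrm2; ring. Qed.

(** For the rhombus at [v] whose sector contains [x], one computation gives both the closer
    neighbour used by [greedy] and the separation of the class. *)
Lemma sector_far_from v x : V v -> V x -> x <> v -> exists2 o, o \in nb v &
  nrm2 (o - x) < nrm2 (v - x) /\ kap * delta ^+ 2 <= nrm2 (x - v).
Proof.
move=> Vv Vx xv; have [ o vo [s [t [s0 t0 Ex]]]] := sector_cover delta0 cc Vv xv.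
exists o => //; have [ha hb] := cc_dist cc Vv vo.
have [_ _ Wa Wb] := cc_nb cc Vv vo.
have Y0 : 0 < nrm2 (x - v) by apply/nrm2_gt0 => /subr0_eq.
have h1 := delaunay_dot Vx Wa ha; have h2 := delaunay_dot Vx Wb hb.
have hd := cc_dot cc Vv vo.
have pa : dot (x - v) (lft o v - v) =
    s * delta ^+ 2 + t * dot (lft o v - v) (lft v o - v).
  by rewrite dotC Ex dot_comb dot_nrm2 ha.
have pb : dot (x - v) (lft v o - v) =
    s * dot (lft o v - v) (lft v o - v) + t * delta ^+ 2.
  by rewrite dotC Ex dot_comb dot_nrm2 hb dotC.
have EY : nrm2 (x - v) = s * (s * delta ^+ 2 + t * dot (lft o v - v) (lft v o - v)) +
    t * (s * dot (lft o v - v) (lft v o - v) + t * delta ^+ 2).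
  by rewrite -pa -pb -dot_nrm2 [X in dot _ (X - v)]Ex dot_comb.
rewrite pa in h1; rewrite pb in h2.
have [lt0 far] := sector_far kap0 kap1 D0 hd Y0 s0 t0 EY h1 h2.
split => //.
have -> : o - x = (o - v) - (x - v) by ring.
rewrite nrm2B (nb_nrm2 cc Vv vo) [nrm2 (v - x)]nrm2C (opp_corner delta v o).
have -> : dot (lft o v - v + (lft v o - v)) (x - v) =
   dot (x - v) (lft o v - v) + dot (x - v) (lft v o - v).
  by rewrite /dot !cE; ring.
rewrite pa pb; lra.
Qed.

Lemma greedy v x : V v -> V x -> x <> v -> exists2 o, o \in nb v & nrm2 (o - x) < nrm2 (v - x).
Proof. by move=> Vv Vx xv; have [ o vo []] := sector_far_from Vv Vx xv; exists o. Qed.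

Lemma separation v x : V v -> V x -> x <> v -> (kap * delta) ^+ 2 <= nrm2 (x - v).
Proof.
move=> Vv Vx xv; have [_ _ [_ h]] := sector_far_from Vv Vx xv; apply: le_trans h.
by rewrite exprMn ler_pM2r // expr2 ler_piMl // ltW.
Qed.

Lemma class_card p (r : R) (s : seq (cplx R)) : uniq s ->
  (forall v, v \in s -> V v /\ cabs (v - p) <= r) -> (size s <= cells (r / (kap * delta)))%N.
Proof.
move=> us H; apply: (packing (p := p)) => //; first exact: mulr_gt0.
  by move=> v /H [].
move=> v v' /H [Vv _] /H [Vv' _] vv; rewrite nrm2C; apply: separation => //.
exact: nesym.
Qed.

Lemma class_ball p (r : R) : exists s : seq (cplx R), [/\ uniq s,
  forall v, (v \in s) <-> (V v /\ cabs (v - p) <= r) &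
  (size s <= cells (r / (kap * delta)))%N].
Proof.
pose s := seq_of (cc_finite cc p r).
have sP v : (v \in s) <-> (V v /\ cabs (v - p) <= r) by exact: mem_seq_of.
exists s; have us : uniq s by exact: undup_uniq.
split; [exact: us|exact: sP|].
by apply: (class_card us) => v /sP H; exact: H.
Qed.

Lemma class_degree v : V v -> (size (nb v) <= cells (2 / kap))%N.
Proof.
move=> Vv; have -> : 2 / kap = 2 * delta / (kap * delta) by field; rewrite !gt_eqF.
apply: (@class_card v); first exact: (cc_uniq cc Vv).
move=> o vo; have [Vo _ _ _] := cc_nb cc Vv vo.
by split => //; apply: (nb_cabs_le delta0 cc Vv vo).
Qed.

(* Moving greedily towards [x] reaches [x] within the number of vertices of the ball. *)
Lemma greedy_chain x (r C : R) (h : cplx R -> R) : V x -> 1 <= C -> 0 <= h x ->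
  (forall v o, V v -> o \in nb v -> cabs (v - x) < r -> cabs (o - x) < r -> h v <= C * h o) ->
  forall v, V v -> cabs (v - x) < r -> h v <= C ^+ cells (r / (kap * delta)) * h x.
Proof.
move=> Vx C1 hx step v Vv vr.
have [s [us sP ss]] := class_ball x r.
have C0 : 0 <= C by apply: le_trans C1.
pose rk v := count (fun v' => nrm2 (v' - x) < nrm2 (v - x)) s.
have main n : forall v, V v -> cabs (v - x) < r -> (rk v <= n)%N -> h v <= C ^+ n * h x.
  elim: n => [|n IH] y Vy yr rky.
    have [->|/eqP xy] := eqVneq y x; first by rewrite expr0 mul1r.
    move: rky; rewrite leqn0 /rk => /eqP E.
    have : has (fun v' => nrm2 (v' - x) < nrm2 (y - x)) s.
      apply/hasP; exists x.
        by apply/sP; split => //; rewrite subrr cabs0; apply: ltW; apply: le_lt_trans yr; apply: cabs_ge0.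
      by rewrite subrr; have -> : nrm2 (0 : cplx R) = 0 by [rewrite /nrm2 /= expr0n addr0];
        apply/nrm2_gt0 => /subr0_eq.
    by rewrite has_count E.
  have [->|/eqP xy] := eqVneq y x; first by rewrite ler_peMl // exprn_ege1.
  have [ o yo lt] := greedy Vy Vx (nesym xy); have [Vo _ _ _] := cc_nb cc Vy yo.
  have or : cabs (o - x) < r by apply: lt_trans yr; rewrite !cabsE ltr_sqrt ?(le_lt_trans (nrm2_ge0 (o - x)) lt).
  apply: (le_trans (step y o Vy yo yr or)); rewrite exprS -mulrA ler_wpM2l //.
  apply: IH => //; rewrite -ltnS; apply: leq_trans rky.
  apply: (@count_lt _ _ _ _ o) => //; last by move=> z /lt_trans; apply.
    by apply/sP; split => //; apply: ltW.
  by rewrite ltxx.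
apply: (main _ v Vv vr); apply: leq_trans ss; exact: count_size.
Qed.

(** Twice the total area of the rhombi at [v], and also the Laplacian of |z - p|^2 at [v]
    ([sum_dq]): the mass of [v] in the averages below. *)
Definition area v := \sum_(o <- nb v) tanw v o * nrm2 (o - v).

Lemma area_ge v : V v -> 2 * kap * delta ^+ 2 <= area v.
Proof.
move=> Vv; have [ o vo] := cc_nonempty cc Vv.
rewrite /area (big_rem o) //=; apply: (le_trans (nb_area_ge delta0 kap01 cc Vv vo)).
rewrite lerDl big_seq sumr_ge0 // => y /mem_rem vy.
by rewrite mulr_ge0 ?nrm2_ge0 // ltW // (nb_tanw_gt0 cc Vv vy).
Qed.

Lemma area_le v : V v -> area v <= (cells (2 / kap))%:R * (8 / kap * delta ^+ 2).
Proof.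
move=> Vv; apply: (@le_trans _ _ (\sum_(o <- nb v) (8 / kap * delta ^+ 2))).
  rewrite /area big_seq [X in _ <= X]big_seq ler_sum // => o vo.
  have -> : 8 / kap * delta ^+ 2 = 2 / kap * (4 * delta ^+ 2) by field; rewrite gt_eqF.
  apply: ler_pM; rewrite ?nrm2_ge0 ?(nb_nrm2_le cc Vv vo) ?(nb_tanw_le delta0 kap01 cc Vv vo) //.
  exact: ltW (nb_tanw_gt0 cc Vv vo).
rewrite big_const_seq count_predT iter_addr_0 -[X in X <= _]mulr_natl ler_wpM2r //.
  by rewrite mulr_ge0 ?divr_ge0 ?(ltW kap0) ?(ltW D0).
by rewrite ler_nat class_degree.
Qed.
End ClassMetric.

(** * Discrete Laplacian and barriers *)

Section ScalarTaylor.
Variable R : realType.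
Implicit Types (x c t : R).

(** For c = 1 or -1 the cubic term makes the Taylor remainder of the logarithm monotone on
    [-1/2, 1/2], whence its sign on each side of 0. *)
Let g c : R -> R := (fun x => ln (1 + x) - x + x ^+ 2 / 2 + c * x ^+ 3).

Lemma is_derive_ln_taylor c x : -1 < x ->
  is_derive x 1 (g c) ((1 + x)^-1 - 1 + x + 3 * c * x ^+ 2).
Proof.
move=> x1; have x0 : 0 < 1 + x by lra.
have h1 : is_derive x (1 : R) (fun y : R => 1 + y) 1.
  by apply: is_derive_eq; rewrite add0r mulr1.
have h2 : is_derive x (1 : R) (fun y : R => ln (1 + y)) (1 + x)^-1.
  have h := is_derive1_ln x0.
  by have := @is_derive1_comp R (@ln R) (fun y => 1 + y) x _ _ h h1; rewrite mulr1.
rewrite /g; apply: is_derive_eq.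
by rewrite /GRing.scale /=; field; rewrite gt_eqF.
Qed.

(** The margin 1/8 opens the interval while keeping x > -5/8, where the factors 1 + x, 2 + 3 x and 4
    + 3 x of the derivatives are positive. *)
Lemma ln_taylor_mono (f : R -> R) (df : R -> R) :
  (forall x, -(2^-1) - 8^-1 < x -> is_derive x 1 f (df x)) ->
  (forall x, -(2^-1) - 8^-1 < x -> 0 <= df x) ->
  forall x y, -(2^-1) <= x -> x <= y -> y <= 2^-1 -> f x <= f y.
Proof.
move=> H df0 x y x0 xy y0.
have lt8 : 0 < (8^-1 : R) by rewrite invr_gt0.
have lt2 : 0 < (2^-1 : R) by rewrite invr_gt0.
have dv (z : R) : z \in `](-(2^-1) - 8^-1), 1[%R -> is_derive z 1 f (df z).
  by rewrite in_itv /= => /andP[z0 _]; apply: H.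
apply: (@ger0_derive1_le_oo _ f (-(2^-1) - 8^-1) 1).
- by move=> z /dv hz; apply: ex_derive.
- move=> z zI; have hz := dv z zI; rewrite derive1E derive_val.
  by apply: df0; move: zI; rewrite in_itv /= => /andP[].
- move=> z; rewrite inE => zI; have hz := dv z zI.
  by apply: differentiable_continuous; apply/derivable1_diffP; apply: ex_derive.
- by rewrite in_itv /=; apply/andP; split; lra.
- by rewrite in_itv /=; apply/andP; split; lra.
- exact: xy.
Qed.

Lemma ln_taylor x : `|x| <= 2^-1 -> `|ln (1 + x) - x + x ^+ 2 / 2| <= `|x| ^+ 3.
Proof.
move=> hx; have := hx; rewrite ler_norml => /andP[x1 x2].
have h8 : (8^-1 : R) * 8 = 1 by rewrite mulVf // pnatr_eq0.
have h2 : (2^-1 : R) * 2 = 1 by rewrite mulVf // pnatr_eq0.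
have gt_half (y : R) : -(2^-1) - 8^-1 < y -> 0 < 3 + 4 * y -1 + 1 /\ 0 < 1 + y /\ 0 < 2 + 3 * y.
  by move=> h; split; [lra|split; lra].
have g0 c : g c 0 = 0 by rewrite /g addr0 ln1 !expr0n /= mulr0 mul0r; ring.
have up (y z : R) : -(2^-1) <= y -> y <= z -> z <= 2^-1 -> g 1 y <= g 1 z.
  apply: (ln_taylor_mono (df := fun w => (1 + w)^-1 - 1 + w + 3 * 1 * w ^+ 2)).
    by move=> w /gt_half [_ [w0 _]]; apply: is_derive_ln_taylor; lra.
  move=> w /gt_half [w4 [w0 _]].
  have -> : (1 + w)^-1 - 1 + w + 3 * 1 * w ^+ 2 = w ^+ 2 * (4 + 3 * w) / (1 + w).
    by field; rewrite gt_eqF.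
  by rewrite divr_ge0 ?(ltW w0) // mulr_ge0 ?sqr_ge0 //; lra.
have dn (y z : R) : -(2^-1) <= y -> y <= z -> z <= 2^-1 -> (- g (-1)) y <= (- g (-1)) z.
  apply: (ln_taylor_mono (df := fun w => - ((1 + w)^-1 - 1 + w + 3 * (-1) * w ^+ 2))).
    move=> w /gt_half [_ [w0 _]].
    by apply: is_deriveN; apply: is_derive_ln_taylor; lra.
  move=> w /gt_half [w4 [w0 w3]].
  have -> : - ((1 + w)^-1 - 1 + w + 3 * (-1) * w ^+ 2) = w ^+ 2 * (2 + 3 * w) / (1 + w).
    by field; rewrite gt_eqF.
  by rewrite divr_ge0 ?(ltW w0) // mulr_ge0 ?sqr_ge0 // ltW.
have dn' (y z : R) : -(2^-1) <= y -> y <= z -> z <= 2^-1 -> g (-1) z <= g (-1) y.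
  by move=> h3 h4 h5; have := dn y z h3 h4 h5; rewrite /GRing.opp /= lerN2.
have Eup : ln (1 + x) - x + x ^+ 2 / 2 = g 1 x - x ^+ 3 by rewrite /g; ring.
have Edn : ln (1 + x) - x + x ^+ 2 / 2 = g (-1) x + x ^+ 3 by rewrite /g; ring.
have half0 : 0 <= (2^-1 : R) by rewrite invr_ge0.
rewrite ler_norml; have [x0|x0] := leP 0 x.
  rewrite ger0_norm //; apply/andP; split.
    by rewrite Eup lerBDr addNr -(g0 1); apply: up => //; lra.
  by rewrite Edn gerDr -(g0 (-1)); apply: dn' => //; lra.
rewrite ltr0_norm // exprNn (_ : (-1) ^+ 3 = -1 :> R); last by ring.
rewrite mulN1r opprK; apply/andP; split.
  by rewrite Edn lerDr -(g0 (-1)); apply: dn' => //; lra.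
by rewrite Eup gerDr -(g0 1); apply: up => //; lra.
Qed.

(** Both barrier estimates use the inverse root from below. Squaring reduces the bound to P^2 (1 +
    x) <= 1, and 1 - P^2 (1 + x) has |x|^3 as a factor. *)
Lemma sqrtV_taylor x : `|x| <= 2^-1 ->
  1 - x / 2 + 3 / 8 * x ^+ 2 - `|x| ^+ 3 <= (Num.sqrt (1 + x))^-1.
Proof.
move=> hx; have := hx; rewrite ler_norml => /andP[x1 x2].
have h2 : (2^-1 : R) * 2 = 1 by rewrite mulVf // pnatr_eq0.
have x0 : 0 < 1 + x by lra.
set P := 1 - _ + _ - _.
have [P0|P0] := leP P 0; first by apply: (le_trans P0); rewrite invr_ge0 sqrtr_ge0.
have s0 : 0 < Num.sqrt (1 + x) by rewrite sqrtr_gt0.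
rewrite -[P]mulr1 -(ler_pM2r s0) mulVf ?gt_eqF // mulr1.
rewrite -ler_sqr ?nnegrE ?mulr_ge0 ?(ltW P0) ?(ltW s0) // expr1n exprMn sqr_sqrtr ?(ltW x0) //.
have [xp|xn] := leP 0 x.
  rewrite /P ger0_norm // -subr_ge0.
  have -> : 1 - (1 - x / 2 + 3 / 8 * x ^+ 2 - x ^+ 3) ^+ 2 * (1 + x) =
    x ^+ 3 * (2 * (1 + x) * (1 - x / 2 + 3 / 8 * x ^+ 2) - 5 / 8 + 15 / 64 * x
      - 9 / 64 * x ^+ 2 - x ^+ 3 * (1 + x)) by field.
  apply: mulr_ge0; first exact: exprn_ge0.
  have x2' : x ^+ 2 <= 1 / 4 by rewrite expr2; nra.
  have xx0 : 0 <= x ^+ 2 by rewrite sqr_ge0.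
  rewrite (_ : x ^+ 3 = x * x ^+ 2); last by ring.
  by move: x2' xx0; set y := x ^+ 2 => y1 y0; nra.
rewrite /P ltr0_norm // exprNn (_ : (-1) ^+ 3 = -1 :> R); last by ring.
rewrite mulN1r opprK -subr_ge0.
pose s := - x; have sE : x = - s by rewrite /s opprK.
have s00 : 0 < s by rewrite /s oppr_gt0.
have s1 : s <= 2^-1 by rewrite /s lerNl.
rewrite sE.
have -> : 1 - (1 - - s / 2 + 3 / 8 * (- s) ^+ 2 + (- s) ^+ 3) ^+ 2 * (1 + - s) =
  s ^+ 3 * (5 / 8 + 15 / 64 * s + 9 / 64 * s ^+ 2 +
    (1 - s) * (2 * (1 + s / 2 + 3 / 8 * s ^+ 2) - s ^+ 3)) by field.
apply: mulr_ge0; first by rewrite exprn_ge0 // ltW.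
have s2 : s ^+ 2 <= 1 / 4 by rewrite expr2; nra.
have ss0 : 0 <= s ^+ 2 by rewrite sqr_ge0.
rewrite (_ : s ^+ 3 = s * s ^+ 2); last by ring.
move: s2 ss0; set y := s ^+ 2 => y1 y0.
have : 0 <= (1 - s) * (2 * (1 + s / 2 + 3 / 8 * y) - s * y).
  by apply: mulr_ge0; [lra|nra].
by move=> h; nra.
Qed.

Lemma ln_le_sub1 t : 0 < t -> ln t <= t - 1.
Proof. by move=> t0; have := @le_ln1Dx R (t - 1); rewrite (_ : 1 + (t - 1) = t); [apply; lra|ring]. Qed.

Lemma ln_ge_1subV t : 0 < t -> 1 - t^-1 <= ln t.
Proof.
move=> t0; have := @ln_le_sub1 t^-1; rewrite invr_gt0 => /(_ t0).
by rewrite lnV ?posrE //; lra.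
Qed.
End ScalarTaylor.

(** * Summation by parts and the Laplacian of radial functions *)

Section Laplacian.
Variable R : realType.
Variables (delta kap : R) (V W : set (cplx R)) (nb : cplx R -> seq (cplx R)).
Hypothesis delta0 : 0 < delta.
Hypothesis kap01 : 0 < kap <= 1.
Hypothesis cc : colour_class delta kap V W nb.
Implicit Types (b c m o v y z : cplx R) (h psi F : cplx R -> R).
Notation tanw := (tanw delta).
Notation area := (area delta nb).

Definition Lap h v := \sum_(o <- nb v) tanw v o * (h o - h v).

Lemma sum_nb (s : seq (cplx R)) v (F : cplx R -> R) : uniq s -> V v ->
  (forall o, o \in nb v -> o \notin s -> F o = 0) ->
  \sum_(o <- nb v) F o = \sum_(o <- s | o \in nb v) F o.
Proof.
move=> us Vv H; rewrite (bigID (fun o => o \in s)) /= [X in _ + X]big1_seq ?addr0.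
  transitivity (\sum_(o <- [seq o <- nb v | o \in s]) F o); first by rewrite big_filter.
  transitivity (\sum_(o <- [seq o <- s | o \in nb v]) F o); last by rewrite big_filter.
  apply: perm_big; apply: uniq_perm; rewrite ?filter_uniq //; first exact: (cc_uniq cc Vv).
  by move=> y; rewrite !mem_filter andbC.
by move=> o /andP[os vo]; apply: H.
Qed.

(** The weights are symmetric, and [s] contains the support of [psi] and its neighbours, so no
    boundary term appears. *)
Lemma green (s : seq (cplx R)) h psi : uniq s -> (forall v, v \in s -> V v) ->
  (forall v, V v -> psi v <> 0 -> v \in s /\ (forall o, o \in nb v -> o \in s)) ->
  \sum_(v <- s) psi v * Lap h v = \sum_(v <- s) h v * Lap psi v.
Proof.
move=> us sV supp.
pose T v o := if o \in nb v then tanw v o else 0.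
have TC v o : v \in s -> o \in s -> T v o = T o v.
  move=> /sV Vv /sV Vo; rewrite /T tanwC.
  case: ifP => vo; first by have [_ -> _ _] := cc_nb cc Vv vo.
  by case: ifP => ov //; have [_ vo' _ _] := cc_nb cc Vo ov; rewrite vo' in vo.
have e1 : \sum_(v <- s) psi v * Lap h v =
    \sum_(v <- s) \sum_(o <- s) (T v o * (psi v * h o) - T v o * (psi v * h v)).
  rewrite big_seq [RHS]big_seq; apply: eq_bigr => v vs; have Vv := sV v vs.
  transitivity (\sum_(o <- s | o \in nb v) psi v * (tanw v o * (h o - h v))).
    rewrite -sum_nb // /Lap ?mulr_sumr //.
    move=> o vo os; have [->|/eqP n0] := eqVneq (psi v) 0; first by rewrite mul0r.
    by have [_ /(_ o vo)] := supp v Vv n0; rewrite (negPf os).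
  rewrite big_mkcond /=; apply: eq_bigr => o _; rewrite /T; case: ifP => _; ring.
have e2 : \sum_(v <- s) h v * Lap psi v =
    \sum_(v <- s) \sum_(o <- s) (T v o * (h v * psi o) - T v o * (psi v * h v)).
  rewrite big_seq [RHS]big_seq; apply: eq_bigr => v vs; have Vv := sV v vs.
  transitivity (\sum_(o <- s | o \in nb v) h v * (tanw v o * (psi o - psi v))).
    rewrite -sum_nb // /Lap ?mulr_sumr //.
    move=> o vo os; have [Vo _ _ _] := cc_nb cc Vv vo.
    have -> : psi o = 0.
      by apply: contrapT => n0; have [os' _] := supp o Vo n0; rewrite os' in os.
    have -> : psi v = 0.
      by apply: contrapT => n0; have [_ /(_ o vo)] := supp v Vv n0; rewrite (negPf os).
    by rewrite subrr !mulr0.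
  rewrite big_mkcond /=; apply: eq_bigr => o _; rewrite /T; case: ifP => _; ring.
rewrite e1 e2.
under eq_bigr => v _ do rewrite sumrB.
under [RHS]eq_bigr => v _ do rewrite sumrB.
rewrite !sumrB; congr (_ - _).
rewrite exchange_big /= big_seq [RHS]big_seq; apply: eq_bigr => v vs.
rewrite big_seq [RHS]big_seq; apply: eq_bigr => o os.
by rewrite (TC o v) // [psi o * _]mulrC.
Qed.

Variables (p : cplx R) (a : R).
Hypothesis a_ge : 1000 * delta <= a.
(** The shift keeps the regularised distance [rd] at least 1000 delta, so that one step changes [qd]
    by a small relative amount even next to [p]. *)
Definition qd z := nrm2 (z - p) + a ^+ 2.
Definition rd z := Num.sqrt (qd z).
Notation q := qd.
Notation r := rd.
Let a0 : 0 < a. Proof. by have := delta0; have := a_ge; lra. Qed.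

Lemma qd_ge v : a ^+ 2 <= q v.
Proof. by rewrite /qd lerDr nrm2_ge0. Qed.
Lemma qd_gt0 v : 0 < q v.
Proof. by apply: lt_le_trans (qd_ge v); rewrite exprn_gt0. Qed.
Lemma rd_gt0 v : 0 < r v. Proof. by rewrite /rd sqrtr_gt0 qd_gt0. Qed.
Lemma rd_sqr v : r v ^+ 2 = q v. Proof. by rewrite /rd sqr_sqrtr // ltW // qd_gt0. Qed.
Lemma rd_ge v : 1000 * delta <= r v.
Proof.
apply: (le_trans a_ge).
rewrite -ler_sqr ?nnegrE ?(ltW (rd_gt0 v)) ?(ltW a0) // rd_sqr; exact: qd_ge.
Qed.
Lemma rd_ge_cabs v : cabs (v - p) <= r v.
Proof. by rewrite cabs_le ?(ltW (rd_gt0 v)) // rd_sqr /qd lerDl sqr_ge0. Qed.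

Lemma dqE v o : q o - q v = 2 * dot (v - p) (o - v) + nrm2 (o - v).
Proof. by rewrite /qd /nrm2 /dot !cE; ring. Qed.

Lemma abs_dot_le b c : `|dot b c| <= cabs b * cabs c.
Proof.
rewrite ler_norml dot_le andbT lerNl.
have -> : - dot b c = dot (- b) c by rewrite /dot !cE; ring.
by apply: (le_trans (dot_le _ _)); rewrite cabsN.
Qed.

Lemma nb_dot_le v o : V v -> o \in nb v -> `|dot (v - p) (o - v)| <= r v * (2 * delta).
Proof.
move=> Vv vo; apply: (le_trans (abs_dot_le _ _)).
by apply: ler_pM; rewrite ?cabs_ge0 ?rd_ge_cabs // (nb_cabs_le delta0 cc Vv vo).
Qed.

Lemma abs_dq v o : V v -> o \in nb v -> `|q o - q v| <= 8 * delta * r v.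
Proof.
move=> Vv vo; rewrite dqE; have h1 := nb_dot_le Vv vo; have h2 := nb_nrm2_le cc Vv vo.
have h3 : delta * delta <= delta * r v.
  by rewrite ler_pM2l //; have := rd_ge v; have := delta0; lra.
apply: (le_trans (ler_normD _ _)); rewrite normrM (ger0_norm (nrm2_ge0 _)) ger0_norm //.
by move: h2; rewrite expr2; lra.
Qed.

Lemma sum_dq v : V v -> \sum_(o <- nb v) tanw v o * (q o - q v) = area v.
Proof.
move=> Vv; rewrite /area.
transitivity (\sum_(o <- nb v) (2 * Re (v - p) * (tanw v o * Re (o - v)) +
   2 * Im (v - p) * (tanw v o * Im (o - v)) + tanw v o * nrm2 (o - v))).
  by apply: eq_bigr => o _; rewrite dqE /dot; ring.
rewrite !big_split /= -!mulr_sumr (moment_Re cc Vv) (moment_Im cc Vv); ring.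
Qed.

(** Isotropy: by the moment identities only the trace of the second moment survives. *)
Lemma sum_dot2 v : V v ->
  \sum_(o <- nb v) tanw v o * dot (v - p) (o - v) ^+ 2 = nrm2 (v - p) * area v / 2.
Proof.
move=> Vv; rewrite /area.
transitivity (\sum_(o <- nb v) (nrm2 (v - p) / 2 * (tanw v o * nrm2 (o - v)) +
   (Re (v - p) ^+ 2 - Im (v - p) ^+ 2) / 2 * (tanw v o * (Re (o - v) ^+ 2 - Im (o - v) ^+ 2)) +
   2 * Re (v - p) * Im (v - p) * (tanw v o * (Re (o - v) * Im (o - v))))).
  by apply: eq_bigr => o _; rewrite /dot /nrm2; field.
rewrite !big_split /= -!mulr_sumr (moment_Re2Im2 cc Vv) (moment_ReIm cc Vv); ring.
Qed.

Lemma area_ge0 v : V v -> 0 <= area v.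
Proof.
move=> Vv; rewrite /area big_seq sumr_ge0 // => o vo.
by rewrite mulr_ge0 ?nrm2_ge0 // ltW // (nb_tanw_gt0 cc Vv vo).
Qed.

Lemma sum_dq2 v : V v ->
  `|\sum_(o <- nb v) tanw v o * (q o - q v) ^+ 2 - 2 * nrm2 (v - p) * area v| <=
  12 * delta * r v * area v.
Proof.
move=> Vv.
have -> : \sum_(o <- nb v) tanw v o * (q o - q v) ^+ 2 - 2 * nrm2 (v - p) * area v =
  \sum_(o <- nb v) tanw v o * nrm2 (o - v) * (4 * dot (v - p) (o - v) + nrm2 (o - v)).
  have -> : 2 * nrm2 (v - p) * area v =
      \sum_(o <- nb v) 4 * (tanw v o * dot (v - p) (o - v) ^+ 2).
    by rewrite -mulr_sumr sum_dot2 //; field.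
  by rewrite -sumrB; apply: eq_bigr => o _; rewrite dqE; ring.
apply: (le_trans (ler_norm_sum _ _ _)).
rewrite /area mulr_sumr big_seq [X in _ <= X]big_seq ler_sum // => o vo.
have t0 : 0 <= tanw v o * nrm2 (o - v).
  by rewrite mulr_ge0 ?nrm2_ge0 // ltW // (nb_tanw_gt0 cc Vv vo).
rewrite normrM (ger0_norm t0) mulrC ler_wpM2r //.
have h1 := nb_dot_le Vv vo; have h2 := nb_nrm2_le cc Vv vo.
have h3 : delta * delta <= delta * r v.
  by rewrite ler_pM2l //; have := rd_ge v; have := delta0; lra.
apply: (le_trans (ler_normD _ _)); rewrite normrM (ger0_norm (nrm2_ge0 _)) ger0_norm //.
by move: h2; rewrite expr2; lra.
Qed.

Lemma sum_dq3 v : V v ->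
  \sum_(o <- nb v) tanw v o * `|q o - q v| ^+ 3 <= 17 * delta * r v ^+ 3 * area v.
Proof.
move=> Vv; have A0 := area_ge0 Vv; have r0 := rd_gt0 v.
apply: (@le_trans _ _ (8 * delta * r v * \sum_(o <- nb v) tanw v o * (q o - q v) ^+ 2)).
  rewrite mulr_sumr big_seq [X in _ <= X]big_seq ler_sum // => o vo.
  rewrite exprS -[(q o - q v) ^+ 2]real_normK ?num_real //.
  rewrite [X in _ <= X](_ : _ = tanw v o * (8 * delta * r v * `|q o - q v| ^+ 2)); last by ring.
  rewrite ler_wpM2l //; first exact: ltW (nb_tanw_gt0 cc Vv vo).
  by rewrite ler_wpM2r ?sqr_ge0 // abs_dq.
have := sum_dq2 Vv; rewrite ler_norml => /andP[_]; rewrite lerBlDr => h.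
have h1 : nrm2 (v - p) <= r v ^+ 2 by rewrite rd_sqr /qd lerDl sqr_ge0.
have h2 : delta * r v <= r v ^+ 2 / 1000.
  rewrite expr2 (_ : r v * r v / 1000 = (r v / 1000) * r v); last by field.
  by rewrite ler_pM2r //; have := rd_ge v; lra.
have h3 : \sum_(o <- nb v) tanw v o * (q o - q v) ^+ 2 <= 17 / 8 * r v ^+ 2 * area v.
  apply: (le_trans h); rewrite -mulrDl ler_wpM2r //; have := sqr_ge0 (r v); lra.
rewrite [X in _ <= X](_ : _ = 8 * delta * r v * (17 / 8 * r v ^+ 2 * area v)); last by field.
by rewrite ler_wpM2l // !mulr_ge0 // ltW.
Qed.

Definition dx v o : R := (q o - q v) / q v.
Notation x := dx.

Lemma abs_x v o : V v -> o \in nb v -> `|x v o| <= 2^-1.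
Proof.
move=> Vv vo; rewrite /dx normrM normfV (gtr0_norm (qd_gt0 v)) ler_pdivrMr ?qd_gt0 //.
apply: (le_trans (abs_dq Vv vo)); rewrite -rd_sqr expr2 mulrA ler_pM2r ?rd_gt0 //.
have := rd_ge v; have := delta0; have h2 : (2^-1 : R) * 2 = 1 by rewrite mulVf // pnatr_eq0.
by lra.
Qed.

(** Turns a one-variable Taylor bound in the relative increment [x] into a bound on the Laplacian.
    In units of area / q, the first moment of [x] is 1, the second is 2 (1 - a^2 / q) up to 12 delta
    / r, and the cubic one is at most 17 delta / r. *)
Lemma Lap_taylor_le F v (al be ga : R) : V v -> 0 <= ga ->
  (forall o, o \in nb v -> F o - F v <= al * x v o + be * x v o ^+ 2 + ga * `|x v o| ^+ 3) ->
  Lap F v <= area v / q v * (al + 2 * be * (1 - a ^+ 2 / q v) +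
    12 * `|be| * (delta / r v) + 17 * ga * (delta / r v)).
Proof.
move=> Vv ga0 H; have q0 := qd_gt0 v; have r0 := rd_gt0 v.
apply: (@le_trans _ _ (\sum_(o <- nb v) (al / q v * (tanw v o * (q o - q v)) +
   be / q v ^+ 2 * (tanw v o * (q o - q v) ^+ 2) + ga / q v ^+ 3 * (tanw v o * `|q o - q v| ^+ 3)))).
  rewrite /Lap big_seq [X in _ <= X]big_seq ler_sum // => o vo.
  have t0 := ltW (nb_tanw_gt0 cc Vv vo).
  apply: (le_trans (ler_wpM2l t0 (H o vo))).
  rewrite /dx normrM normfV (gtr0_norm q0) le_eqVlt; apply/orP; left; apply/eqP.
  by field; rewrite gt_eqF.
rewrite !big_split /= -!mulr_sumr sum_dq //.
set S2 := \sum_(o <- nb v) tanw v o * (q o - q v) ^+ 2.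
set S3 := \sum_(o <- nb v) tanw v o * _ ^+ 3.
have h3 : ga / q v ^+ 3 * S3 <= area v / q v * (17 * ga * (delta / r v)).
  have -> : area v / q v * (17 * ga * (delta / r v)) =
     ga / q v ^+ 3 * (17 * delta * r v ^+ 3 * area v).
    by rewrite -rd_sqr; field; rewrite !gt_eqF.
  by rewrite ler_wpM2l ?sum_dq3 // divr_ge0 // exprn_ge0 // ltW.
have h2 : be / q v ^+ 2 * S2 <= area v / q v * (2 * be * (1 - a ^+ 2 / q v) +
    12 * `|be| * (delta / r v)).
  have -> : area v / q v * (2 * be * (1 - a ^+ 2 / q v) + 12 * `|be| * (delta / r v)) =
      be / q v ^+ 2 * (2 * nrm2 (v - p) * area v) +
      `|be| / q v ^+ 2 * (12 * delta * r v * area v).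
    have -> : nrm2 (v - p) = q v - a ^+ 2 by rewrite /qd addrK.
    by rewrite -rd_sqr; field; rewrite !gt_eqF.
  rewrite -lerBlDl -mulrBr; apply: (le_trans (ler_norm _)).
  rewrite normrM normrM normfV (gtr0_norm (exprn_gt0 2 q0)) ler_wpM2l ?sum_dq2 //.
  by rewrite divr_ge0 // exprn_ge0 // ltW.
apply: (le_trans (lerD (lerD (lexx _) h2) h3)).
by rewrite le_eqVlt; apply/orP; left; apply/eqP; field; rewrite !gt_eqF.
Qed.
End Laplacian.

Section Barrier.
Variable R : realType.
Implicit Types (t u b T : R).

(** Read u = delta / r, b = a^2 / q, T = t and e = delta / S. With k = 448 e, k / sqrt t is 448 u,
    whence 224 = 448 / 2 and 168 = 448 * 3/8. The correction contributes (224 - 336) u = - 112 u,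
    which beats the errors 6 u and 17 u. *)
Lemma barrier_sub_ineq u b T e : 0 <= u -> u <= 1 / 1000 -> 0 <= b -> b <= 1 -> 0 <= T -> 0 <= e ->
  (-1 + T * (1 - 224 * e) + 224 * u) + 2 * (1 / 2 - 168 * u) * (1 - b) +
  12 * `|1 / 2 - 168 * u| * u + 17 * (1 + 448 * u) * u <= T - b / 2.
Proof.
move=> u0 u1 b0 b1 T0 e0; rewrite ger0_norm; last lra.
have Te := mulr_ge0 T0 e0; have ub : u * b <= b / 1000 by nra.
have uu : u * u <= u / 1000 by nra.
lra.
Qed.

(** The same balance leaves - 89 u. Part of it pays for the terms in u^2; the remaining - 79 u is
    what outweighs [b] away from the pole in [weak_harnack_super]. *)
Lemma barrier_super_ineq u b T : 0 <= u -> u <= 1 / 1000 -> 0 <= b -> b <= 1 ->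
  (1 - T / 4 + 224 * u) + 2 * (- (1 / 2) - 168 * u) * (1 - b) +
  12 * `|- (1 / 2) - 168 * u| * u + 17 * (1 + 448 * u) * u <= - (T / 4) + 3 / 2 * b - 79 * u.
Proof.
move=> u0 u1 b0 b1; rewrite ler0_norm; last lra.
have ub : u * b <= b / 1000 by nra.
have uu : u * u <= u / 1000 by nra.
lra.
Qed.

(* With [t = (|v - p|^2 + a^2) / S^2], the Laplacian of [- ln t] is that of a smoothed
   Green function up to a relative error [O(delta / |v - p|)]; the multiple [k] of
   [t^(-1/2)], of order [delta / S], has a Laplacian of the same order and absorbs
   that error.  Both barriers vanish at [t = 1], where they are cut off by [0]:
   [bsub] to second order, [bsuper] with a negative slope, so that its cut-off only
   gains Laplacian. *)
Definition bsub (k t : R) : R := - ln t + t - 1 - k * ((Num.sqrt t)^-1 - 1 + (t - 1) / 2).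
Definition bsuper (k t : R) : R := - ln t + (t - 1) / 4 + k * ((Num.sqrt t)^-1 - 1).

(** The correction in [bsub] has a double zero at t = 1, so the second-order contact with 0 is
    kept. *)
Lemma sqrt_convex t : 0 < t ->
  (Num.sqrt t)^-1 - 1 + (t - 1) / 2 =
  (1 - Num.sqrt t) ^+ 2 * (Num.sqrt t + 2) / (2 * Num.sqrt t).
Proof.
move=> t0; have s0 : 0 < Num.sqrt t by rewrite sqrtr_gt0.
have E : t = Num.sqrt t ^+ 2 by rewrite sqr_sqrtr // ltW.
by rewrite {2}E; field; rewrite gt_eqF.
Qed.

(** With s = sqrt t, ln s <= s - 1 bounds the main part below by (1 - s)^2. The correction is this
    square times k (s + 2) / (2 s), at most 1 since k <= s / 2 and s <= 2. *)
Lemma bsub_ge0 k t : 0 < t -> t <= 4 -> 0 <= k -> k <= Num.sqrt t / 2 -> 0 <= bsub k t.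
Proof.
move=> t0 t4 k0 ks; have s0 : 0 < Num.sqrt t by rewrite sqrtr_gt0.
have E : t = Num.sqrt t ^+ 2 by rewrite sqr_sqrtr // ltW.
have s2 : Num.sqrt t <= 2.
  by rewrite -ler_sqr ?nnegrE ?(ltW s0) // -E (_ : (2 : R) ^+ 2 = 4) //; ring.
rewrite /bsub sqrt_convex //; have : - ln t + t - 1 >= (1 - Num.sqrt t) ^+ 2.
  by have := ln_le_sub1 s0; rewrite [in ln t]E lnXn // mulr2n [in X in _ -> _ <= _ + X - _]E; lra.
suff : k * ((1 - Num.sqrt t) ^+ 2 * (Num.sqrt t + 2) / (2 * Num.sqrt t)) <= (1 - Num.sqrt t) ^+ 2.
  by lra.
set s := Num.sqrt t in s0 s2 ks *.
have -> : k * ((1 - s) ^+ 2 * (s + 2) / (2 * s)) = (1 - s) ^+ 2 * (k * (s + 2) / (2 * s)).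
  by ring.
rewrite ler_piMr ?sqr_ge0 // ler_pdivrMr ?mulr_gt0 // mul1r; nra.
Qed.

Lemma bsub_le k t : 0 < t -> 0 <= k -> bsub k t <= (1 - t) ^+ 2 / t.
Proof.
move=> t0 k0; have s0 : 0 < Num.sqrt t by rewrite sqrtr_gt0.
have : 0 <= k * ((Num.sqrt t)^-1 - 1 + (t - 1) / 2).
  rewrite sqrt_convex //; apply: mulr_ge0 => //; apply: divr_ge0; last by rewrite mulr_ge0 // ltW.
  by apply: mulr_ge0; [exact: sqr_ge0|lra].
have -> : (1 - t) ^+ 2 / t = t^-1 - 1 + (t - 1) by field; rewrite gt_eqF.
rewrite /bsub; have := ln_ge_1subV t0; lra.
Qed.

Lemma bsuper_ge0 k t : 0 < t -> t < 1 -> 0 <= k -> 0 <= bsuper k t.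
Proof.
move=> t0 t1 k0; have s0 : 0 < Num.sqrt t by rewrite sqrtr_gt0.
have s1 : Num.sqrt t <= 1 by rewrite -(sqrtr1 R) ler_sqrt // ltW.
have : 0 <= k * ((Num.sqrt t)^-1 - 1) by rewrite mulr_ge0 // subr_ge0 invf_ge1.
by rewrite /bsuper; have := ln_le_sub1 t0; lra.
Qed.

(** By ln t >= (t - 1) / t, the slope 1/4 is dominated by 1 / t on [1, 4]; this range contains every
    neighbour of a point with t < 1. *)
Lemma bsuper_le0 k t : 1 <= t -> t <= 4 -> 0 <= k -> bsuper k t <= 0.
Proof.
move=> t1 t4 k0; have t0 : 0 < t by apply: lt_le_trans t1.
have s0 : 0 < Num.sqrt t by rewrite sqrtr_gt0.
have s1 : 1 <= Num.sqrt t by rewrite -(sqrtr1 R) ler_sqrt // ltW.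
have : k * ((Num.sqrt t)^-1 - 1) <= 0 by rewrite mulr_ge0_le0 // subr_le0 invf_le1.
have : (t - 1) / 4 <= 1 - t^-1.
  have -> : 1 - t^-1 = (t - 1) * t^-1 by field; rewrite gt_eqF.
  by rewrite ler_wpM2l ?subr_ge0 // lef_pV2 ?posrE.
by rewrite /bsuper; have := ln_ge_1subV t0; lra.
Qed.

Lemma bsub_step k t x : 0 < t -> `|x| <= 2^-1 -> 0 <= k ->
  bsub k (t * (1 + x)) - bsub k t <=
  (-1 + t * (1 - k / 2) + k / Num.sqrt t / 2) * x +
  (1 / 2 - 3 / 8 * (k / Num.sqrt t)) * x ^+ 2 + (1 + k / Num.sqrt t) * `|x| ^+ 3.
Proof.
move=> t0 hx k0; have := hx; rewrite ler_norml => /andP[x1 x2].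
have h2 : (2^-1 : R) * 2 = 1 by rewrite mulVf // pnatr_eq0.
have y0 : 0 < 1 + x by lra.
have s0 : 0 < Num.sqrt t by rewrite sqrtr_gt0.
have ln1 := ln_taylor hx; have sq1 := sqrtV_taylor hx.
rewrite /bsub lnM ?posrE // sqrtrM ?(ltW t0) // invfM.
have h : k / Num.sqrt t * (1 - x / 2 + 3 / 8 * x ^+ 2 - `|x| ^+ 3) <=
    k / Num.sqrt t * (Num.sqrt (1 + x))^-1.
  by rewrite ler_wpM2l // divr_ge0 // ltW.
by move: ln1; rewrite ler_norml => /andP[ln1 _]; lra.
Qed.

Lemma bsuper_step k t x : 0 < t -> `|x| <= 2^-1 -> 0 <= k ->
  - bsuper k (t * (1 + x)) - - bsuper k t <=
  (1 - t / 4 + k / Num.sqrt t / 2) * x +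
  (- (1 / 2) - 3 / 8 * (k / Num.sqrt t)) * x ^+ 2 + (1 + k / Num.sqrt t) * `|x| ^+ 3.
Proof.
move=> t0 hx k0; have := hx; rewrite ler_norml => /andP[x1 x2].
have h2 : (2^-1 : R) * 2 = 1 by rewrite mulVf // pnatr_eq0.
have y0 : 0 < 1 + x by lra.
have s0 : 0 < Num.sqrt t by rewrite sqrtr_gt0.
have ln1 := ln_taylor hx; have sq1 := sqrtV_taylor hx.
rewrite /bsuper lnM ?posrE // sqrtrM ?(ltW t0) // invfM.
have h : k / Num.sqrt t * (1 - x / 2 + 3 / 8 * x ^+ 2 - `|x| ^+ 3) <=
    k / Num.sqrt t * (Num.sqrt (1 + x))^-1.
  by rewrite ler_wpM2l // divr_ge0 // ltW.
by move: ln1; rewrite ler_norml => /andP[_ ln1]; lra.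
Qed.
End Barrier.

(** * Mean value inequality and weak Harnack inequality *)

Section MeanValue.
Variable R : realType.
Variables (delta kap : R) (V W : set (cplx R)) (nb : cplx R -> seq (cplx R)).
Hypothesis delta0 : 0 < delta.
Hypothesis kap01 : 0 < kap <= 1.
Hypothesis cc : colour_class delta kap V W nb.
Implicit Types (b c m o v y z : cplx R) (h psi F : cplx R -> R).
Notation tanw := (tanw delta).
Notation area := (area delta nb).
Notation Lap := (Lap delta nb).
Variables (p : cplx R) (a S : R).
Hypothesis Vp : V p.
Hypothesis a_ge : 1000 * delta <= a.
Hypothesis S_ge : 2 * a <= S.
Notation q := (qd p a).
Notation r := (rd p a).
Notation x := (dx p a).
Let a0 : 0 < a. Proof. by have := delta0; have := a_ge; lra. Qed.
Let S0 : 0 < S. Proof. by have := a0; have := S_ge; lra. Qed.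
Let k := 448 * (delta / S).
Let t v := q v / S ^+ 2.
Let q0 v : 0 < q v. Proof. exact: (qd_gt0 delta0 p a_ge). Qed.
Let r0 v : 0 < r v. Proof. exact: (rd_gt0 delta0 p a_ge). Qed.

Lemma tt_gt0 v : 0 < t v. Proof. by rewrite divr_gt0 ?exprn_gt0. Qed.

Lemma sqrt_tt v : Num.sqrt (t v) = r v / S.
Proof.
have -> : t v = (r v / S) ^+ 2 by rewrite /t expr_div_n (rd_sqr delta0 p a_ge).
by rewrite sqrtr_sqr ger0_norm // divr_ge0 // ltW.
Qed.

Lemma k_ge0 : 0 <= k. Proof. by rewrite /k; have := divr_gt0 delta0 S0; lra. Qed.

Lemma k_sqrt_tt v : k / Num.sqrt (t v) = 448 * (delta / r v).
Proof. by rewrite sqrt_tt /k; field; rewrite !gt_eqF. Qed.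

Lemma tt_step v o : t o = t v * (1 + x v o).
Proof. by rewrite /t /dx; field; rewrite !gt_eqF. Qed.

Lemma u_bounds v : 0 <= delta / r v /\ delta / r v <= 1 / 1000.
Proof.
split; first by rewrite divr_ge0 // ltW.
by rewrite ler_pdivrMr //; have := rd_ge delta0 p a_ge v; lra.
Qed.

Lemma b_bounds v : 0 <= a ^+ 2 / q v /\ a ^+ 2 / q v <= 1.
Proof.
split; first by rewrite divr_ge0 ?sqr_ge0 // ltW.
by rewrite ler_pdivrMr // mul1r; apply: qd_ge.
Qed.

Lemma area_q v : area v / q v * t v = area v / S ^+ 2.
Proof. by rewrite /t; field; rewrite !gt_eqF. Qed.

Lemma aq_ge0 v : V v -> 0 <= area v / q v.
Proof. by move=> Vv; rewrite divr_ge0 ?(area_ge0 cc Vv) // ltW. Qed.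

(** The term t gives a source of density 1 / S^2, and - ln t a negative one of density a^2 / (2 q^2)
    concentrated near [p], a smoothed point mass. *)
Lemma Lap_bsub v : V v -> Lap (fun z => bsub k (t z)) v <=
  area v / S ^+ 2 - area v / q v * (a ^+ 2 / q v / 2).
Proof.
move=> Vv; have [u0 u1] := u_bounds v; have [b0 b1] := b_bounds v.
pose al := -1 + t v * (1 - 224 * (delta / S)) + 224 * (delta / r v).
pose be := 1 / 2 - 168 * (delta / r v).
pose ga := 1 + 448 * (delta / r v).
have ga0 : 0 <= ga by rewrite /ga; lra.
have H o : o \in nb v -> bsub k (t o) - bsub k (t v) <=
    al * x v o + be * x v o ^+ 2 + ga * `|x v o| ^+ 3.
  move=> vo; have hx := abs_x delta0 cc p a_ge Vv vo.
  rewrite (tt_step v o); apply: (le_trans (bsub_step (tt_gt0 v) hx k_ge0)).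
  rewrite k_sqrt_tt le_eqVlt; apply/orP; left; apply/eqP.
  by rewrite /al /be /ga /k; field; rewrite !gt_eqF.
apply: (le_trans (Lap_taylor_le delta0 cc a_ge (F := fun z => bsub k (t z)) Vv ga0 H)).
rewrite -area_q -mulrBr ler_wpM2l ?aq_ge0 //.
by apply: barrier_sub_ineq => //; [exact: ltW (tt_gt0 v)|rewrite divr_ge0 // ltW].
Qed.

Lemma Lap_bsuper v : V v -> area v / q v * (t v / 4 - 3 / 2 * (a ^+ 2 / q v) + 79 * (delta / r v)) <=
  Lap (fun z => bsuper k (t z)) v.
Proof.
move=> Vv; have [u0 u1] := u_bounds v; have [b0 b1] := b_bounds v.
pose al := 1 - t v / 4 + 224 * (delta / r v).
pose be := - (1 / 2) - 168 * (delta / r v).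
pose ga := 1 + 448 * (delta / r v).
have ga0 : 0 <= ga by rewrite /ga; lra.
have -> : Lap (fun z => bsuper k (t z)) v = - Lap (fun z => - bsuper k (t z)) v.
  by rewrite /Lap -sumrN; apply: eq_bigr => o _; ring.
rewrite lerNr.
have H o : o \in nb v -> - bsuper k (t o) - - bsuper k (t v) <=
    al * x v o + be * x v o ^+ 2 + ga * `|x v o| ^+ 3.
  move=> vo; have hx := abs_x delta0 cc p a_ge Vv vo.
  rewrite (tt_step v o); apply: (le_trans (bsuper_step (tt_gt0 v) hx k_ge0)).
  rewrite k_sqrt_tt le_eqVlt; apply/orP; left; apply/eqP.
  by rewrite /al /be /ga /k; field; rewrite !gt_eqF.
apply: (le_trans (Lap_taylor_le delta0 cc a_ge (F := fun z => - bsuper k (t z)) Vv ga0 H)).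
rewrite -[X in _ <= X]mulrN ler_wpM2l ?aq_ge0 //.
have := barrier_super_ineq (t v) u0 u1 b0 b1; rewrite -/al -/be -/ga; lra.
Qed.

Lemma k_le v : k <= Num.sqrt (t v) / 2.
Proof.
rewrite sqrt_tt /k; have [_ u1] := u_bounds v.
have -> : 448 * (delta / S) = 448 * (delta / r v) * (r v / S) by field; rewrite !gt_eqF.
have rS : 0 < r v / S by rewrite divr_gt0.
by move: u1; set u := delta / r v; set w := r v / S in rS *; nra.
Qed.

Lemma tt_nb v o : V v -> o \in nb v -> t v / 2 <= t o <= 3 / 2 * t v.
Proof.
move=> Vv vo; have := abs_x delta0 cc p a_ge Vv vo; rewrite (tt_step v o) ler_norml.
have t0 := tt_gt0 v; have h2 : (2^-1 : R) * 2 = 1 by rewrite mulVf // pnatr_eq0.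
by move=> /andP[x1 x2]; apply/andP; split; nra.
Qed.

Lemma tt_lt1 v : t v < 1 -> cabs (v - p) < S.
Proof.
rewrite ltr_pdivrMr ?exprn_gt0 // mul1r => h; rewrite cabs_lt ?(ltW S0) //.
by apply: le_lt_trans h; rewrite /qd lerDl sqr_ge0.
Qed.

Section Cutoff.
Variables (s : seq (cplx R)) (h : cplx R -> R).
Hypothesis us : uniq s.
Hypothesis sP : forall v, (v \in s) <-> (V v /\ cabs (v - p) <= S + 2 * delta).
Hypothesis h0 : forall v, v \in s -> 0 <= h v.

Let psi (g : R -> R) v := if t v < 1 then g (t v) else 0.

Lemma cutoff_supp g v : V v -> psi g v <> 0 ->
  v \in s /\ (forall o, o \in nb v -> o \in s).
Proof.
move=> Vv; rewrite /psi; case: ifP => // /tt_lt1 vS _.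
have dS : 2 * delta <= S by have := a_ge; have := S_ge; have := delta0; lra.
split; first by apply/sP; split => //; have := delta0; lra.
move=> o vo; have [Vo _ _ _] := cc_nb cc Vv vo; apply/sP; split => //.
have := cabs_triangle o v p; have := nb_cabs_le delta0 cc Vv vo; lra.
Qed.

Lemma sV v : v \in s -> V v. Proof. by move=> /sP []. Qed.

Lemma cutoff_green g : \sum_(v <- s) psi g v * Lap h v = \sum_(v <- s) h v * Lap (psi g) v.
Proof. by apply: (green cc h us sV) => v; exact: cutoff_supp. Qed.

Lemma Lap_mono F F' v : V v -> F v = F' v -> (forall o, o \in nb v -> F o <= F' o) ->
  Lap F v <= Lap F' v.
Proof.
move=> Vv E H; rewrite /Lap big_seq [X in _ <= X]big_seq ler_sum // => o vo.
by rewrite ler_wpM2l ?lerB ?H // ?E // ltW // (nb_tanw_gt0 cc Vv vo).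
Qed.

Lemma p_in : p \in s.
Proof. by apply/sP; split => //; rewrite subrr cabs0; have := S0; have := delta0; lra. Qed.

(** For t v < 1, cutting off outer neighbours only lowers the Laplacian. For t v >= 1 the value is
    0, and a neighbour inside has 1 - t o <= - t v * x v o, so [bsub_le] makes the jump quadratic in
    [x]. *)
Lemma Lap_cutoff_sub v : V v -> Lap (psi (bsub k)) v <= 12 * (area v / S ^+ 2).
Proof.
move=> Vv; have A0 : 0 <= area v / S ^+ 2 by rewrite divr_ge0 ?sqr_ge0 // (area_ge0 cc Vv).
have [tv|tv] := ltP (t v) 1.
  apply: (@le_trans _ _ (Lap (fun z => bsub k (t z)) v)).
    apply: Lap_mono => //; first by rewrite /psi tv.
    move=> o vo; rewrite /psi; case: ifP => // _.
    have /andP[_ t2] := tt_nb Vv vo.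
    by apply: bsub_ge0; [exact: tt_gt0|lra|exact: k_ge0|exact: k_le].
  apply: (le_trans (Lap_bsub Vv)).
  have : 0 <= area v / q v * (a ^+ 2 / q v / 2).
    by have [b_0 _] := b_bounds v; rewrite mulr_ge0 ?aq_ge0 // divr_ge0.
  by lra.
have [u0 u1] := u_bounds v; have [b0 b1] := b_bounds v; have t0 := tt_gt0 v.
have H o : o \in nb v -> psi (bsub k) o - psi (bsub k) v <=
    0 * x v o + 2 * t v * x v o ^+ 2 + 0 * `|x v o| ^+ 3.
  move=> vo; rewrite mul0r add0r mul0r addr0 /psi (ltNge (t v)) tv subr0.
  case: ifP => [to1|_]; last by rewrite mulr_ge0 ?sqr_ge0 // mulr_ge0 // ltW.
  apply: (le_trans (bsub_le (tt_gt0 o) k_ge0)).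
  rewrite ler_pdivrMr ?tt_gt0 //.
  have /andP[to2 _] := tt_nb Vv vo; have E := tt_step v o.
  have xx0 := sqr_ge0 (x v o).
  have h1 : (1 - t o) ^+ 2 <= (t v * x v o) ^+ 2.
    rewrite -[X in _ <= X]sqrrN ler_sqr ?nnegrE; rewrite ?E; lra.
  apply: (le_trans h1).
  have -> : (t v * x v o) ^+ 2 = 2 * t v * x v o ^+ 2 * (t v / 2) by field.
  by rewrite ler_wpM2l //; apply: mulr_ge0 => //; rewrite mulr_ge0 // ltW.
apply: (le_trans (Lap_taylor_le delta0 cc a_ge (F := psi (bsub k)) Vv (lexx _) H)).
have tt0 : 0 <= 2 * t v := mulr_ge0 (ler0n _ 2) (ltW t0).
rewrite -area_q (ger0_norm tt0).
rewrite [X in _ <= X](_ : _ = area v / q v * (12 * t v)); last by ring.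
rewrite ler_wpM2l ?aq_ge0 //.
move: u0 u1 b0 b1; set u := delta / r v; set b := a ^+ 2 / q v => u0 u1 b0 b1.
have tb := mulr_ge0 (ltW t0) b0; have tu : t v * u <= t v / 1000 by nra.
lra.
Qed.

(** Pairing [Lap h] >= 0 with the nonnegative cut-off barrier and moving the Laplacian to the
    barrier leaves - area p * h p / (4 a^2) at the pole, against at most 12 / S^2 times the sum of
    area * h. Hence 48 = 12 * 4. *)
Theorem mean_value_sub : (forall v, V v -> cabs (v - p) < S -> 0 <= Lap h v) ->
  area p * h p <= 48 * a ^+ 2 / S ^+ 2 * \sum_(v <- s) area v * h v.
Proof.
move=> sub.
have pos : 0 <= \sum_(v <- s) psi (bsub k) v * Lap h v.
  rewrite big_seq sumr_ge0 // => v vs; have Vv := sV vs.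
  rewrite /psi; case: ifP => [tv|_]; last by rewrite mul0r.
  rewrite mulr_ge0 ?sub //; last exact: tt_lt1.
  by apply: bsub_ge0; [exact: tt_gt0|lra|exact: k_ge0|exact: k_le].
rewrite cutoff_green in pos.
have SS : 0 < S ^+ 2 by rewrite exprn_gt0.
have aa : 0 < a ^+ 2 by rewrite exprn_gt0.
have S4 : 4 * a ^+ 2 <= S ^+ 2.
  by have := S_ge; have := a0; rewrite !expr2; nra.
have Ep : q p = a ^+ 2 by rewrite /qd subrr /nrm2 /= expr0n !addr0 add0r.
have tp : t p <= 1 / 4 by rewrite /t Ep ler_pdivrMr //; lra.
have Lp : Lap (psi (bsub k)) p <= area p / S ^+ 2 - area p / (2 * a ^+ 2).
  apply: (@le_trans _ _ (Lap (fun z => bsub k (t z)) p)).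
    apply: Lap_mono => //; first by rewrite /psi; case: ifP => // /negbT; rewrite -leNgt; lra.
    move=> o vo; rewrite /psi; case: ifP => // _.
    have /andP[_ t2] := tt_nb Vp vo.
    by apply: bsub_ge0; [exact: tt_gt0|lra|exact: k_ge0|exact: k_le].
  apply: (le_trans (Lap_bsub Vp)); rewrite Ep le_eqVlt; apply/orP; left; apply/eqP.
  by field; rewrite !gt_eqF.
have hp := h0 p_in; have Ap := area_ge0 cc Vp.
have : \sum_(v <- s) h v * Lap (psi (bsub k)) v <=
    12 / S ^+ 2 * (\sum_(v <- s) area v * h v) - area p * h p / (4 * a ^+ 2).
  rewrite (big_rem p p_in) /= [in X in _ <= X](big_rem p p_in) /= mulrDr.
  have h1 : h p * Lap (psi (bsub k)) p <= 12 / S ^+ 2 * (area p * h p) - area p * h p / (4 * a ^+ 2).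
    apply: (le_trans (ler_wpM2l hp Lp)).
    have : area p * h p / S ^+ 2 <= area p * h p / (4 * a ^+ 2).
      by rewrite ler_wpM2l ?mulr_ge0 // lef_pV2 ?posrE // mulr_gt0.
    have : 0 <= area p * h p / S ^+ 2 by rewrite divr_ge0 ?mulr_ge0 // ltW.
    have -> : h p * (area p / S ^+ 2 - area p / (2 * a ^+ 2)) =
      area p * h p / S ^+ 2 - 2 * (area p * h p / (4 * a ^+ 2)) by field; rewrite !gt_eqF.
    rewrite [12 / _ * _](_ : _ = 12 * (area p * h p / S ^+ 2)); last by ring.
    lra.
  have h2 : \sum_(v <- rem p s) h v * Lap (psi (bsub k)) v <=
      12 / S ^+ 2 * \sum_(v <- rem p s) area v * h v.
    rewrite mulr_sumr big_seq [X in _ <= X]big_seq ler_sum // => v /mem_rem vs.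
    rewrite [X in _ <= X](_ : _ = h v * (12 * (area v / S ^+ 2))); last by ring.
    by rewrite ler_wpM2l ?h0 //; exact: Lap_cutoff_sub (sV vs).
  by move: h1 h2; lra.
move/(le_trans pos); rewrite subr_ge0 ler_pdivrMr ?mulr_gt0 // => hh; apply: (le_trans hh).
by rewrite le_eqVlt; apply/orP; left; apply/eqP; field; rewrite gt_eqF.
Qed.

(** The pairing with [Lap h] <= 0 is bounded below: for t < 1 the barrier has Laplacian at least
    area / (4 S^2) minus at most 3/2 area / a^2, and the condition on [rho] lets 79 delta / r cancel
    the negative term once r >= rho. Hence 6 = 4 * 3/2. *)
Theorem weak_harnack_super (rho : R) : 3 / 2 * a ^+ 2 <= 79 * delta * rho ->
  (forall v, V v -> cabs (v - p) < S -> Lap h v <= 0) ->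
  \sum_(v <- s | t v < 1) area v * h v <=
  6 * S ^+ 2 / a ^+ 2 * \sum_(v <- s | cabs (v - p) < rho) area v * h v.
Proof.
move=> rho_ge super.
have SS : 0 < S ^+ 2 by rewrite exprn_gt0.
have aa : 0 < a ^+ 2 by rewrite exprn_gt0.
have neg : \sum_(v <- s) psi (bsuper k) v * Lap h v <= 0.
  rewrite big_seq sumr_le0 // => v vs; have Vv := sV vs.
  rewrite /psi; case: ifP => [tv|_]; last by rewrite mul0r.
  rewrite mulr_ge0_le0 ?super //; last exact: tt_lt1.
  by apply: bsuper_ge0; [exact: tt_gt0|exact: tv|exact: k_ge0].
rewrite cutoff_green in neg.
have low : \sum_(v <- s) ((if t v < 1 then area v * h v / (4 * S ^+ 2) else 0) -
    (if cabs (v - p) < rho then 3 / 2 / a ^+ 2 * (area v * h v) else 0)) <=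
    \sum_(v <- s) h v * Lap (psi (bsuper k)) v.
  rewrite big_seq [X in _ <= X]big_seq ler_sum // => v vs; have Vv := sV vs.
  have hv := h0 vs; have Av := area_ge0 cc Vv; have Ah := mulr_ge0 Av hv.
  have near0 : 0 <= (if cabs (v - p) < rho then 3 / 2 / a ^+ 2 * (area v * h v) else 0).
    by case: ifP => // _; rewrite mulr_ge0 // divr_ge0 // ltW.
  case: ifP => [tv|tv]; last first.
    apply: (@le_trans _ _ 0); first by rewrite sub0r oppr_le0.
    rewrite mulr_ge0 // /Lap big_seq sumr_ge0 // => o vo.
    rewrite mulr_ge0 ?(ltW (nb_tanw_gt0 cc Vv vo)) // {2}/psi tv subr0 /psi.
    by case: ifP => // to; apply: bsuper_ge0; [exact: tt_gt0|exact: to|exact: k_ge0].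
  have Lv : area v / q v * (t v / 4 - 3 / 2 * (a ^+ 2 / q v) + 79 * (delta / r v)) <=
      Lap (psi (bsuper k)) v.
    apply: (le_trans (Lap_bsuper Vv)); apply: Lap_mono => //; first by rewrite /psi tv.
    move=> o vo; rewrite /psi; case: ifP => // /negbT; rewrite -leNgt => to.
    have /andP[_ t2] := tt_nb Vv vo.
    by apply: bsuper_le0; [exact: to|lra|exact: k_ge0].
  apply: le_trans (ler_wpM2l hv Lv).
  have -> : h v * (area v / q v * (t v / 4 - 3 / 2 * (a ^+ 2 / q v) + 79 * (delta / r v))) =
      area v * h v / (4 * S ^+ 2) + area v * h v / q v * (79 * (delta / r v) - 3 / 2 * (a ^+ 2 / q v)).
    by rewrite /t; field; rewrite !gt_eqF.
  rewrite lerD2l; have [near|far] := ltP (cabs (v - p)) rho.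
    have : 3 / 2 / a ^+ 2 * (area v * h v) >= area v * h v / q v * (3 / 2 * (a ^+ 2 / q v)).
      have -> : area v * h v / q v * (3 / 2 * (a ^+ 2 / q v)) =
         3 / 2 / a ^+ 2 * (area v * h v) * ((a ^+ 2 / q v) * (a ^+ 2 / q v)).
        by field; rewrite !gt_eqF.
      have [b_0 b_1] := b_bounds v.
      have bb : a ^+ 2 / q v * (a ^+ 2 / q v) <= 1.
        by move: b_0 b_1; set bq := a ^+ 2 / q v; nra.
      apply: ler_piMr bb; apply: mulr_ge0 => //; apply: divr_ge0; last exact: ltW.
      lra.
    have : 0 <= area v * h v / q v * (79 * (delta / r v)).
      by have [u0 _] := u_bounds v; rewrite mulr_ge0 ?divr_ge0 ?(ltW (q0 v)) // mulr_ge0.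
    by rewrite mulrBr; lra.
  rewrite oppr0 mulr_ge0 ?divr_ge0 ?(ltW (q0 v)) //.
  have rr : rho <= r v by apply: (le_trans far); apply: (rd_ge_cabs delta0 p a_ge).
  have -> : 79 * (delta / r v) - 3 / 2 * (a ^+ 2 / q v) =
      (79 * delta * r v - 3 / 2 * a ^+ 2) / q v.
    by rewrite -(rd_sqr delta0 p a_ge); field; rewrite gt_eqF.
  rewrite divr_ge0 ?(ltW (q0 v)) // subr_ge0; apply: (le_trans rho_ge).
  by rewrite ler_pM2l // mulr_gt0.
have := le_trans low neg; rewrite sumrB subr_le0 -!big_mkcond /= -mulr_suml -mulr_sumr.
rewrite ler_pdivrMr ?mulr_gt0 // => hh; apply: (le_trans hh).
by rewrite le_eqVlt; apply/orP; left; apply/eqP; field; rewrite gt_eqF.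
Qed.
End Cutoff.
End MeanValue.

(** * s-holomorphic stars *)

Section StarAlgebra.
Variable R : realType.
Implicit Types (delta k s : R) (m n al D Z F : cplx R).

(* Compatibility across an edge of direction [al] of two values of [F] differing by
   [D], namely [delta * D + i * conj al * conj D = 0]: equal projections on
   [(- i * al)^(-1/2)]. *)
Definition edge_rel delta al D :=
  (delta + Im al) * Re D + Re al * Im D = 0 /\ Re al * Re D + (delta - Im al) * Im D = 0.

(* [al] is [i * n ^ 2] up to the positive factor [s]. *)
Definition dir_sqrt s n al := Re al = - s * (2 * Re n * Im n) /\
  Im al = s * (Re n ^+ 2 - Im n ^+ 2).

(** The two real relations amount to the single one Re (n D) = 0: equality of components along one
    line. *)
Lemma edge_rel_sqrt delta s n al D : dir_sqrt s n al -> delta = s * nrm2 n -> 0 < delta ->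
  edge_rel delta al D -> Re n * Re D - Im n * Im D = 0.
Proof.
move=> [ex ey] ed d0 [r1 r2].
have E : 2 * delta * (Re n * Re D - Im n * Im D) = 0.
  have -> : 2 * delta * (Re n * Re D - Im n * Im D) =
     Re n * ((delta + Im al) * Re D + Re al * Im D) - Im n * (Re al * Re D + (delta - Im al) * Im D).
    by rewrite ex ey ed /nrm2; ring.
  by rewrite r1 r2; ring.
by move/eqP: E; rewrite mulf_eq0 mulf_eq0 (gt_eqF d0) pnatr_eq0 /= => /eqP.
Qed.

Lemma exists_sqrt al : exists m, dir_sqrt 1 m al.
Proof.
pose z : cplx R := Complex (Im al) (- Re al).
exists (sqrtC z); have E : sqrtC z ^+ 2 = z by rewrite sqrtCK.
have hr : Re (sqrtC z ^+ 2) = Im al by rewrite E.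
have hi : Im (sqrtC z ^+ 2) = - Re al by rewrite E.
move: hr hi; rewrite expr2 !cE => hr hi; split.
  by rewrite mulN1r -(opprK (Re al)) -hi; ring.
by rewrite -hr; ring.
Qed.

Variables (m al0 : cplx R).
Hypothesis m0 : dir_sqrt 1 m al0.

Definition circ_dir k : cplx R := al0 * Complex ((k ^+ 2 - 1) / (k ^+ 2 + 1)) (2 * k / (k ^+ 2 + 1)).
(** The factor k + i turns by half the angle of [circ_dir k]: a continuous branch of the square root
    over the circle cut at [al0]. *)
Definition circ_root k : cplx R := m * Complex k 1.

Lemma circ_dir_sqrt k : dir_sqrt (k ^+ 2 + 1)^-1 (circ_root k) (circ_dir k).
Proof.
case: m0 => hx hy; rewrite /dir_sqrt /circ_dir /circ_root !cE /= hx hy.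
by split; field; rewrite sq1_neq0.
Qed.

Lemma circ_root_nrm2 k : (k ^+ 2 + 1)^-1 * nrm2 (circ_root k) = nrm2 m.
Proof. by rewrite /nrm2 /circ_root !cE /=; field; rewrite sq1_neq0. Qed.

(** [pz] and [qz] are the real and imaginary parts of m F; [yz] is the real part of
    [circ_root k * F], the signed component shared by the two rhombi at an edge of direction
    [circ_dir k]. *)
Definition pz F := Re m * Re F - Im m * Im F.
Definition qz F := Re m * Im F + Im m * Re F.
Definition yz F k := pz F * k - qz F.
Definition gz F k := 2 * yz F k ^+ 2 * k / (k ^+ 2 + 1).

Lemma yzE F k : yz F k = Re (circ_root k) * Re F - Im (circ_root k) * Im F.
Proof. by rewrite /yz /pz /qz /circ_root !cE /=; ring. Qed.

Lemma Re_sqr_circ F k : Re (F ^+ 2 * circ_dir k) = - 2 * yz F k * pz F + gz F k.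
Proof.
case: m0 => hx hy; rewrite /gz /yz /pz /qz /circ_dir expr2 !cE /= hx hy.
by field; rewrite sq1_neq0.
Qed.

Lemma Re_sqr_base F : Re (F ^+ 2 * al0) = - 2 * pz F * qz F.
Proof. by case: m0 => hx hy; rewrite /pz /qz expr2 !cE /= hx hy; ring. Qed.

(** The deficit is the square term 2 (pz F)^2 (ka - kb). The bound involves [F] only through the
    shared components [yz], so it telescopes around a point. *)
Lemma picone F ka kb : kb < ka ->
  gz F kb - gz F ka <= Re (F ^+ 2 * (circ_dir kb - circ_dir ka)).
Proof.
move=> h; rewrite mulrBr cReD cReN !Re_sqr_circ.
have -> : - 2 * yz F kb * pz F + gz F kb - (- 2 * yz F ka * pz F + gz F ka) =
  gz F kb - gz F ka + 2 * pz F ^+ 2 * (ka - kb) by rewrite /yz; ring.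
by rewrite lerDl mulr_ge0 ?subr_ge0 ?(ltW h) // mulr_ge0 ?sqr_ge0.
Qed.

(** The quantity of [exists_bad] factors through the signed components at the two corners; when 1 +
    ka * kb > 0 it is positive exactly when they have the same sign. *)
Lemma bad_circ F ka kb : nrm2 m * Im (F ^+ 2 * (circ_dir ka + circ_dir kb)) +
    nrm2 F * (nrm2 m ^+ 2 + dot (circ_dir ka) (circ_dir kb)) =
  4 * nrm2 m * (1 + ka * kb) * (yz F ka * yz F kb) / ((ka ^+ 2 + 1) * (kb ^+ 2 + 1)).
Proof.
case: m0 => hx hy; rewrite /yz /pz /qz /circ_dir /nrm2 /dot expr2 !cE /= hx hy.
by field; rewrite !sq1_neq0.
Qed.

Lemma bad_base F k : nrm2 m * Im (F ^+ 2 * (al0 + circ_dir k)) +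
    nrm2 F * (nrm2 m ^+ 2 + dot al0 (circ_dir k)) =
  4 * nrm2 m * k * (pz F * yz F k) / (k ^+ 2 + 1).
Proof.
case: m0 => hx hy; rewrite /yz /pz /qz /circ_dir /nrm2 /dot expr2 !cE /= hx hy.
by field; rewrite !sq1_neq0.
Qed.
End StarAlgebra.

Section Star.
Variable R : realType.
Variables (delta kap : R) (V W : set (cplx R)) (nb : cplx R -> seq (cplx R)).
Hypothesis delta0 : 0 < delta.
Hypothesis kap01 : 0 < kap <= 1.
Hypothesis cc : colour_class delta kap V W nb.
Implicit Types (a b c m o z : cplx R).
Notation lft := (lft delta).
Notation tanw := (tanw delta).
Variable v : cplx R.
Hypothesis Vv : V v.
Variable Fs : cplx R -> cplx R.
Hypothesis hol : forall o o', o \in nb v -> o' \in nb v -> lft o' v = lft v o ->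
  edge_rel delta (lft v o - v) (Fs o - Fs o').

Lemma nb_prev o : o \in nb v -> exists2 o', o' \in nb v & lft v o' = lft o v.
Proof.
move=> vo; have : lft o v \in [seq lft o v | o <- nb v] by apply/mapP; exists o.
by rewrite -(perm_mem (lft_perm cc Vv)) => /mapP [ o' vo' E]; exists o'.
Qed.

(** [phi] may depend on the rhombus, provided that the two rhombi at an edge agree there; it then
    descends to a function [g] of the corner. The default of [head] is never reached at a corner. *)
Lemma telescope_edges (T : zmodType) (phi : cplx R -> cplx R -> T) :
  (forall o o', o \in nb v -> o' \in nb v -> lft o' v = lft v o ->
     phi o (lft v o) = phi o' (lft o' v)) ->
  \sum_(o <- nb v) (phi o (lft v o) - phi o (lft o v)) = 0.
Proof.
move=> H; pose g a := phi (head v [seq o <- nb v | lft o v == a]) a.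
have gE o : o \in nb v -> g (lft o v) = phi o (lft o v).
  move=> vo; rewrite /g; set s := [seq o' <- nb v | lft o' v == lft o v].
  have os : o \in s by rewrite mem_filter eqxx.
  have hs : head v s \in s by case: s os => // y s _; apply: mem_head.
  move: hs; rewrite mem_filter => /andP[/eqP E hs].
  by rewrite (cc_injr cc Vv hs vo E).
have gE' o : o \in nb v -> g (lft v o) = phi o (lft v o).
  move=> vo; have [ o' vo' E] := cc_next cc Vv vo.
  by rewrite (H o o' vo vo' E) -E gE.
rewrite -[RHS](subrr (\sum_(o <- nb v) g (lft o v))) -{1}(telescope_nb cc g Vv) -sumrB.
by rewrite big_seq [RHS]big_seq; apply: eq_bigr => o vo; rewrite gE // gE'.
Qed.

Section Base.
Variable o0 : cplx R.
Hypothesis vo0 : o0 \in nb v.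
Let a0 := lft o0 v.
Let D0 : 0 < nrm2 (a0 - v).
Proof. by have [-> _] := cc_dist cc Vv vo0; rewrite exprn_gt0. Qed.
Let K a := ctg v a0 a.

Lemma corner_nrm2 o : o \in nb v ->
  nrm2 (lft o v - v) = nrm2 (a0 - v) /\ nrm2 (lft v o - v) = nrm2 (a0 - v).
Proof. by move=> vo; have [-> ->] := cc_dist cc Vv vo; have [-> _] := cc_dist cc Vv vo0. Qed.

Lemma corner_circ a : nrm2 (a - v) = nrm2 (a0 - v) -> a <> a0 ->
  a - v = circ_dir (a0 - v) (K a).
Proof. by move=> h an; rewrite -{1}(ctgK h an) /circ /circ_dir addrAC subrr add0r. Qed.

Lemma corners_neq o : o \in nb v -> lft o v <> lft v o.
Proof.
move=> vo E; have := cc_crs cc Vv vo; rewrite E /crs; rewrite [X in X - _]mulrC subrr.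
by rewrite ltxx.
Qed.

Lemma K_lt o : o \in nb v -> lft o v <> a0 -> lft v o <> a0 -> K (lft v o) < K (lft o v).
Proof.
move=> vo h1 h2; have [n1 n2] := corner_nrm2 vo.
rewrite -(orient_ctg D0 n1 n2 h1 h2) orient_rot.
by apply: (cc_empty cc Vv vo vo0); apply: nesym.
Qed.

Variable m : cplx R.
Hypothesis hm : dir_sqrt 1 m (a0 - v).

Lemma delta_m : delta = nrm2 m.
Proof.
have [h _] := cc_dist cc Vv vo0.
have : nrm2 m ^+ 2 = delta ^+ 2.
  by rewrite -h; case: hm => hx hy; rewrite [in RHS]/nrm2 hx hy /nrm2; ring.
by move=> E; apply/eqP; rewrite -(eqrXn2 (n := 2)) ?nrm2_ge0 ?(ltW delta0) // E.
Qed.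

Lemma rel_yz D a : nrm2 (a - v) = nrm2 (a0 - v) -> a <> a0 -> edge_rel delta (a - v) D ->
  yz m D (K a) = 0.
Proof.
move=> h an rel; rewrite yzE.
apply: (edge_rel_sqrt (circ_dir_sqrt hm (K a)) _ delta0); first by rewrite circ_root_nrm2 -delta_m.
by rewrite -corner_circ.
Qed.

Lemma rel_pz D : edge_rel delta (a0 - v) D -> pz m D = 0.
Proof. by apply: (edge_rel_sqrt hm _ delta0); rewrite mul1r -delta_m. Qed.

Lemma yzB F F' k : yz m (F - F') k = yz m F k - yz m F' k.
Proof. by rewrite /yz /pz /qz !cE; ring. Qed.
Lemma pzB F F' : pz m (F - F') = pz m F - pz m F'.
Proof. by rewrite /pz !cE; ring. Qed.

Lemma hol_yz o o' : o \in nb v -> o' \in nb v -> lft o' v = lft v o -> lft v o <> a0 ->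
  yz m (Fs o) (K (lft v o)) = yz m (Fs o') (K (lft v o)).
Proof.
move=> vo vo' E an; have [_ n2] := corner_nrm2 vo.
by apply/eqP; rewrite -subr_eq0 -yzB; apply/eqP/rel_yz => //; apply: hol.
Qed.

Lemma hol_pz o o' : o \in nb v -> o' \in nb v -> lft o' v = lft v o -> lft v o = a0 ->
  pz m (Fs o) = pz m (Fs o').
Proof.
move=> vo vo' E an; apply/eqP; rewrite -subr_eq0 -pzB; apply/eqP/rel_pz.
by rewrite -an; apply: hol.
Qed.

(** Expanding the square leaves two corrections: the sum of the chords around [v], and the discrete
    contour integral of [Fs] along them. Both vanish. *)
Lemma sum_shift_sq (c : cplx R) :
  \sum_(o <- nb v) Re (Fs o ^+ 2 * (lft v o - lft o v)) =
  \sum_(o <- nb v) Re ((Fs o - c) ^+ 2 * (lft v o - lft o v)).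
Proof.
have z1 : \sum_(o <- nb v) (lft v o - lft o v) = 0.
  by rewrite sumrB (telescope_nb cc (fun z => z) Vv) subrr.
have z2 : \sum_(o <- nb v) Fs o * (lft v o - lft o v) = 0.
  (* The added term is i delta times the conjugate of [Fs o]; the edge relation says that the total
     is the same for the two rhombi at an edge. *)
  rewrite -[RHS](telescope_edges (phi := fun o a => Fs o * (a - v) +
    Complex (delta * Im (Fs o)) (delta * Re (Fs o)))).
    by apply: eq_bigr => o _; ring.
  move=> o o' vo vo' E; rewrite E; apply/eqP; rewrite -subr_eq0; apply/eqP.
  have [r1 r2] := hol vo vo' E.
  apply: cplx_eq; rewrite !cE [RHS]/=; move: r1 r2; rewrite !(cReD, cReN, cImD, cImN) => r1 r2.
    by rewrite -[RHS]r2 /=; ring.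
  by rewrite -[RHS]r1 /=; ring.
have Radd : {morph (fun z : cplx R => Re z) : y z / y + z} by move=> y z; rewrite cReD.
have Rsum (G : cplx R -> cplx R) : \sum_(o <- nb v) Re (G o) = Re (\sum_(o <- nb v) G o).
  by rewrite (big_morph _ Radd (erefl : Re (0 : cplx R) = 0)).
rewrite !Rsum; congr complex.Re.
transitivity (\sum_(o <- nb v) ((Fs o - c) ^+ 2 * (lft v o - lft o v) +
    2 * c * (Fs o * (lft v o - lft o v)) - c ^+ 2 * (lft v o - lft o v))).
  by apply: eq_bigr => o _; ring.
by rewrite !big_split /= sumrN -!mulr_sumr z1 z2 !mulr0 subr0 addr0.
Qed.

(** Shifting the value at [o0] to 0 removes the rhombus that starts at the cut [a0]; the other terms
    are bounded below by [picone], whose bounds telescope. *)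
Lemma sum_sq_ge0 : 0 <= \sum_(o <- nb v) Re (Fs o ^+ 2 * (lft v o - lft o v)).
Proof.
rewrite (sum_shift_sq (Fs o0)).
pose G o := Fs o - Fs o0.
have GB o o' : G o - G o' = Fs o - Fs o' by rewrite /G; ring.
pose phi o a := if a == a0 then 0 else gz m (G o) (K a).
rewrite -[X in X <= _](telescope_edges (phi := phi)).
  rewrite big_seq [X in _ <= X]big_seq ler_sum // => o vo; rewrite -/(G o).
  have [n1 n2] := corner_nrm2 vo.
  have [Ea|/eqP na] := eqVneq (lft o v) a0.
    have Eo : o = o0 by apply: (cc_injr cc Vv vo vo0).
    have G0 : G o = 0 by rewrite /G Eo subrr.
    rewrite G0 expr0n mul0r /= {2}/phi Ea eqxx subr0 /phi.
    by case: ifP => _ //; rewrite G0 /gz /yz /pz /qz /= !mulr0 ?subr0 ?addr0 ?mul0r ?subr0 ?expr0n ?mulr0 ?mul0r.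
  have [Eb|/eqP nb'] := eqVneq (lft v o) a0.
    have p0 : pz m (G o) = 0.
      by rewrite /G pzB (hol_pz vo vo0 _ Eb) ?subrr //; rewrite Eb.
    have -> : lft v o - lft o v = (a0 - v) - (lft o v - v) by rewrite Eb; ring.
    rewrite mulrBr cReD cReN (Re_sqr_base hm) (corner_circ n1 na) (Re_sqr_circ hm) p0.
    rewrite /phi Eb eqxx; move/eqP: na => /negPf ->.
    by rewrite le_eqVlt; apply/orP; left; apply/eqP; ring.
  have -> : lft v o - lft o v = (lft v o - v) - (lft o v - v) by ring.
  rewrite (corner_circ n1 na) (corner_circ n2 nb') /phi.
  move/eqP: (na) => /negPf ->; move/eqP: (nb') => /negPf ->.
  exact: (picone hm (G o) (K_lt vo na nb')).
move=> o o' vo vo' E; rewrite /phi E; case: eqP => // an.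
have [_ n2] := corner_nrm2 vo.
rewrite /gz; suff -> : yz m (G o) (K (lft v o)) = yz m (G o') (K (lft v o)) by [].
by rewrite /G !yzB (hol_yz vo vo' E an).
Qed.

(* Going once around [v] from [a0] changes the sign of the square root of the
   direction, so the signed projections cannot keep a constant sign. *)
Lemma exists_bad : exists2 o, o \in nb v &
  delta * Im (Fs o ^+ 2 * (o - v)) + nrm2 (Fs o) * (delta ^+ 2 + dot (lft o v - v) (lft v o - v)) <= 0.
Proof.
apply: contrapT => N.
have pos o : o \in nb v -> 0 < nrm2 m * Im (Fs o ^+ 2 * ((lft o v - v) + (lft v o - v))) +
    nrm2 (Fs o) * (nrm2 m ^+ 2 + dot (lft o v - v) (lft v o - v)).
  move=> vo; rewrite -(opp_corner delta) -delta_m ltNge; apply/negP => h.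
  by apply: N; exists o.
pose P := pz m (Fs o0).
have m0 : 0 < nrm2 m by rewrite -delta_m.
have inner o : o \in nb v -> lft o v <> a0 -> lft v o <> a0 ->
    0 < yz m (Fs o) (K (lft o v)) * yz m (Fs o) (K (lft v o)).
  move=> vo na nb'; have [n1 n2] := corner_nrm2 vo; have := pos o vo.
  have := cc_crs cc Vv vo; have lt := K_lt vo na nb'.
  rewrite (corner_circ n1 na) (corner_circ n2 nb') (bad_circ hm).
  move: lt; set ka := K (lft o v); set kb := K (lft v o) => lt c0.
  have kk : 0 < 1 + ka * kb.
    move: c0; have -> : crs (circ_dir (a0 - v) ka) (circ_dir (a0 - v) kb) =
      2 * nrm2 (a0 - v) * ((ka - kb) * (1 + ka * kb)) / ((ka ^+ 2 + 1) * (kb ^+ 2 + 1)).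
      by rewrite /crs /circ_dir /nrm2 !cE /=; field; rewrite !sq1_neq0.
    rewrite pmulr_lgt0 ?invr_gt0; last by rewrite mulr_gt0 ?sq1_gt0.
    by rewrite pmulr_rgt0; [rewrite pmulr_rgt0 // subr_gt0|rewrite mulr_gt0].
  rewrite pmulr_lgt0 ?invr_gt0; last by rewrite mulr_gt0 ?sq1_gt0.
  by rewrite pmulr_rgt0 //; apply: mulr_gt0 kk; rewrite mulr_gt0.
have first o : o \in nb v -> lft o v = a0 -> lft v o <> a0 ->
    0 < pz m (Fs o) * yz m (Fs o) (K (lft v o)).
  move=> vo Ea nb'; have [n1 n2] := corner_nrm2 vo; have := pos o vo.
  have := cc_crs cc Vv vo.
  rewrite Ea (corner_circ n2 nb') (bad_base hm).
  set kb := K (lft v o) => c0.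
  have kk : 0 < kb.
    move: c0; have -> : crs (a0 - v) (circ_dir (a0 - v) kb) =
      2 * nrm2 (a0 - v) * kb / (kb ^+ 2 + 1).
      by rewrite /crs /circ_dir /nrm2 !cE /=; field; rewrite !sq1_neq0.
    rewrite pmulr_lgt0 ?invr_gt0 ?sq1_gt0 //.
    by rewrite pmulr_rgt0 //; rewrite mulr_gt0.
  rewrite pmulr_lgt0 ?invr_gt0 ?sq1_gt0 //.
  by rewrite pmulr_rgt0 //; apply: mulr_gt0 kk; rewrite mulr_gt0.
have last o : o \in nb v -> lft v o = a0 -> lft o v <> a0 ->
    pz m (Fs o) * yz m (Fs o) (K (lft o v)) < 0.
  move=> vo Eb na; have [n1 n2] := corner_nrm2 vo; have := pos o vo.
  have := cc_crs cc Vv vo.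
  rewrite Eb (corner_circ n1 na) [X in Im (_ * X)]addrC.
  have -> : dot (circ_dir (a0 - v) (K (lft o v))) (a0 - v) =
    dot (a0 - v) (circ_dir (a0 - v) (K (lft o v))) by rewrite /dot; ring.
  rewrite (bad_base hm).
  set ka := K (lft o v) => c0.
  have kk : 0 < - ka.
    move: c0; have -> : crs (circ_dir (a0 - v) ka) (a0 - v) =
      2 * nrm2 (a0 - v) * (- ka) / (ka ^+ 2 + 1).
      by rewrite /crs /circ_dir /nrm2 !cE /=; field; rewrite !sq1_neq0.
    rewrite pmulr_lgt0 ?invr_gt0 ?sq1_gt0 //.
    by rewrite pmulr_rgt0 //; rewrite mulr_gt0.
  rewrite pmulr_lgt0 ?invr_gt0 ?sq1_gt0 //.
  set y := pz _ _ * _; have -> : 4 * nrm2 m * ka * y = 4 * nrm2 m * (- ka) * (- y) by ring.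
  by rewrite pmulr_rgt0 ?oppr_gt0 //; apply: mulr_gt0 kk; rewrite mulr_gt0.
(* Rhombi whose component at the right corner has the sign opposite to [P]. The last one before
   returning to [a0] is bad; the predecessor of the first bad one is ruled out by [first] if it
   starts at [a0], and is itself bad by [inner] otherwise. *)
pose bad := [seq o <- nb v | (lft o v != a0) && (P * yz m (Fs o) (K (lft o v)) < 0)].
have [ o1 vo1 E1] := nb_prev vo0.
have na1 : lft o1 v <> a0 by move=> h; apply: (corners_neq vo1); rewrite h E1.
have bad1 : o1 \in bad.
  rewrite mem_filter vo1 andbT; apply/andP; split; first exact/eqP.
  have PE : pz m (Fs o1) = P by apply: (hol_pz vo1 vo0) => //; rewrite E1.
  by rewrite -PE; apply: last.
have [ o ob omax] := seq_argmax (fun o => K (lft o v)) bad1.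
move: (ob); rewrite mem_filter => /andP[/andP[/eqP na ylt] vo].
have [ o' vo' E'] := nb_prev vo.
have yE : yz m (Fs o') (K (lft o v)) = yz m (Fs o) (K (lft o v)).
  by rewrite -E'; apply: hol_yz; rewrite ?E'.
have [Ea|/eqP na'] := eqVneq (lft o' v) a0.
  have Eo : o' = o0 by apply: (cc_injr cc Vv vo' vo0).
  have := first o' vo' Ea; rewrite E' yE => /(_ na); rewrite Eo -/P => h.
  by have := lt_trans h ylt; rewrite ltxx.
have := inner o' vo' na'; rewrite E' yE => /(_ na) h.
have ltK := K_lt vo' na'; rewrite E' in ltK.
have bad' : o' \in bad.
  rewrite mem_filter vo' andbT; apply/andP; split; first exact/eqP.
  move: h ylt; set y' := yz _ (Fs o') _; set y := yz _ (Fs o) _ => h ylt.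
  rewrite ltNge; apply/negP => h2.
  have : 0 <= (P * y') * (P * - y) by rewrite mulr_ge0 // mulrN oppr_ge0 ltW.
  have -> : (P * y') * (P * - y) = - (P ^+ 2 * (y' * y)) by ring.
  rewrite oppr_ge0 => h3; have PP : P != 0 by apply/eqP => P0; move: ylt; rewrite P0 mul0r ltxx.
  by move: h3; rewrite leNgt mulr_gt0 // exprn_even_gt0.
by have := omax o' bad'; rewrite leNgt ltK.
Qed.
End Base.

(** By [tanw_Re] and [tanw_Im], tanw v o * (o - v) is - i times the chord, so the sum is the
    opposite of the one in [sum_sq_ge0]. *)
Theorem star_super : \sum_(o <- nb v) tanw v o * Im (Fs o ^+ 2 * (o - v)) <= 0.
Proof.
have [ o0 vo0] := cc_nonempty cc Vv.
have [m hm] := exists_sqrt (lft o0 v - v).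
have := sum_sq_ge0 vo0 hm; rewrite -oppr_le0 -sumrN; congr (_ <= 0).
apply: eq_bigr => o _.
have ex := tanw_Re delta v o; have ey := tanw_Im delta v o.
have -> : tanw v o * Im (Fs o ^+ 2 * (o - v)) =
    Re (Fs o ^+ 2) * (tanw v o * (Im o - Im v)) + Im (Fs o ^+ 2) * (tanw v o * (Re o - Re v)).
  by rewrite !cE; ring.
by rewrite ex ey !(cReM, cImM, cReD, cImD, cReN, cImN); ring.
Qed.

Theorem star_bad : exists2 o, o \in nb v &
  kap * delta * nrm2 (Fs o) <= - Im (Fs o ^+ 2 * (o - v)).
Proof.
have [ o0 vo0] := cc_nonempty cc Vv.
have [m hm] := exists_sqrt (lft o0 v - v).
have [ o vo h] := exists_bad vo0 hm; exists o => //.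
have := cc_dot cc Vv vo; rewrite ler_norml => /andP[d1 _].
have n0 := nrm2_ge0 (Fs o).
rewrite -(ler_pM2l delta0).
have : nrm2 (Fs o) * (kap * delta ^+ 2) <= nrm2 (Fs o) *
    (delta ^+ 2 + dot (lft o v - v) (lft v o - v)) by rewrite ler_wpM2l //; lra.
by rewrite mulrN expr2; lra.
Qed.
End Star.

(** * The primitive H *)

Section Projection.
Variable R : realType.
Implicit Types (u w X : cplx R) (delta : R).

Lemma Proj_edge delta u w X : 0 < delta -> nrm2 (w - u) = delta ^+ 2 ->
  Proj X (edge_dir u w) =
  Complex ((Re X - (Re X * Im (w - u) + Im X * Re (w - u)) / delta) / 2)
          ((Im X - (Re X * Re (w - u) - Im X * Im (w - u)) / delta) / 2).
Proof.
move=> d0 h; set z := ii * (w - u).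
have nz : nrm2 z = delta ^+ 2 by rewrite -h /z /nrm2 !cE /=; ring.
have E2 : edge_dir u w ^+ 2 = z^-1 by rewrite /edge_dir exprVn sqrtCK.
have En : `|edge_dir u w| ^+ 2 = rc delta^-1 :> cplx R.
  rewrite -normrX E2 normrV ?unitfE; last first.
    by apply/eqP => z0; move: nz; rewrite z0 /nrm2 /= expr0n addr0 => /esym/eqP; rewrite sqrf_eq0 gt_eqF.
  rewrite normcE -/(nrm2 z) nz sqrtr_sqr ger0_norm ?(ltW d0) //.
  by rewrite invcE /rc /=; apply: cplx_eq => /=; rewrite expr0n /= addr0; field; rewrite gt_eqF.
have dn : delta != 0 by rewrite gt_eqF.
have E3 : z^-1 / (2 * rc delta^-1) = Complex (- Im (w - u) / (2 * delta)) (- Re (w - u) / (2 * delta)) :> cplx R.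
  have -> : (2 * rc delta^-1)^-1 = rc (delta / 2) :> cplx R.
    rewrite two_rc -rcM invcE /rc; apply: cplx_eq => /=; rewrite ?expr0n /= ?addr0.
      by field.
    by rewrite oppr0 mul0r.
  by rewrite invcE -/(nrm2 z) nz /z; apply: cplx_eq; rewrite !cE /=; field.
by rewrite /Proj E2 En -mulrA E3 conjcE; apply: cplx_eq; rewrite !cE /=; field.
Qed.

(** Frees the increments of [H] from square roots and makes them affine in the edge vector. *)
Lemma Proj_edge_nrm2 delta u w X : 0 < delta -> nrm2 (w - u) = delta ^+ 2 ->
  2 * delta * cabs (Proj X (edge_dir u w)) ^+ 2 = delta * nrm2 X - Im (X ^+ 2 * (w - u)).
Proof.
move=> d0 h; rewrite (Proj_edge X d0 h) cabs_sq /nrm2 /=.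
rewrite expr2 [in RHS]cImM [in RHS]cReM [in RHS]cImM.
have h' : Re (w - u) ^+ 2 + Im (w - u) ^+ 2 = delta ^+ 2 by [].
move: h'; set ax := Re (w - u); set ay := Im (w - u) => h'.
have dn : delta != 0 by rewrite gt_eqF.
apply: (mulfI dn); apply/eqP; rewrite -subr_eq0.
have -> : delta * (2 * delta * (((Re X - (Re X * ay + Im X * ax) / delta) / 2) ^+ 2 +
    ((Im X - (Re X * ax - Im X * ay) / delta) / 2) ^+ 2)) -
  delta * (delta * (Re X ^+ 2 + Im X ^+ 2) - ((Re X * Re X - Im X * Im X) * ay +
    (Re X * Im X + Im X * Re X) * ax)) =
  (Re X ^+ 2 + Im X ^+ 2) * ((ax ^+ 2 + ay ^+ 2) - delta ^+ 2) / 2 by field.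
by rewrite h' subrr mulr0 mul0r.
Qed.

(** The edge has opposite directions seen from [u] and from [w], and the factor i compensates. As
    i^2 = -1, one star theorem yields superharmonicity at centers and subharmonicity at vertices. *)
Lemma Proj_eq_rel delta u w X X' : 0 < delta -> nrm2 (w - u) = delta ^+ 2 ->
  Proj X (edge_dir u w) = Proj X' (edge_dir u w) ->
  edge_rel delta (u - w) (X - X') /\ edge_rel delta (w - u) (ii * X - ii * X').
Proof.
move=> d0 h; rewrite (Proj_edge X d0 h) (Proj_edge X' d0 h) => -[e1 e2].
have dn : delta != 0 by rewrite gt_eqF.
have {}e1 : delta * (Re X - Re X') - (Im w - Im u) * (Re X - Re X') - (Re w - Re u) * (Im X - Im X') = 0.
  apply/eqP; rewrite -(subrr (2 * delta * ((Re X - (Re X * Im (w - u) + Im X * Re (w - u)) / delta) / 2))).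
  by rewrite {2}e1 !cE; apply/eqP; field.
have {}e2 : delta * (Im X - Im X') - (Re w - Re u) * (Re X - Re X') + (Im w - Im u) * (Im X - Im X') = 0.
  apply/eqP; rewrite -(subrr (2 * delta * ((Im X - (Re X * Re (w - u) - Im X * Im (w - u)) / delta) / 2))).
  by rewrite {2}e2 !cE; apply/eqP; field.
rewrite /edge_rel !cE /= ?mul0r; split; split.
- by rewrite -[RHS]e1; ring.
- by rewrite -[RHS]e2; ring.
- by move/(congr1 -%R): e2; rewrite oppr0 => <-; ring.
- by rewrite -[RHS]e1; ring.
Qed.

Lemma Im_sqr_le X (e : cplx R) : `|Im (X ^+ 2 * e)| <= nrm2 X * cabs e.
Proof.
have h : nrm2 (X ^+ 2 * e) = (nrm2 X * cabs e) ^+ 2.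
  by rewrite exprMn cabs_sq /nrm2 !expr2 !cE; ring.
rewrite -ler_sqr ?nnegrE ?mulr_ge0 ?nrm2_ge0 ?cabs_ge0 // real_normK ?num_real // -h.
by rewrite /nrm2 lerDr sqr_ge0.
Qed.
End Projection.

Section RhombusEdges.
Variable R : realType.
Variables (delta : R) (G : geom_graph R).
Implicit Types (u w z : cplx R).

Lemma rhombus_flip u w u' w' : rhombus delta G u w u' w' -> rhombus delta G u w' u' w.
Proof.
move=> [V [d d'] n1 n2 [f ff E]]; split => //; first exact: nesym.
exists f => //; rewrite E; apply/seteqP; split => x /= [[[->|->]|->]|->].
- by left; left; left.
- by right.
- by left; right.
- by left; left; right.
- by left; left; left.
- by right.
- by left; right.
- by left; left; right.
Qed.

Lemma rhombus_turn u w u' w' : rhombus delta G u w u' w' -> rhombus delta G u' w u w'.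
Proof.
move=> [[V V'] d n1 n2 [f ff E]]; split => //; first exact: nesym.
exists f => //; rewrite E; apply/seteqP; split => x /= [[[->|->]|->]|->].
- by left; right.
- by left; left; right.
- by left; left; left.
- by right.
- by left; right.
- by left; left; right.
- by left; left; left.
- by right.
Qed.

Lemma rhombus_edges u w u' w' : rhombus delta G u w u' w' ->
  [/\ rhombus_edge delta G ((u + u') / 2) u w, rhombus_edge delta G ((u + u') / 2) u w',
      rhombus_edge delta G ((u + u') / 2) u' w & rhombus_edge delta G ((u + u') / 2) u' w'].
Proof.
move=> h; split; [exists u', w'|exists u', w|exists u, w'|exists u, w]; split => //.
- exact: rhombus_flip.
- exact: rhombus_turn.
- by rewrite addrC.
- exact/rhombus_flip/rhombus_turn.
- by rewrite addrC.
Qed.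
End RhombusEdges.

Lemma chord_le (R : realType) (D t k : R) : 0 < D -> 0 < k -> t <= (1 - k) * D ->
  D + D + 2 * t <= 2 ^+ 2 * D * (1 - k / 4) ^+ 2.
Proof. nra. Qed.

Section Primitive.
Variable R : realType.
Variables (eta delta : R) (G : geom_graph R).
Hypothesis eta0 : 0 < eta.
Hypothesis delta0 : 0 < delta.
Hypothesis iG : isoradial delta G.
Hypothesis aG : rhombi_angles_in delta G eta (pi - eta).
Variables (v0 : cplx R) (r : R) (F : cplx R -> cplx R) (H : cplx R -> R).
Hypothesis Fhol : s_holomorphic delta G (Bdiamond delta G v0 r) F.
Hypothesis Hint : Im_int_sq delta G (Bdiamond delta G v0 r) F H.
Hypothesis Hpos : forall v, BLambda delta G v0 r v -> 0 <= H v.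
Implicit Types (u w o v z : cplx R).
Notation bd := (bd delta G).
Notation inc := (incident delta G).
Notation dual := (dual_vert delta G).
Notation kap := (angle_gap eta).
Notation gnb := (gnb delta0 iG).
Notation dnb := (dnb_seq delta0 iG).
Notation near v := (cabs (v - v0) < r).
Notation lft := (lft delta).
Let gcc := gamma_class eta0 delta0 iG aG.
Let dcc := dual_class eta0 delta0 iG aG.
Let kap01 := angle_gap_bounds eta0.

Lemma quad_domain u w u' w' x : bd w u' u -> bd w' u u' -> near x ->
  [\/ x = u, x = w, x = u' | x = w'] -> Bdiamond delta G v0 r ((u + u') / 2).
Proof.
move=> B B' nx hx; have [e1 e2 e3 e4] := rhombus_edges (rhombusP delta0 iG B B').
exists x => //; case: hx => ->.
- by exists w; left.
- by exists u; right.
- by exists w; left.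
- by exists u; right.
Qed.

Section Quad.
Variables (u w u' w' x : cplx R).
Hypothesis B : bd w u' u.
Hypothesis B' : bd w' u u'.
Hypothesis nx : near x.
Hypothesis hx : [\/ x = u, x = w, x = u' | x = w'].
Let f := F ((u + u') / 2).
Let zD := quad_domain B B' nx hx.
Let RR := rhombus_edges (rhombusP delta0 iG B B').

Lemma quad_ge0 : [/\ 0 <= H u, 0 <= H w, 0 <= H u' & 0 <= H w'].
Proof.
have [e1 e2 e3 e4] := RR; split; apply: Hpos; exists ((u + u') / 2) => //.
- by exists w; left.
- by exists u; right.
- by exists w; left.
- by exists u; right.
Qed.

Lemma quad_H :
  [/\ H u - H w = delta * nrm2 f - Im (f ^+ 2 * (w - u)),
      H u - H w' = delta * nrm2 f - Im (f ^+ 2 * (w' - u)),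
      H u' - H w = delta * nrm2 f + Im (f ^+ 2 * (w' - u)) &
      H u' - H w' = delta * nrm2 f + Im (f ^+ 2 * (w - u))].
Proof.
have [e1 e2 e3 e4] := RR; have Es := rh_sum B B'.
have nn a b : inc a b -> nrm2 (b - a) = delta ^+ 2.
  by move=> /(inc_cabs delta0) h; rewrite nrm2C -cabs_sq h.
have [_ i1 i2 _] := B; have [_ i3 i4 _] := B'.
rewrite (Hint zD e1) (Hint zD e2) (Hint zD e3) (Hint zD e4).
rewrite !(Proj_edge_nrm2 _ delta0) ?nn //.
have E1 : w - u' = - (w' - u) by rewrite Es; ring.
have E2 : w' - u' = - (w - u) by rewrite Es; ring.
by rewrite E1 E2 !mulrN !cImN !opprK.
Qed.

Lemma quad_opp : H w' - H w = Im (f ^+ 2 * (w' - w)) /\ H u' - H u = Im (f ^+ 2 * (u' - u)).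
Proof.
have [h1 h2 h3 h4] := quad_H; have Es := rh_sum B B'.
have -> : w' - w = (w' - u) - (w - u) by ring.
have -> : u' - u = (w' - u) + (w - u) by rewrite Es; ring.
rewrite (mulrBr _ (w' - u)) (mulrDr _ (w' - u)) !cImD cImN.
by clear Es; split; lra.
Qed.

(** The angle bound shortens the diagonal: |u' - u| <= 2 delta (1 - kap / 4). Adding the increments
    from [u] to [w] and [w'], where [H] >= 0, gives 2 H u >= (kap / 2) delta |f|^2, and delta |f|^2
    controls all other increments. *)
Lemma quad_cmp : [/\ H w <= H u, H w' <= H u, delta * nrm2 f <= 4 / kap * H u,
  H u' <= (1 + 8 / kap) * H u & H u <= H w + 2 * (delta * nrm2 f)].
Proof.
have [k0 k1] := andP kap01.
have [h1 h2 h3 h4] := quad_H; have [p1 p2 p3 p4] := quad_ge0.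
have nn a b : inc a b -> nrm2 (b - a) = delta ^+ 2.
  by move=> /(inc_cabs delta0) h; rewrite nrm2C -cabs_sq h.
have [_ i1 i2 _] := B; have [_ i3 i4 _] := B'.
have m0 : 0 <= delta * nrm2 f by rewrite mulr_ge0 ?nrm2_ge0 // ltW.
have cb a b : inc a b -> cabs (b - a) = delta by rewrite cabsC; exact: inc_cabs.
have := Im_sqr_le f (w - u); have := Im_sqr_le f (w' - u).
rewrite !cb // (mulrC (nrm2 f)) !ler_norml => /andP[b1 b2] /andP[b3 b4].
have c1 : cabs ((w - u) + (w' - u)) <= 2 * delta * (1 - kap / 4).
  have dd : 0 <= 2 * delta * (1 - kap / 4) by rewrite mulr_ge0 ?mulr_ge0 ?(ltW delta0) //; lra.
  rewrite cabs_le // nrm2D !nn //.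
  have [/ler_normlP [_ d1] _] := rhombus_angle eta0 delta0 iG aG B B'.
  by rewrite !exprMn; apply: chord_le; rewrite ?exprn_gt0.
have c2 : Im (f ^+ 2 * (w - u)) + Im (f ^+ 2 * (w' - u)) <= 2 * (delta * nrm2 f) * (1 - kap / 4).
  rewrite -cImD -mulrDr; apply: (le_trans (ler_norm _)); apply: (le_trans (Im_sqr_le _ _)).
  apply: (le_trans (ler_wpM2l (nrm2_ge0 _) c1)); rewrite le_eqVlt; apply/orP; left; apply/eqP; ring.
have c3 : delta * nrm2 f <= 4 / kap * H u.
  rewrite mulrAC ler_pdivlMr //; lra.
move: c3 h1 h2 h3 h4 b1 b2 b3 b4 p1 p2 p3 p4.
have -> : (1 + 8 / kap) * H u = H u + 2 * (4 / kap * H u) by ring.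
by split => //; lra.
Qed.
End Quad.

Lemma opp_cmp u w u' w' : bd w u' u -> bd w' u u' -> near u -> H u' <= (1 + 8 / kap) * H u.
Proof. by move=> B B' n; have [] := quad_cmp B B' n (Or41 _ _ _ erefl). Qed.

Lemma edge_cmp u w : inc u w -> near u \/ near w -> [/\ 0 <= H w & H w <= H u].
Proof.
move=> i n; have [u' B] := bd_prev delta0 iG i; have B' := bd_refl delta0 iG B.
case: n => n.
  have h := Or41 (u = w) (u = u') (u = u' + u - w) (erefl u).
  by have [_ ? _ _] := quad_ge0 B B' n h; have [? _ _ _ _] := quad_cmp B B' n h.
have h := Or42 (w = u) (w = u') (w = u' + u - w) (erefl w).
by have [_ ? _ _] := quad_ge0 B B' n h; have [? _ _ _ _] := quad_cmp B B' n h.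
Qed.

Lemma gamma_star u o o' : gvert G u -> near u -> o \in gnb u -> o' \in gnb u ->
  lft o' u = lft u o ->
  edge_rel delta (lft u o - u) (ii * F ((u + o) / 2) - ii * F ((u + o') / 2)).
Proof.
move=> Gu n uo uo' E; have [B B'] := gedge_bds uo; have [C C'] := gedge_bds uo'.
have z1 := quad_domain B B' n (Or41 _ _ _ erefl).
have z2 := quad_domain C C' n (Or41 _ _ _ erefl).
have [_ e2 _ _] := rhombus_edges (rhombusP delta0 iG B B').
have [e3 _ _ _] := rhombus_edges (rhombusP delta0 iG C C').
rewrite E in e3; have [_ h] := cc_dist gcc Gu uo.
by have [] := Proj_eq_rel delta0 h (Fhol z1 z2 e2 e3).
Qed.

Lemma dual_star w o o' : dual w -> near w -> o \in dnb w -> o' \in dnb w ->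
  lft o' w = lft w o ->
  edge_rel delta (lft w o - w) (F ((w + o) / 2) - F ((w + o') / 2)).
Proof.
move=> Dw n wo wo' E; have [B B' s1] := dnb_bds wo; have [C C' s2] := dnb_bds wo'.
have z1 := quad_domain B B' n (Or42 _ _ _ erefl).
have z2 := quad_domain C C' n (Or42 _ _ _ erefl).
have [e1 _ _ _] := rhombus_edges (rhombusP delta0 iG B B').
have [_ _ e3 _] := rhombus_edges (rhombusP delta0 iG C C').
have Z1 : w + o = lft w o + lft o w by rewrite {1}s1; ring.
have Z2 : w + o' = lft w o' + lft o' w by rewrite {1}s2; ring.
rewrite E in e3; have [_ h] := cc_dist dcc Dw wo.
rewrite Z1 Z2; apply: (proj1 (Proj_eq_rel delta0 _ _)); first by rewrite nrm2C.
by rewrite E in z2 *; exact: (Fhol z1 z2 e1 e3).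
Qed.

Lemma H_subharmonic u : gvert G u -> near u -> 0 <= Lap delta gnb H u.
Proof.
move=> Gu n; have := star_super delta0 gcc Gu (fun o o' => @gamma_star u o o' Gu n).
rewrite /Lap -oppr_ge0 -sumrN; rewrite big_seq [X in _ -> 0 <= X]big_seq.
congr (_ <= _); apply: eq_bigr => o uo; have [B B'] := gedge_bds uo.
have [_ ->] := quad_opp B B' n (Or41 _ _ _ erefl).
rewrite -mulrN; congr (_ * _); rewrite -cImN; congr Im.
have -> : (ii * F ((u + o) / 2)) ^+ 2 = - F ((u + o) / 2) ^+ 2.
  by apply: cplx_eq; rewrite !expr2 !cE /=; ring.
by rewrite mulNr opprK.
Qed.

Lemma H_diff_dual w o : dual w -> near w -> o \in dnb w ->
  H o - H w = Im (F ((w + o) / 2) ^+ 2 * (o - w)).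
Proof.
move=> Dw n wo; have [B B' s1] := dnb_bds wo.
have [-> _] := quad_opp B B' n (Or42 _ _ _ erefl).
by have -> : w + o = lft w o + lft o w by rewrite {1}s1; ring.
Qed.

Lemma H_superharmonic w : dual w -> near w -> Lap delta dnb H w <= 0.
Proof.
move=> Dw n; have := star_super delta0 dcc Dw (fun o o' => @dual_star w o o' Dw n).
rewrite /Lap big_seq [X in _ -> X <= _]big_seq.
by congr (_ <= _); apply: eq_bigr => o wo; rewrite -H_diff_dual.
Qed.

(** The factor 1 + 2 / k pays for the first corner at a center, 1 + 8 / k for each step to the next
    corner, with at most [cells (2 / k)] corners. *)
Definition star_const (k : R) : R := (1 + 8 / k) ^+ cells (2 / k) * (1 + 2 / k).

Lemma star_const_ge1 k : 0 < k -> 1 + 8 / k <= star_const k /\ 1 <= star_const k.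
Proof.
move=> k0; have a : 0 <= 8 / k by rewrite divr_ge0 // ltW.
have b : 0 <= 2 / k by rewrite divr_ge0 // ltW.
have c : 1 + 8 / k <= star_const k.
  have : (0 < cells (2 / k))%N by rewrite expn_gt0.
  rewrite /star_const; case: (cells (2 / k)) => // n _; rewrite exprS -mulrA ler_peMr //; first by lra.
  by rewrite mulr_ege1 ?exprn_ege1 //; lra.
by split => //; lra.
Qed.

Lemma star_cmp u w : inc u w -> near w -> H u <= star_const kap * H w.
Proof.
move=> i n; have [k0 k1] := andP kap01.
have [Dw _ _] := incidentE i.
have [ o wo bad] := star_bad delta0 dcc Dw (fun o o' => @dual_star w o o' Dw n).
have [B B' s1] := dnb_bds wo.
have hw := Or42 (w = lft w o) (w = lft o w) (w = o) (erefl w).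
have [p1 p2 p3 p4] := quad_ge0 B B' n hw.
have [_ _ _ _ q5] := quad_cmp B B' n hw.
rewrite -H_diff_dual // in bad.
have Z1 : (w + o) / 2 = (lft w o + lft o w) / 2 by congr (_ / 2); rewrite {1}s1; ring.
rewrite Z1 in bad; set a0 := lft w o in q5.
(* The rhombus from [star_bad] satisfies kap * delta * |F|^2 <= H w - H o <= H w. *)
have start : H a0 <= (1 + 2 / kap) * H w.
  have h : delta * nrm2 (F ((lft w o + lft o w) / 2)) <= H w / kap.
    by rewrite ler_pdivlMr //; move: bad p4; rewrite -mulrA mulrC; lra.
  have -> : (1 + 2 / kap) * H w = H w + 2 * (H w / kap) by ring.
  by apply: (le_trans q5); lra.
pose P k u := H u <= (1 + 8 / kap) ^+ k * ((1 + 2 / kap) * H w).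
have e0 : 0 <= 8 / kap by rewrite divr_ge0 // ltW.
have f0 : 0 <= (1 + 2 / kap) * H w by rewrite mulr_ge0 // addr_ge0 // divr_ge0 // ltW.
pose s := [seq lft w o | o <- dnb w].
have -> : star_const kap * H w = (1 + 8 / kap) ^+ cells (2 / kap) * ((1 + 2 / kap) * H w) by rewrite mulrA.
have ia0 : inc a0 w by have [] := B.
have ss : (size s <= cells (2 / kap))%N by rewrite size_map; exact: (class_degree delta0 kap01 dcc).
have mono (k l : nat) a : (k <= l)%N -> P k a -> P l a.
  move=> kl h; apply: (le_trans h); rewrite ler_wpM2r // ler_weXn2l //; lra.
apply: (mono _ _ _ ss).
have d2 : 0 < delta ^+ 2 by rewrite exprn_gt0.
have Nn a : inc a w -> nrm2 (a - w) = delta ^+ 2 by move=> /(inc_cabs delta0) h; rewrite -cabs_sq h.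
have Ei a b : bd w a b -> inc a w /\ inc b w by move=> [_ ? ? _].
have em a b c : bd w a b -> inc c w -> c <> a -> c <> b -> 0 < orient a b c by exact: bd_empty.
have pv b : inc b w -> exists a, bd w a b by exact: bd_prev.
have P0 : P 0%N a0 by rewrite /P expr0 mul1r.
have st (k : nat) a b : bd w a b -> P k a -> P k.+1 b.
  move=> ab h; rewrite /P exprS -mulrA.
  have B2 := bd_refl delta0 iG ab.
  have [_ _ _ h4 _] := quad_cmp B2 ab n (Or44 _ _ _ erefl).
  by apply: (le_trans h4); rewrite ler_pM2l //; lra.
have Ns : [set a | inc a w] = [set` s].
  apply/seteqP; split => a /=.
    move=> ia; have [p hp] := bd_prev delta0 iG ia.
    have [m e _] := bd_dnb delta0 iG hp.
    by apply/mapP; exists (p + a - w).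
  by move=> /mapP[ o' wo' ->]; have [[_ _ ? _] _ _] := dnb_bds wo'.
exact: (@cyclic_ind R w (delta ^+ 2) [set a | inc a w] (bd w) d2 Nn Ei em a0 P ia0 P0 pv st mono s Ns u i).
Qed.

Lemma gamma_step v o : gvert G v -> o \in gnb v -> near o -> H v <= star_const kap * H o.
Proof.
move=> Gv vo n; have [k0 k1] := andP kap01; have [B B'] := gedge_bds vo.
have hx := Or43 (o = v) (o = lft o v) (o = lft v o) (erefl o).
have [p1 p2 p3 p4] := quad_ge0 B B' n hx.
have := opp_cmp B' B n; move/le_trans; apply.
by rewrite ler_wpM2r //; have [] := star_const_ge1 k0.
Qed.

Lemma dual_step v o : dual v -> o \in dnb v -> near o -> H v <= star_const kap * H o.
Proof.
move=> Dv vo n; have [B B' _] := dnb_bds vo.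
have hx := Or44 (o = lft v o) (o = v) (o = lft o v) (erefl o).
have [h _ _ _ _] := quad_cmp B B' n hx; apply: (le_trans h).
by apply: star_cmp => //; have [] := B'.
Qed.
End Primitive.

(** * Harnack inequality *)

Lemma sum_fiber_le (R : numDomainType) (S T : eqType) (s : seq S) (t : seq T) (f : S -> T)
    (g : T -> R) (n : nat) : uniq t -> (forall v, v \in s -> f v \in t) ->
  (forall w, w \in t -> 0 <= g w) -> (forall w, w \in t -> (count (fun v => f v == w) s <= n)%N) ->
  \sum_(v <- s) g (f v) <= n%:R * \sum_(w <- t) g w.
Proof.
move=> ut ft g0 cn.
have -> : \sum_(v <- s) g (f v) = \sum_(v <- s) \sum_(w <- t) (if w == f v then g w else 0).
  rewrite big_seq [RHS]big_seq; apply: eq_bigr => v vs.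
  by rewrite -big_mkcond -big_filter (filter_pred1_uniq ut (ft v vs)) big_seq1.
rewrite exchange_big mulr_sumr big_seq [leRHS]big_seq; apply: ler_sum => w wt.
rewrite -big_mkcond big_const_seq iter_addr_0 -[leLHS]mulr_natl ler_wpM2r ?g0 // ler_nat.
by rewrite (eq_count (a2 := fun v => f v == w)) ?cn // => v; exact: eq_sym.
Qed.

Lemma cells_mono (R : realType) (x y : R) : x <= y -> (cells x <= cells y)%N.
Proof. by move=> h; rewrite leq_exp2r // ltnS le_truncn // ler_pM2l. Qed.

Lemma sqr_sum_lt (R : realFieldType) (b r c : R) : 0 <= b -> 0 < r -> 100 * b <= r ->
  0 <= c -> c <= 7 / 10 * r -> c ^+ 2 + b ^+ 2 < (3 / 4 * r) ^+ 2.
Proof.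
move=> b0 r0 br c0 cr.
have h1 : c ^+ 2 <= (7 / 10 * r) ^+ 2 by rewrite ler_sqr ?nnegrE //; lra.
have h2 : b ^+ 2 <= (1 / 100 * r) ^+ 2 by rewrite ler_sqr ?nnegrE //; lra.
by have := exprn_gt0 2 r0; move: h1 h2; rewrite !exprMn; lra.
Qed.

Section Harnack.
Variable R : realType.
Variables (eta delta : R) (G : geom_graph R).
Hypothesis eta0 : 0 < eta.
Hypothesis delta0 : 0 < delta.
Hypothesis iG : isoradial delta G.
Hypothesis aG : rhombi_angles_in delta G eta (pi - eta).
Variables (v0 : cplx R) (r : R) (F : cplx R -> cplx R) (H : cplx R -> R).
Hypothesis Fhol : s_holomorphic delta G (Bdiamond delta G v0 r) F.
Hypothesis Hint : Im_int_sq delta G (Bdiamond delta G v0 r) F H.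
Hypothesis Hpos : forall v, BLambda delta G v0 r v -> 0 <= H v.
Implicit Types (u w o v z : cplx R).
Notation bd := (bd delta G).
Notation inc := (incident delta G).
Notation dual := (dual_vert delta G).
Notation kap := (angle_gap eta).
Notation gnb := (gnb delta0 iG).
Notation dnb := (dnb_seq delta0 iG).
Notation near v := (cabs (v - v0) < r).
Notation B := (star_const kap).
Let gcc := gamma_class eta0 delta0 iG aG.
Let dcc := dual_class eta0 delta0 iG aG.
Let kap01 := angle_gap_bounds eta0.
Let k0 : 0 < kap. Proof. by have /andP[] := kap01. Qed.
Let B1 : 1 <= B. Proof. by have [] := star_const_ge1 k0. Qed.
Let ecmp := edge_cmp eta0 delta0 iG aG Hint Hpos.
Let scmp := star_cmp eta0 delta0 iG aG Fhol Hint Hpos.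

Lemma dual_incident w : dual w -> exists u, inc u w.
Proof. by move=> /(dual_bd delta0 iG) [u [b [_ i _ _]]]; exists u. Qed.

Lemma gamma_ge0 u : gvert G u -> near u -> 0 <= H u.
Proof.
move=> Gu n; have [w i] := vert_incident delta0 iG Gu.
by have [h1 h2] := ecmp i (or_introl n); apply: le_trans h2.
Qed.

Lemma dual_ge0 w : dual w -> near w -> 0 <= H w.
Proof. by move=> /dual_incident[u i] n; have [h1 h2] := ecmp i (or_intror n). Qed.

Lemma gamma_chain x rad v : gvert G x -> gvert G v -> (forall y, cabs (y - x) < rad -> near y) ->
  cabs (v - x) < rad -> H v <= B ^+ cells (rad / (kap * delta)) * H x.
Proof.
move=> Gx Gv sub h; have nx : near x.
  by apply: sub; rewrite subrr cabs0; apply: le_lt_trans h; exact: cabs_ge0.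
apply: (greedy_chain delta0 kap01 gcc Gx B1 (gamma_ge0 Gx nx) _ Gv h).
move=> y o Gy yo hy ho; have n : near o by exact: sub.
exact: (gamma_step eta0 aG Hint Hpos Gy yo n).
Qed.

Lemma dual_chain x rad v : dual x -> dual v -> (forall y, cabs (y - x) < rad -> near y) ->
  cabs (v - x) < rad -> H v <= B ^+ cells (rad / (kap * delta)) * H x.
Proof.
move=> Gx Gv sub h; have nx : near x.
  by apply: sub; rewrite subrr cabs0; apply: le_lt_trans h; exact: cabs_ge0.
apply: (greedy_chain delta0 kap01 dcc Gx B1 (dual_ge0 Gx nx) _ Gv h).
move=> y o Gy yo hy ho; have n : near o by exact: sub.
exact: (dual_step eta0 aG Fhol Hint Hpos Gy yo n).
Qed.

(** At this scale a disc has boundedly many vertices, so a greedy chain inside one colour class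
    suffices, after at most one change of colour at [v1]. Passing from a vertex down to a center
    there costs the extra factor. *)
Lemma harnack_small K v1 : r < K * delta -> gvert (Lambda delta G) v0 ->
  gvert (Lambda delta G) v1 -> cabs (v1 - v0) < r / 2 ->
  H v1 <= B ^+ (cells (K / kap)).+1 * H v0.
Proof.
move=> rK Lv0 Lv1 h1.
have r0 : 0 < r by have := cabs_ge0 (v1 - v0); lra.
have nv0 : near v0 by rewrite subrr cabs0.
have nv1 : near v1 by lra.
have p0 : 0 <= H v0.
  by case: Lv0 => ?; [exact: gamma_ge0|exact: dual_ge0].
have cm : (cells (r / (kap * delta)) <= cells (K / kap))%N.
  apply: cells_mono; rewrite ler_pdivrMr ?mulr_gt0 //.
  have -> : K / kap * (kap * delta) = K * delta by field; rewrite gt_eqF.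
  exact: ltW.
have up : B ^+ cells (r / (kap * delta)) * H v0 <= B ^+ cells (K / kap) * H v0.
  by rewrite ler_wpM2r // ler_weXn2l.
have up1 : B ^+ cells (K / kap) * H v0 <= B ^+ (cells (K / kap)).+1 * H v0.
  by rewrite ler_wpM2r // ler_weXn2l.
have far a b : gvert G a -> dual b -> delta <= cabs (a - b).
  by move=> ga db; rewrite cabs_ge ?(ltW delta0) //; exact: (delaunay delta0 iG ga db).
have id y : near y -> near y by [].
case: Lv0 => T0; case: Lv1 => T1.
- by apply: (le_trans (gamma_chain T0 T1 id nv1)); lra.
(* Vertices and centers are at least [delta] apart, so delta <= |v1 - v0| < r / 2 and a corner at
   distance [delta] from [v1] is still in the disc. *)
- have [u i] := dual_incident T1; have [_ Gu _] := incidentE i.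
  have nu : near u.
    have := cabs_triangle u v1 v0; rewrite (inc_cabs delta0 i).
    by have := far _ _ T0 T1; rewrite cabsC; lra.
  have [_ h2] := ecmp i (or_intror nv1).
  by have := gamma_chain T0 Gu id nu; lra.
have [w i] := vert_incident delta0 iG T1; have [Dw _ _] := incidentE i.
  have nw : near w.
    have := cabs_triangle w v1 v0; rewrite (cabsC w v1) (inc_cabs delta0 i).
    by have := far _ _ T1 T0; lra.
  apply: (le_trans (scmp i nw)); rewrite exprS -mulrA.
  by apply: ler_wpM2l; [exact: le_trans ler01 B1|exact: le_trans (dual_chain T0 Dw id nw) up].
- by apply: (le_trans (dual_chain T0 T1 id nv1)); lra.
Qed.

Definition area_const (k : R) : R := (cells (2 / k))%:R * (8 / k).
(** 2592 = 48 * 6 * 36 / 4, with 48 and 6 from the two barrier theorems, 36 = (SC / SA)^2 from the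
    radii below, and 4 k^2 from two lower bounds on areas. The other factors come from [core_link]
    and [core_near]. *)
Definition core_const (k : R) : R :=
  2592 * area_const k ^+ 2 * star_const k * (cells (2 / k))%:R *
  ((cells ((20 * 1000) / k))%:R * star_const k ^+ cells ((20 * 1000) / k)) / k ^+ 2.

Lemma core_const_ge0 k : 0 < k -> 0 <= core_const k.
Proof.
move=> k_gt0; have [_ S1] := star_const_ge1 k_gt0; have S0 := le_trans ler01 S1.
exact: (divr_ge0 (mulr_ge0 (mulr_ge0 (mulr_ge0 (mulr_ge0 (ler0n R 2592) (sqr_ge0 _)) S0)
  (ler0n R _)) (mulr_ge0 (ler0n R _) (exprn_ge0 _ S0))) (sqr_ge0 k)).
Qed.

Lemma incident_count w (s : seq (cplx R)) (f : cplx R -> cplx R) : dual w -> uniq s ->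
  (forall u, u \in s -> inc u (f u)) -> (count (fun u => f u == w) s <= cells (2 / kap))%N.
Proof.
move=> Dw us fi; apply: leq_trans (class_degree delta0 kap01 dcc Dw).
rewrite -(size_map (fun o => lft delta w o)) -size_filter.
apply: uniq_leq_size; first exact: filter_uniq.
move=> a; rewrite mem_filter => /andP[/eqP fa ains]; have := fi a ains; rewrite fa => ia.
have [p hp] := bd_prev delta0 iG ia; have [m e _] := bd_dnb delta0 iG hp.
by apply/mapP; exists (p + a - w).
Qed.

Section Core.
Variables (u1 w0 : cplx R) (a : R).
Hypothesis a_def : a = 1000 * delta.
Hypothesis Gu1 : gvert G u1.
Hypothesis Dw0 : dual w0.
Hypothesis rbig : 100 * a <= r.
Hypothesis hw0 : cabs (w0 - v0) <= delta.
Hypothesis hu1 : cabs (u1 - v0) < r / 2 + delta.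

(* The [SA]-ball about [u1], enlarged by a few [delta], has to lie in the
   [SC]-ball about [w0], and the latter in the domain of [H]. *)
Notation SA := (r / 8).
Notation SC := (3 / 4 * r).
Notation garea := (area delta gnb).
Notation darea := (area delta dnb).

Ltac slra := have := delta0; have := a_def; have := k0; have := B1; have := rbig; have := hw0; have := hu1; lra.

Lemma core_sub sA : uniq sA ->
  (forall v, v \in sA <-> gvert G v /\ cabs (v - u1) <= SA + 2 * delta) ->
  garea u1 * H u1 <= 48 * a ^+ 2 / SA ^+ 2 * \sum_(v <- sA) garea v * H v.
Proof.
move=> us sP; apply: (mean_value_sub delta0 gcc Gu1 _ _ us sP).
- by rewrite a_def.
- by slra.
- move=> v /sP[Gv h]; apply: gamma_ge0 => //.
  by have := cabs_triangle v u1 v0; slra.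
- move=> v Gv h; apply: (H_subharmonic eta0 delta0 iG aG Fhol Hint) => //.
  by have := cabs_triangle v u1 v0; slra.
Qed.

Lemma core_super sC : uniq sC ->
  (forall v, v \in sC <-> dual v /\ cabs (v - w0) <= SC + 2 * delta) ->
  \sum_(v <- sC | qd w0 a v / SC ^+ 2 < 1) darea v * H v <=
  6 * SC ^+ 2 / a ^+ 2 * \sum_(v <- sC | cabs (v - w0) < 20 * a) darea v * H v.
Proof.
move=> us sP; apply: (weak_harnack_super delta0 dcc _ _ us sP).
- by rewrite a_def.
- by slra.
- move=> v /sP[Gv h]; apply: dual_ge0 => //.
  by have := cabs_triangle v w0 v0; slra.
(* With a = 1000 delta and rho = 20 a, the condition reads 1500000 <= 79 * 20000. *)
- by have := sqr_ge0 delta; rewrite a_def !expr2; lra.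
- move=> v Gv h; apply: (H_superharmonic eta0 delta0 iG aG Fhol Hint) => //.
  by have := cabs_triangle v w0 v0; slra.
Qed.

Lemma core_near sC : uniq sC ->
  (forall v, v \in sC <-> dual v /\ cabs (v - w0) <= SC + 2 * delta) ->
  \sum_(v <- sC | cabs (v - w0) < 20 * a) darea v * H v <=
  (cells ((20 * 1000) / kap))%:R * (area_const kap * delta ^+ 2 * (B ^+ cells ((20 * 1000) / kap) * H w0)).
Proof.
move=> us sP; set P := cells ((20 * 1000) / kap).
have EP : cells (20 * a / (kap * delta)) = P.
  by congr cells; rewrite a_def; field; rewrite !gt_eqF.
have sub y : cabs (y - w0) < 20 * a -> near y.
  by have := cabs_triangle y w0 v0; slra.
have nw0 : near w0 by slra.
have [s [us' s'P s'n]] := class_ball delta0 kap01 dcc w0 (20 * a).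
have sz : (size [seq v <- sC | (cabs (v - w0) < 20 * a)%R] <= P)%N.
  rewrite -EP; apply: leq_trans s'n; apply: uniq_leq_size; first exact: filter_uniq.
  move=> v; rewrite mem_filter => /andP[h /sP[Dv _]]; apply/s'P; split => //; exact: ltW.
have A0 : 0 <= area_const kap * delta ^+ 2.
  by rewrite mulr_ge0 ?sqr_ge0 // mulr_ge0 // divr_ge0 // ltW.
have Q0 : 0 <= area_const kap * delta ^+ 2 * (B ^+ P * H w0).
  by rewrite mulr_ge0 // mulr_ge0 ?(dual_ge0 Dw0 nw0) // exprn_ge0 //; slra.
rewrite -big_filter; apply: (@le_trans _ _
   (\sum_(v <- [seq v <- sC | cabs (v - w0) < 20 * a]) (area_const kap * delta ^+ 2 * (B ^+ P * H w0)))).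
  rewrite big_seq [leRHS]big_seq; apply: ler_sum => v; rewrite mem_filter => /andP[h /sP[Dv _]].
  apply: ler_pM.
  - exact: (area_ge0 dcc Dv).
  - exact: (dual_ge0 Dv (sub _ h)).
  - by have := area_le delta0 kap01 dcc Dv; rewrite mulrA.
  - by have := dual_chain Dw0 Dv sub h; rewrite EP.
rewrite big_const_seq count_predT iter_addr_0 -[leLHS]mulr_natl.
by rewrite ler_wpM2r // ler_nat.
Qed.

(** Each vertex is sent to an incident center, where [star_cmp] compares the values; a center
    receives at most as many vertices as its face has corners. *)
Lemma core_link sA sC : uniq sA -> uniq sC ->
  (forall v, v \in sA <-> gvert G v /\ cabs (v - u1) <= SA + 2 * delta) ->
  (forall v, v \in sC <-> dual v /\ cabs (v - w0) <= SC + 2 * delta) ->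
  2 * kap * \sum_(v <- sA) garea v * H v <=
  area_const kap * B * (cells (2 / kap))%:R *
  \sum_(v <- sC | qd w0 a v / SC ^+ 2 < 1) darea v * H v.
Proof.
move=> uA uC sAP sCP.
have : forall u, exists w, gvert G u -> inc u w.
  move=> u; have [Gu|nGu] := pselect (gvert G u).
    by have [w i] := vert_incident delta0 iG Gu; exists w.
  by exists u.
move=> /choice [f fi].
set t := [seq v <- sC | qd w0 a v / SC ^+ 2 < 1].
have fin v : v \in sA -> [/\ inc v (f v), dual (f v), near (f v), gvert G v & near v].
  move=> /sAP[Gv h]; have i := fi v Gv; have [Df _ _] := incidentE i.
  have h2 := inc_cabs delta0 i; have h3 := cabs_triangle (f v) v v0.
  have h4 := cabs_triangle v u1 v0; rewrite (cabsC (f v) v) in h3.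
  by split => //; slra.
have ft v : v \in sA -> f v \in t.
  move=> vA; have [i Df nf Gv nv] := fin v vA; have /sAP[_ h] := vA.
  have h2 := inc_cabs delta0 i; have h3 := cabs_triangle (f v) v v0.
  have h4 := cabs_triangle v u1 v0; rewrite (cabsC (f v) v) in h3.
  have h5 := cabs_triangle (f v) v0 w0; rewrite (cabsC v0 w0) in h5.
  (* r / 8 + r / 2 plus a few delta stays below 7 / 10 r; the room left up to 3 / 4 r absorbs the
     shift by [a ^+ 2] in [qd]. *)
  have h6 : cabs (f v - w0) <= 7 / 10 * r by slra.
  have SC0 : 0 < SC ^+ 2 by rewrite exprn_gt0 //; slra.
  rewrite mem_filter; apply/andP; split.
    rewrite ltr_pdivrMr // mul1r /qd -cabs_sq.
    have b0 : 0 <= a by slra.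
    have r0 : 0 < r by slra.
    have br : 100 * a <= r by slra.
    exact: (sqr_sum_lt b0 r0 br (cabs_ge0 _) h6).
  by apply/sCP; split => //; slra.
have tP w : w \in t -> dual w /\ near w.
  rewrite mem_filter => /andP[_ /sCP[Dw h]]; split => //.
  by have := cabs_triangle w w0 v0; slra.
have D0 : 0 < delta ^+ 2 by rewrite exprn_gt0.
have A0 : 0 <= area_const kap by rewrite mulr_ge0 // divr_ge0 // ltW.
have e1 : \sum_(v <- sA) garea v * H v <= area_const kap * delta ^+ 2 * (B * \sum_(v <- sA) H (f v)).
  rewrite !mulr_sumr big_seq [leRHS]big_seq; apply: ler_sum => v vA.
  have [i Df nf Gv nv] := fin v vA; apply: ler_pM.
  - exact: (area_ge0 gcc Gv).
  - exact: gamma_ge0.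
  - by have := area_le delta0 kap01 gcc Gv; rewrite mulrA.
  - exact: scmp.
have e2 : \sum_(v <- sA) H (f v) <= (cells (2 / kap))%:R * \sum_(w <- t) H w.
  apply: sum_fiber_le => //; first exact: filter_uniq.
    by move=> w /tP[]; exact: dual_ge0.
  move=> w /tP[Dw _]; apply: incident_count => // v vA.
  by have [] := fin v vA.
have e3 : 2 * kap * delta ^+ 2 * \sum_(w <- t) H w <= \sum_(w <- t) darea w * H w.
  rewrite mulr_sumr big_seq [leRHS]big_seq; apply: ler_sum => w /tP[Dw n].
  by rewrite ler_wpM2r ?dual_ge0 //; exact: (area_ge delta0 kap01 dcc).
rewrite -[X in _ <= _ * X]big_filter -/t.
have B0 : 0 <= B by exact: le_trans ler01 B1.
have c1 : 0 <= kap * area_const kap * delta ^+ 2 * B * 2.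
  exact: (mulr_ge0 (mulr_ge0 (mulr_ge0 (mulr_ge0 (ltW k0) A0) (ltW D0)) B0) (ler0n R 2)).
have c2 : 0 <= area_const kap * B * (cells (2 / kap))%:R.
  exact: (mulr_ge0 (mulr_ge0 A0 B0) (ler0n R _)).
have k2 : 0 <= 2 * kap by exact: (mulr_ge0 (ler0n R 2) (ltW k0)).
apply: (le_trans (ler_wpM2l k2 e1)); apply: le_trans _ (ler_wpM2l c2 e3).
have -> : 2 * kap * (area_const kap * delta ^+ 2 * (B * \sum_(v <- sA) H (f v))) =
    kap * area_const kap * delta ^+ 2 * B * 2 * \sum_(v <- sA) H (f v) by ring.
apply: (le_trans (ler_wpM2l c1 e2)); rewrite le_eqVlt; apply/orP; left; apply/eqP; ring.
Qed.

(** The factors a^2 / SA^2 and SC^2 / a^2 of the two barrier estimates cancel up to (SC / SA)^2, and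
    so do the powers of [delta] from the areas: nothing depends on r / delta. *)
Lemma core : H u1 <= core_const kap * H w0.
Proof.
have [sA [uA sAP _]] := class_ball delta0 kap01 gcc u1 (SA + 2 * delta).
have [sC [uC sCP _]] := class_ball delta0 kap01 dcc w0 (SC + 2 * delta).
have i1 := core_sub uA sAP; have i2 := core_link uA uC sAP sCP.
have i3 := core_super uC sCP; have i4 := core_near uC sCP.
have i5 : 2 * kap * delta ^+ 2 * H u1 <= garea u1 * H u1.
  rewrite ler_wpM2r ?(area_ge delta0 kap01 gcc) //.
  by apply: gamma_ge0 => //; slra.
have D0 : 0 < delta ^+ 2 by rewrite exprn_gt0.
have r0 : 0 < r by slra.
have N0 : 0 <= area_const kap * B * (cells (2 / kap))%:R.
  rewrite mulr_ge0 ?ler0n // mulr_ge0 //; last by slra.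
  by rewrite mulr_ge0 // divr_ge0 // ltW.
have c2 : 0 <= 48 * a ^+ 2 / SA ^+ 2.
  exact: (divr_ge0 (mulr_ge0 (ler0n R 48) (sqr_ge0 a)) (sqr_ge0 SA)).
have c3 : 0 <= 6 * SC ^+ 2 / a ^+ 2.
  exact: (divr_ge0 (mulr_ge0 (ler0n R 6) (sqr_ge0 SC)) (sqr_ge0 a)).
have j := le_trans i3 (ler_wpM2l c3 i4).
have {j}j := le_trans i2 (ler_wpM2l N0 j).
have {j}j := ler_wpM2l c2 j.
have {i1}i1 := le_trans i5 i1.
have k2 : 0 <= 2 * kap by slra.
have {i1}i1 := ler_wpM2l k2 i1.
rewrite [X in _ <= X]mulrCA in i1; have {}j := le_trans i1 j.
rewrite -(ler_pM2l (_ : 0 < 4 * kap ^+ 2 * delta ^+ 2)); last by rewrite !mulr_gt0 ?exprn_gt0.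
have -> : 4 * kap ^+ 2 * delta ^+ 2 * H u1 = 2 * kap * (2 * kap * delta ^+ 2 * H u1) by ring.
have a0 : 0 < a by slra.
apply: (le_trans j); rewrite le_eqVlt; apply/orP; left; apply/eqP; rewrite /core_const.
set A := area_const _; set n := (cells (2 / _))%:R; set m := (cells _)%:R; set b := _ ^+ cells _.
by field; rewrite ?gt_eqF.
Qed.
End Core.

(** [H] is larger on vertices than on adjacent centers, so [v1] may be moved to a vertex and [v0] to
    a center before applying [core]. *)
Lemma harnack_large v1 : 100 * (1000 * delta) <= r -> gvert (Lambda delta G) v0 ->
  gvert (Lambda delta G) v1 -> cabs (v1 - v0) < r / 2 ->
  H v1 <= core_const kap * H v0.
Proof.
move=> rbig Lv0 Lv1 h1.
have d0 := delta0.
have nv0 : near v0 by rewrite subrr cabs0; lra.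
have C0 := core_const_ge0 k0.
have [w0 [Dw0 hw0 le0]] : exists w0, [/\ dual w0, cabs (w0 - v0) <= delta & H w0 <= H v0].
  case: Lv0 => T0; last by exists v0; split => //; rewrite subrr cabs0 ltW.
  have [w i] := vert_incident delta0 iG T0; have [Dw _ _] := incidentE i.
  by exists w; rewrite cabsC (inc_cabs delta0 i); split => //; have [] := ecmp i (or_introl nv0).
have [u1 [Gu1 hu1 le1]] : exists u1, [/\ gvert G u1, cabs (u1 - v0) < r / 2 + delta & H v1 <= H u1].
  case: Lv1 => T1; first by exists v1; split => //; lra.
  have [u i] := dual_incident T1; have [_ Gu _] := incidentE i.
  have n1 : near v1 by lra.
  exists u; split => //; last by have [] := ecmp i (or_intror n1).
  by have := cabs_triangle u v1 v0; rewrite (inc_cabs delta0 i); lra.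
have h := core (erefl (1000 * delta)) Gu1 Dw0 rbig hw0 hu1.
exact: (le_trans le1 (le_trans h (ler_wpM2l C0 le0))).
Qed.
End Harnack.

Theorem proposition3p11 (R : realType) (eta : R) (eta_gt0 : 0 < eta) :
  exists2 C : R, 0 < C &
  forall (delta : R) (G : geom_graph R),
    0 < delta -> isoradial delta G ->
    rhombi_angles_in delta G eta (pi - eta) ->
  forall (v0 : cplx R) (r : R) (F : cplx R -> cplx R) (H : cplx R -> R),
    gvert (Lambda delta G) v0 -> 0 < r ->
    s_holomorphic delta G (Bdiamond delta G v0 r) F ->
    Im_int_sq delta G (Bdiamond delta G v0 r) F H ->
    (forall v, BLambda delta G v0 r v -> 0 <= H v) ->
  forall v1 : cplx R,
    gvert (Lambda delta G) v1 -> cabs (v1 - v0) < r / 2 ->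
    H v1 <= C * H v0.
Proof.
have kap01 := angle_gap_bounds eta_gt0; set k := angle_gap eta in kap01.
have k0 : 0 < k by case/andP: kap01.
have [_ B1] := star_const_ge1 k0.
have B0 : 0 < star_const k ^+ (cells ((100 * 1000) / k)).+1 by rewrite exprn_gt0 //; lra.
have C0 := core_const_ge0 k0.
exists (star_const k ^+ (cells ((100 * 1000) / k)).+1 + core_const k); first by lra.
move=> delta G d0 iG aG v0 r F H Lv0 r0 Fhol Hint Hpos v1 Lv1 h1.
have p0 : 0 <= H v0.
  by case: Lv0 => T; [apply: (gamma_ge0 eta_gt0 d0 iG aG Hint Hpos T)|
    apply: (dual_ge0 eta_gt0 d0 iG aG Hint Hpos T)]; rewrite subrr cabs0.
rewrite mulrDl; have q1 := mulr_ge0 (ltW B0) p0; have q2 := mulr_ge0 C0 p0.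
have [big|small] := leP (100 * (1000 * delta)) r.
  by have := harnack_large eta_gt0 d0 iG aG Fhol Hint Hpos big Lv0 Lv1 h1; rewrite -/k; lra.
rewrite mulrA in small; by have := harnack_small eta_gt0 d0 iG aG Fhol Hint Hpos small Lv0 Lv1 h1; rewrite -/k; lra.
Qed.
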